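(* Let $1\le r\le\omega$. Assume that $(T,\vec\varphi)$, with $\vec\varphi=(\varphi_1,\dots,\varphi_d)$, is $C^r$ Legendre, that $F:U\subset\mathbb{R}^d\to\mathbb{R}$ is $C^r$, where $U$ is an open set containing the convex hull of $\vec\varphi(X)$, and let $\mathcal{E}(\mu)=F(\mu(\varphi_1),\dots,\mu(\varphi_d))$. Let $\mathsf{P}(y_1,\dots,y_d)=P_{\mathrm{top}}(T,\sum_i y_i\varphi_i)$ be the linear pressure function on $\mathbb{R}^d$ (which is differentiable), with gradient $\nabla\mathsf{P}$, and let $$\mathsf{h}(z)=\sup\{h(T,\mu):\mu\in\mathscr{P}(T),\ \mu(\vec\varphi)=z\},\qquad \mathscr{V}=\{z\in\mathbb{R}^d:\ \mathsf{h}(z)+F(z)=\sup(\mathsf{h}+F)\}.$$ Then the set $\mathscr{Y}=(\nabla\mathsf{P})^{-1}(\mathscr{V})$ is a nonempty compact subset of $\mathbb{R}^d$ such that the nonlinear equilibrium measures are exactly the measures that are linear equilibrium measures for some potential $\sum_i y_i\varphi_i$ with $(y_1,\dots,y_d)\in\mathscr{Y}$. Moreover $-\mathsf{h}$ is the Legendre dual of $\mathsf{P}$, in the sense that $-\mathsf{h}(z)=\sup_{y\in\mathbb{R}^d}\big(-\langle y,z\rangle... \big)$ is replaced, with the sign convention $\mathsf{P}(y)=\sup_{z}\big(\langle y,z\rangle+\mathsf{h}(z)\big)$, by $-\mathsf{h}(z)=\sup_{y\in\mathbb{R}^d}\big(\langle y,z\rangle-\mathsf{P}(y)\big)$ for all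 $z\in\mathbb{R}^d$.
   Context: $T:X\to X$ is a continuous self-map of a compact metric space $(X,d)$, $\varphi_1,\dots,\varphi_d:X\to\mathbb{R}$ are continuous functions (potentials). $\mathscr{P}(T)$ is the set of $T$-invariant Borel probability measures, $h(T,\mu)$ the Kolmogorov–Sinai entropy, $\mu(\varphi)=\int\varphi\,d\mu$ and $\mu(\vec\varphi)=(\mu(\varphi_1),\dots,\mu(\varphi_d))$. The regularity index satisfies $1\le r\le\omega$, i.e. $r$ is a positive integer, $r=\infty$ or $r=\omega$ (real-analytic). The linear topological pressure of a continuous potential $\psi$ is $P_{\mathrm{top}}(T,\psi)=\lim_{\varepsilon\to0}\limsup_{n\to\infty}\frac1n\log\sup_{\mathcal{C}}\sum_{x\in\mathcal{C}}\exp\big(\sum_{k=0}^{n-1}\psi(T^kx)\big)$, the supremum being over finite sets $\mathcal{C}$ such that $\max_{0\le k<n}d(T^kx,T^kx')\ge\varepsilon$ for distinct $x,x'\in\mathcal{C}$; by the classical variational principle it equals $\sup_{\mu\in\mathscr{P}(T)}(h(T,\mu)+\mu(\psi))$. A linear equilibrium measure for $\psi$ is a measure achieving this last supremum. A nonlinear equilibrium measure is a measure $\mu\in\mathscr{P}(T)$ maximizing $h(T,\mu)+\mathcal{E}(\mu)$ over $\mathscr{P}(T)$. The rotation set is $\rho(\vec\varphi)=\{\mu(\vec\varphi):\mu\in\mathscr{P}(T)\}$. Convention: $\sup\varnothing=-\infty$, so $\mathsf{h}$ is finite exactly on $\rho(\vec\varphi)\subset U$ and $\mathsf{h}+F$ is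 understood as $-\infty$ outside $\rho(\vec\varphi)$. For $f:\mathbb{R}^d\to\mathbb{R}\cup\{-\infty\}$ let $\mathrm{dom}(f)=f^{-1}(\mathbb{R})$. $f$ is concave of $C^r$ Legendre type when: (i) $f$ is upper semicontinuous and concave; (ii) the interior of $\mathrm{dom}(f)$ is nonempty and on it $f$ is strictly concave and $C^r$, and, when $r\ge2$, the Hessian of $f$ is negative definite everywhere there; (iii) for every sequence $(x_i)$ in the interior of $\mathrm{dom}(f)$ converging to a boundary point of $\mathrm{dom}(f)$, $|\nabla f(x_i)|\to+\infty$. $(T,\vec\varphi)$ is $C^r$ Legendre when: $\rho(\vec\varphi)$ has nonempty interior in $\mathbb{R}^d$; the topological entropy of $T$ is finite; and $\mathsf{h}$ is concave of $C^r$ Legendre type. The Legendre dual of a convex function $g:\mathbb{R}^d\to\mathbb{R}\cup\{+\infty\}$ is $g^*(z)=\sup_{y\in\mathbb{R}^d}\big(\langle y,z\rangle-g(y)\big)$. *)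

(* Defs.v *)
From HB Require Import structures.
From mathcomp Require Import all_boot all_order all_algebra finmap.
From mathcomp Require Import all_classical all_reals all_analysis.
From mathcomp.analysis.showcase Require Import summability.

Set Implicit Arguments.
Unset Strict Implicit.
Unset Printing Implicit Defensive.
Import Order.TTheory GRing.Theory Num.Theory.
Import numFieldNormedType.Exports.

Local Open Scope classical_set_scope.
Local Open Scope ring_scope.

(* Measurable types are pointed, so the metric spaces below carry a point; it
   plays no role beyond making the space nonempty. *)
#[short(type="pmetricType")]
HB.structure Definition PointedMetric (K : numDomainType) :=
  {M of Pointed M & Metric K M}.

(** * Differential calculus on R^n *)
Section calculus.
Context {R : realType} {n : nat}.
Implicit Types (O : set 'rV[R]_n) (g : 'rV[R]_n -> R) (x y z : 'rV[R]_n).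

Definition inner y z : R := \sum_(i < n) y ord0 i * z ord0 i.

Definition partial (i : 'I_n) g : 'rV[R]_n -> R :=
  fun x => 'D_(delta_mx ord0 i) g x.

Definition gradient g x : 'rV[R]_n := \row_i partial i g x.

Definition hessian g x : 'M[R]_n := \matrix_(i, j) partial i (partial j g) x.

Definition negative_definite (H : 'M[R]_n) : Prop :=
  forall v : 'rV[R]_n, v != 0 -> (v *m H *m v^T) ord0 ord0 < 0.

(* Functions are total; only the germ of g along the open set O matters. *)
Fixpoint Ck (k : nat) O g : Prop :=
  if k is k'.+1 then
    (forall x, O x -> differentiable g x) /\
    (forall i, Ck k' O (partial i g))
  else forall x, O x -> {for x, continuous g}.

Definition monomial (a : {ffun 'I_n -> nat}) x : R :=
  \prod_(i < n) x ord0 i ^+ a i.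

(* Sum of a power series in n variables, as an unconditional sum over the
   multi-indices (for real families: absolute convergence). *)
Definition real_analytic O g : Prop :=
  forall x, O x -> exists2 e : R, 0 < e &
    exists c : {ffun 'I_n -> nat} -> R, forall v : 'rV[R]_n, `|v| < e ->
      partial_sum (fun a => c a * monomial a v) @ totally --> g (x + v).

End calculus.

Inductive regularity := Cfinite of nat | Cinfty | Comega.

Definition reg_ge (k : nat) (r : regularity) : bool :=
  if r is Cfinite m then (k <= m)%N else true.

Definition is_Cr {R : realType} {n : nat} (r : regularity)
    (O : set 'rV[R]_n) (g : 'rV[R]_n -> R) : Prop :=
  match r with
  | Cfinite k => Ck k O g
  | Cinfty => forall k, Ck k O g
  | Comega => real_analytic O g
  end.

(** * Legendre-type concave functions *)
Section legendre.
Context {R : realType} {n : nat}.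
Implicit Types (f : 'rV[R]_n -> \bar R).

Definition dom f : set 'rV[R]_n := [set x | f x \is a fin_num].

Definition boundary (A : set 'rV[R]_n) : set 'rV[R]_n :=
  closure A `\` interior A.

Definition upper_semicontinuous f : Prop :=
  lower_semicontinuous (fun x => - f x)%E.

(* Meant for functions that never take the value +oo, so that the left-hand
   side is not an indeterminate sum. *)
Definition concave f : Prop := forall x y (t : R), 0 < t < 1 ->
  (t%:E * f x + (1 - t)%:E * f y <= f (t *: x + (1 - t) *: y)%R)%E.

Definition strictly_concave_on (O : set 'rV[R]_n) (g : 'rV[R]_n -> R) : Prop :=
  forall x y (t : R), O x -> O y -> x != y -> 0 < t < 1 ->
  t * g x + (1 - t) * g y < g (t *: x + (1 - t) *: y).

(* In the last item `|_| is the sup norm; all norms on R^n being equivalent,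
   the condition is the one for the Euclidean norm. *)
Definition concave_Cr_Legendre_type (r : regularity) f : Prop :=
  let O := interior (dom f) in
  let g := fine \o f in
  [/\ forall x, f x != +oo%E,
      upper_semicontinuous f /\ concave f,
      [/\ O !=set0, strictly_concave_on O g, is_Cr r O g &
          reg_ge 2 r -> forall x, O x -> negative_definite (hessian g x)] &
      forall (x : nat -> 'rV[R]_n) (a : 'rV[R]_n),
        (forall i, O (x i)) -> boundary (dom f) a -> x @ \oo --> a ->
        `|gradient g (x i)| @[i --> \oo] --> +oo].

Definition legendre_dual f (z : 'rV[R]_n) : \bar R :=
  ereal_sup [set ((inner y z)%:E - f y)%E | y in setT].

End legendre.

(** * Entropy and pressure *)
Notation borel X := (g_sigma_algebraType (@open X)).

Section dynamics.
Context {R : realType} {X : pmetricType R}.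
Variable T : X -> X.

Implicit Types (mu : probability (borel X) R) (psi : X -> R).

Definition invariant_measures : set (probability (borel X) R) :=
  [set mu | forall A : set (borel X), measurable A -> mu (T @^-1` A) = mu A].

Definition finite_partition (k : nat) (A : 'I_k -> set (borel X)) : Prop :=
  [/\ forall i, measurable (A i), trivIset setT A & \bigcup_i A i = setT].

(* The atoms of the join of A, T^-1 A, ..., T^-(m-1) A are indexed by the words
   of length m (some of them may be empty). *)
Definition join_atom (k : nat) (A : 'I_k -> set (borel X)) (m : nat)
    (w : {ffun 'I_m -> 'I_k}) : set (borel X) :=
  [set x | forall j : 'I_m, A (w j) (iter j T x)].

Definition shannon_entropy mu (I : finType) (A : I -> set (borel X)) : R :=
  - \sum_(i : I) fine (mu (A i)) * ln (fine (mu (A i))).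

Definition partition_entropy mu (k : nat) (A : 'I_k -> set (borel X)) : R :=
  lim ((m%:R^-1 * shannon_entropy mu (@join_atom k A m)) @[m --> \oo]).

Definition ks_entropy mu : \bar R :=
  ereal_sup [set e | exists (k : nat) (A : 'I_k -> set (borel X)),
    finite_partition A /\ e = (partition_entropy mu A)%:E].

Definition bowen_dist (m : nat) (x y : X) : R :=
  \big[Num.max/0]_(k < m) mdist (iter k T x) (iter k T y).

Definition separated (m : nat) (e : R) (C : set X) : Prop :=
  finite_set C /\
  forall x y, C x -> C y -> x <> y -> e <= bowen_dist m x y.

Definition birkhoff_sum psi (m : nat) (x : X) : R :=
  \sum_(k < m) psi (iter k T x).

Definition separated_sum psi (m : nat) (e : R) : \bar R :=
  ereal_sup [set (\sum_(x \in C) expR (birkhoff_sum psi m x))%:E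
            | C in separated m e].

Definition Ptop psi : \bar R :=
  lim (limn_esup (fun m => (m%:R^-1)%:E * lne (separated_sum psi m e))%E
       @[e --> (0 : R)^'+]).

Definition topological_entropy : \bar R := Ptop (fun=> 0).

Definition mean mu psi : R := (\int[mu]_x psi x)%R.

Definition linear_equilibrium psi mu : Prop :=
  invariant_measures mu /\
  (ks_entropy mu + (mean mu psi)%:E)%E =
    ereal_sup [set (ks_entropy nu + (mean nu psi)%:E)%E
              | nu in invariant_measures].

Definition nonlinear_equilibrium (E : probability (borel X) R -> R) mu : Prop :=
  invariant_measures mu /\
  forall nu, invariant_measures nu ->
    (ks_entropy nu + (E nu)%:E <= ks_entropy mu + (E mu)%:E)%E.

Context {n : nat}.
Variable phi : 'I_n -> X -> R.

Definition vec_mean mu : 'rV[R]_n := \row_i mean mu (phi i).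

Definition rotation_set : set 'rV[R]_n := vec_mean @` invariant_measures.

Definition potential (y : 'rV[R]_n) : X -> R :=
  fun x => \sum_(i < n) y ord0 i * phi i x.

Definition pressure_fun (y : 'rV[R]_n) : \bar R := Ptop (potential y).

(* ereal_sup set0 = -oo *)
Definition entropy_fun (z : 'rV[R]_n) : \bar R :=
  ereal_sup (ks_entropy @` [set mu | invariant_measures mu /\ vec_mean mu = z]).

Definition Cr_Legendre (r : regularity) : Prop :=
  [/\ interior rotation_set !=set0,
      topological_entropy \is a fin_num &
      concave_Cr_Legendre_type r entropy_fun].

(* F need only be meaningful on a neighbourhood of the rotation set: elsewhere
   entropy_fun is -oo, and so is the sum. *)
Definition maximizers (F : 'rV[R]_n -> R) : set 'rV[R]_n :=
  [set z | (entropy_fun z + (F z)%:E)%E =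
     ereal_sup [set (entropy_fun z' + (F z')%:E)%E | z' in setT]].

Definition parameter_set (F : 'rV[R]_n -> R) : set 'rV[R]_n :=
  gradient (fine \o pressure_fun) @^-1` maximizers F.

End dynamics.

Definition convex_hull {R : realType} {n : nat} (A : set 'rV[R]_n) :
    set 'rV[R]_n :=
  smallest (@convex_set R 'rV[R]_n) A.

(* Main.v *)
(* Conjugating the variational principle by the rotation vector gives
   P(y) = sup_z (<y, z> + h(z)), where h is nonnegative, bounded and upper
   semicontinuous on its compact convex domain K.  Since h is strictly concave
   and steep, <y, .> + h has a unique maximizer zeta(y), which is interior; hence
   P is differentiable with gradient zeta, and zeta(- grad h(z)) = z for every
   interior z.  Steepness also sends the maximizers of h + F to the interior,
   because F grows at most linearly near each point of K; they form a compact set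
   V, so Y = zeta^-1(V) is compact and nonempty.  A linear equilibrium measure for
   y is an invariant mu with mean zeta(y) and entropy h(zeta(y)), and a nonlinear
   equilibrium measure is one with mean z in V and entropy h(z).

   Both halves of the variational principle compare, by Gibbs' inequality, the
   law of the names of length m with an explicit subprobability on words. *)
From HB Require Import structures.
Require Import Defs.
From mathcomp Require Import all_boot all_order all_algebra finmap.
From mathcomp Require Import all_classical all_reals all_analysis.
From mathcomp.analysis.showcase Require Import summability.
From mathcomp Require Import ring lra measurable_realfun.

Set Implicit Arguments.
Unset Strict Implicit.
Unset Printing Implicit Defensive.
Import Order.TTheory GRing.Theory Num.Theory.
Import numFieldNormedType.Exports.

Local Open Scope classical_set_scope.
Local Open Scope ring_scope.

(** * Entropy of finite partitions *)

(** Linear functionals and [F] enter the optimisation through a single property: each is Lipschitz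
    at every point of [K] ([calm]), and a maximiser of [f] plus such a function is interior. The
    obstacle is the variational principle for a merely continuous [T]. To bound entropy plus energy
    by the pressure, counting the names met by a Bowen ball would lose a constant factor per time
    step; instead the reference law reads each letter through a channel that errs with small weight
    [delta], so that only visits to a set of small measure are expensive. For the converse,
    empirical averages pass to the limit along an ultrafilter, on all bounded functions at once. The
    limit functional is only finitely additive; regularising it gives a Borel measure that agrees
    with it on sets with null frontier, which is why partitions are cut out by balls with null
    spheres. The limit is taken at fixed [p], for the information of one letter given the next [p],
    whose average is close to an increment of the entropy of names; the increments are summed over
    [p] afterwards. *)

Section gibbs.
Context {R : realType}.

(** The tangent line of [ln] at 1, taken at [q / p] and multiplied by [p]. When [p = 0] the claim is
    [0 <= q]. *)
Lemma gibbs_term (p q : R) : 0 <= p -> 0 <= q -> (0 < p -> 0 < q) ->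
  p * ln q <= p * ln p + (q - p).
Proof.
rewrite le_eqVlt => /predU1P[<-|p0] q0 pq; first by rewrite !mul0r add0r subr0.
have q1 := pq p0.
have : ln (1 + (q / p - 1)) <= q / p - 1.
  by apply: le_ln1Dx; rewrite ltrBDl addrN divr_gt0.
rewrite addrC subrK ln_div ?posrE// => /(ler_wpM2l (ltW p0)).
by rewrite !mulrBr mulrCA divff ?gt_eqF// !mulr1; lra.
Qed.

(** The masses only have to satisfy an inequality, so [q] may be a subprobability, or a law on all
    words restricted to those that occur. *)
Lemma gibbs (I : Type) (r : seq I) (p q : I -> R) : (forall i, 0 <= p i) ->
  (forall i, 0 <= q i) -> (forall i, 0 < p i -> 0 < q i) ->
  \sum_(i <- r) q i <= \sum_(i <- r) p i ->
  \sum_(i <- r) p i * ln (q i) <= \sum_(i <- r) p i * ln (p i).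
Proof.
move=> p0 q0 pq qp.
apply: (@le_trans _ _ (\sum_(i <- r) (p i * ln (p i) + (q i - p i)))).
  by apply: ler_sum => i _; apply: gibbs_term; auto.
by rewrite big_split/= sumrB gerDl subr_le0.
Qed.

End gibbs.

Section label.
Context {R : realType} {d} {Y : measurableType d} (mu : probability Y R).

Definition avg (f : Y -> R) : R := (\int[mu]_x f x)%R.

Definition bmeas (f : Y -> R) : Prop :=
  measurable_fun setT f /\ exists M, forall x, `|f x| <= M.

Lemma bmeas_integrable f : bmeas f -> mu.-integrable setT (EFin \o f).
Proof.
move=> [mf [M fM]]; apply: measurable_bounded_integrable => //.
  by apply: (@le_lt_trans _ _ 1%E); rewrite ?probability_le1 ?ltry.
exists M; split => [|K MK x _]; first exact: num_real.
exact: le_trans (fM x) (ltW MK).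
Qed.

Lemma bmeasD f g : bmeas f -> bmeas g -> bmeas (fun x => f x + g x).
Proof.
move=> [mf [M fM]] [mg [N gN]]; split; first exact: measurable_funD.
by exists (M + N) => x; apply: le_trans (ler_normD _ _) _; exact: lerD.
Qed.

Lemma bmeasZ c f : bmeas f -> bmeas (fun x => c * f x).
Proof.
move=> [mf [M fM]]; split.
  exact: (measurable_funM (measurable_cst _) mf).
by exists (`|c| * M) => x; rewrite normrM ler_wpM2l.
Qed.

Lemma bmeas_cst c : bmeas (fun=> c).
Proof. by split; [exact: measurable_cst | exists `|c|]. Qed.

Lemma bmeas_indic A : measurable A -> bmeas \1_A.
Proof.
move=> mA; split; first exact: measurable_indic.
by exists 1 => x; rewrite indicE; case: (_ \in _); rewrite ?normr1 ?normr0.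
Qed.

Lemma avgD f g : bmeas f -> bmeas g -> avg (fun x => f x + g x) = avg f + avg g.
Proof. by move=> bf bg; rewrite /avg RintegralD//; exact: bmeas_integrable. Qed.

Lemma avgZ c f : bmeas f -> avg (fun x => c * f x) = c * avg f.
Proof. by move=> bf; rewrite /avg RintegralZl//; exact: bmeas_integrable. Qed.

Lemma avg_cst c : avg (fun=> c) = c.
Proof.
rewrite /avg Rintegral_cst// -[RHS]mulr1; congr (c * _).
by rewrite [X in fine X](_ : _ = 1%E)//; exact: probability_setT.
Qed.

Lemma avg_indic A : measurable A -> avg \1_A = fine (mu A).
Proof. by move=> mA; rewrite /avg /Rintegral integral_indic// setIT. Qed.

Lemma le_avg f g : bmeas f -> bmeas g -> (forall x, f x <= g x) ->
  avg f <= avg g.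
Proof.
by move=> bf bg fg; apply: le_Rintegral => //; exact: bmeas_integrable.
Qed.

Lemma bmeas_sum (I : Type) (s : seq I) (P : pred I) (f : I -> Y -> R) :
  (forall i, bmeas (f i)) -> bmeas (fun x => \sum_(i <- s | P i) f i x).
Proof.
move=> bf; elim: s => [|i s ih].
  by under eq_fun do rewrite big_nil; exact: bmeas_cst.
under eq_fun do rewrite big_cons.
by case: (P i) => //; exact: bmeasD.
Qed.

Lemma avg_sum (I : Type) (s : seq I) (P : pred I) (f : I -> Y -> R) :
  (forall i, bmeas (f i)) ->
  avg (fun x => \sum_(i <- s | P i) f i x) = \sum_(i <- s | P i) avg (f i).
Proof.
move=> bf; elim: s => [|i s ih].
  by under eq_fun do rewrite big_nil; rewrite avg_cst big_nil.
under eq_fun do rewrite big_cons.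
rewrite big_cons; case: (P i) => //.
by rewrite avgD ?ih//; exact: bmeas_sum.
Qed.

(* A finite partition is handled as a labelling a : Y -> I, whose fibres are the
   atoms. *)
Definition mlabel (I : Type) (a : Y -> I) := forall i, measurable (a @^-1` [set i]).

Definition law (I : Type) (a : Y -> I) (i : I) : R := fine (mu (a @^-1` [set i])).

Lemma label_sum (I : finType) (a : Y -> I) (f : I -> R) x :
  f (a x) = \sum_i f i * \1_(a @^-1` [set i]) x.
Proof.
rewrite (bigD1 (a x))//= indicE mem_set//= mulr1 big1 ?addr0// => i ia.
by rewrite indicE memNset ?mulr0//= => ax; rewrite ax eqxx in ia.
Qed.

Lemma bmeas_label (I : finType) (a : Y -> I) (f : I -> R) :
  mlabel a -> bmeas (f \o a).
Proof.
move=> ma; rewrite (_ : f \o a = fun x => \sum_i f i * \1_(a @^-1` [set i]) x).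
  by apply: bmeas_sum => i; apply/bmeasZ/bmeas_indic.
by apply/funext => x; exact: label_sum.
Qed.

Lemma avg_label (I : finType) (a : Y -> I) (f : I -> R) : mlabel a ->
  avg (f \o a) = \sum_i law a i * f i.
Proof.
move=> ma; rewrite (_ : f \o a = fun x => \sum_i f i * \1_(a @^-1` [set i]) x).
  rewrite avg_sum; last by move=> i; apply/bmeasZ/bmeas_indic.
  apply: eq_bigr => i _; rewrite avgZ ?avg_indic 1?mulrC//.
  exact: bmeas_indic.
by apply/funext => x; exact: label_sum.
Qed.

Lemma law_ge0 (I : Type) (a : Y -> I) i : 0 <= law a i.
Proof. exact: fine_ge0. Qed.

Lemma law_sum1 (I : finType) (a : Y -> I) : mlabel a -> \sum_i law a i = 1.
Proof.
move=> /(@avg_label _ _ (fun=> 1)); rewrite avg_cst => ->.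
by apply: eq_bigr => i _; rewrite mulr1.
Qed.

Lemma mlabel_comp (I : finType) (J : Type) (a : Y -> I) (h : I -> J) :
  mlabel a -> mlabel (h \o a).
Proof.
move=> ma j; rewrite (_ : _ @^-1` _ = \bigcup_(i in h @^-1` [set j]) (a @^-1` [set i])).
  by apply: fin_bigcup_measurable => //; exact: finite_finset.
apply/seteqP; split => x /=; first by move=> hx; exists (a x).
by move=> [i /= <- <-].
Qed.

Lemma mlabel_pair (I J : finType) (a : Y -> I) (b : Y -> J) :
  mlabel a -> mlabel b -> mlabel (fun x => (a x, b x)).
Proof.
move=> ma mb [i j].
rewrite (_ : _ @^-1` _ = (a @^-1` [set i]) `&` (b @^-1` [set j])).
  exact: measurableI.
by apply/seteqP; split => x /= => [[-> ->]|[-> ->]].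
Qed.

Lemma law_comp_sum (I J : finType) (a : Y -> I) (h : I -> J) (f : J -> R) :
  mlabel a -> \sum_i law a i * f (h i) = \sum_j law (h \o a) j * f j.
Proof.
move=> ma; rewrite -(avg_label f (mlabel_comp h ma)).
by rewrite -(avg_label (f \o h) ma).
Qed.

Lemma law_comp_le (I J : finType) (a : Y -> I) (h : I -> J) i : mlabel a ->
  law a i <= law (h \o a) (h i).
Proof.
move=> ma; rewrite /law fine_le ?fin_num_measure//; first exact: mlabel_comp.
by rewrite le_measure ?inE//; [exact: mlabel_comp | move=> x /= ->].
Qed.

Definition label_entropy (I : finType) (a : Y -> I) : R := - \sum_i law a i * ln (law a i).

Lemma label_entropy_ge0 (I : finType) (a : Y -> I) : mlabel a -> 0 <= label_entropy a.
Proof.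
move=> ma; rewrite /label_entropy oppr_ge0; apply: sumr_le0 => i _.
apply: mulr_ge0_le0; first exact: law_ge0.
by apply: ln_le0; rewrite -(law_sum1 ma) (bigD1 i)//= lerDl sumr_ge0// => *;
  exact: law_ge0.
Qed.

(** Values missed by [h] have empty fibres and contribute 0. This permits recoding a word as a pair
    of words, or a letter followed by a word as a single word. *)
Lemma label_entropy_inj (I J : finType) (a : Y -> I) (h : I -> J) : mlabel a ->
  injective h -> label_entropy (h \o a) = label_entropy a.
Proof.
move=> ma hi; rewrite /label_entropy; congr (- _).
rewrite -(law_comp_sum h (fun j => ln (law (h \o a) j)) ma).
apply: eq_bigr => i _; congr (_ * ln (fine (mu _))).
by apply/seteqP; split => x /=; [move/hi | move->].
Qed.

(** Gibbs' inequality for the joint law against the product of its marginals. *)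
Lemma label_entropy_pair (I J : finType) (a : Y -> I) (b : Y -> J) :
  mlabel a -> mlabel b -> label_entropy (fun x => (a x, b x)) <= label_entropy a + label_entropy b.
Proof.
move=> ma mb; pose c x := (a x, b x); have mc : mlabel c by exact: mlabel_pair.
have ca i : law c i <= law a i.1 by exact: (law_comp_le fst).
have cb i : law c i <= law b i.2 by exact: (law_comp_le snd).
have q1 : \sum_i law a i.1 * law b i.2 <= \sum_i law c i.
  rewrite (law_sum1 mc) -(pair_bigA _ (fun i j => law a i * law b j))/=.
  under eq_bigr do rewrite -mulr_sumr (law_sum1 mb) mulr1.
  by rewrite law_sum1.
rewrite -/c (_ : label_entropy a + label_entropy b = - \sum_i law c i * ln (law a i.1 * law b i.2)).
  rewrite lerN2; apply: gibbs => // i; first exact: law_ge0.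
    by rewrite mulr_ge0// law_ge0.
  by move=> c0; rewrite mulr_gt0//; apply: lt_le_trans c0 _.
rewrite /label_entropy -opprD; congr (- _).
rewrite -(law_comp_sum fst (fun j => ln (law a j)) mc).
rewrite -(law_comp_sum snd (fun j => ln (law b j)) mc) -big_split.
apply: eq_bigr => i _ /=; rewrite -mulrDr.
(* Null pairs are set aside because the logarithm of a product splits only for positive factors. *)
have [->|c0] := eqVneq (law c i) 0; first by rewrite !mul0r.
have {}c0 : 0 < law c i by rewrite lt_neqAle eq_sym c0 law_ge0.
by rewrite lnM// posrE; apply: lt_le_trans c0 _.
Qed.

End label.

(** * Fekete's subadditive lemma *)

Section fekete.
Context {R : realType}.
Implicit Types u : nat -> R.

Lemma subadditive_mul u (u_sub : forall m p, u (m + p)%N <= u m + u p) k q r :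
  u (q * k + r)%N <= q%:R * u k + u r.
Proof.
elim: q => [|q ih]; first by rewrite mul0n add0n mul0r add0r.
rewrite mulSn -addnA; apply: le_trans (u_sub _ _) _.
by rewrite -[q.+1]add1n natrD mulrDl mul1r -addrA lerD2l.
Qed.

(** The limit is the infimum [L] of [u m / m] over positive [m]. Dividing [m] by a near-optimal
    length leaves a remainder at which [u] is bounded independently of [m]. *)
Lemma fekete u : (forall m, 0 <= u m) ->
  (forall m p, u (m + p)%N <= u m + u p) -> cvgn (fun m => m%:R^-1 * u m).
Proof.
(* The shift keeps the index 0, where the inverse is 0 by convention, out of the infimum. *)
move=> u0 u_sub; pose v m := m.+1%:R^-1 * u m.+1.
have v0 m : 0 <= v m by rewrite mulr_ge0.
have hinf : has_inf (range v).
  by split; [exists (v 0%N), 0%N | exists 0 => _ [m _ <-]].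
set L := inf (range v); apply/cvg_ex; exists L; apply/cvgrPdist_le => e e0.
have e2 : 0 < e / 2 by rewrite divr_gt0.
have [_ [k _ <-] vk] := inf_adherent e2 hinf.
have uM : exists M, forall r, (r < k.+1)%N -> u r <= M.
  exists (\sum_(i < k.+1) u i) => r rk.
  by rewrite (bigD1 (Ordinal rk))//= lerDl sumr_ge0.
have [M uM'] := uM.
have M0 : 0 <= M by apply: le_trans (u0 0%N) (uM' 0%N _).
near=> m.
have m0 : (0 < m)%N by near: m; exact: nbhs_infty_gt.
have mM : M <= m%:R * (e / 2).
  rewrite -ler_pdivrMr//; near: m; exact: nbhs_infty_ger.
have Lm : L <= m%:R^-1 * u m.
  by rewrite -(prednK m0); apply: ge_inf; [case: hinf|exists m.-1].
rewrite distrC ger0_norm ?subr_ge0// lerBlDl.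
rewrite mulrC ler_pdivrMr ?ltr0n//.
have := subadditive_mul u_sub k.+1 (m %/ k.+1) (m %% k.+1).
rewrite -divn_eq => /le_trans; apply.
have ur := uM' _ (ltn_pmod m (isT : (0 < k.+1)%N)).
have uk : u k.+1 <= k.+1%:R * (L + e / 2).
  by rewrite mulrC -ler_pdivrMr// mulrC ltW.
have L0 : 0 <= L by apply: lb_le_inf; [case: hinf | move=> _ [i _ <-]].
have qk : (m %/ k.+1)%:R * u k.+1 <= m%:R * (L + e / 2).
  apply: le_trans (ler_wpM2l _ uk) _ => //.
  rewrite mulrA -natrM; apply: ler_wpM2r; first by rewrite addr_ge0// ltW.
  by rewrite ler_nat leq_trunc_div.
lra.
Unshelve. all: by end_near. Qed.

End fekete.

Lemma comp_iterSr (Y I : Type) (T : Y -> Y) (a : Y -> I) j :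
  a \o iter j.+1 T = (a \o iter j T) \o T.
Proof. by apply/funext => x; rewrite /= -iterS iterSr. Qed.

(* The itinerary of x, or (T, a)-name: its fibres are the atoms of the join of
   the partitions T^-j a, j < m. *)
Definition name (Y : Type) (T : Y -> Y) (k : nat) (a : Y -> 'I_k) (m : nat) (x : Y) :
  {ffun 'I_m -> 'I_k} := [ffun j : 'I_m => a (iter j T x)].

(** * Entropy of names under an invariant measure *)

Section names.
Context {R : realType} {d} {Y : measurableType d} (mu : probability Y R).
Variable T : Y -> Y.
Hypothesis mT : measurable_fun setT T.
Hypothesis muT : forall A, measurable A -> mu (T @^-1` A) = mu A.

Lemma mlabel_iter (I : Type) (a : Y -> I) j : mlabel a -> mlabel (a \o iter j T).
Proof.
move=> ma; elim: j => [|j ih] i; first exact: ma.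
rewrite comp_iterSr comp_preimage -[X in measurable X]setTI.
by apply: mT => //; exact: ih.
Qed.

Lemma law_iter (I : Type) (a : Y -> I) j : mlabel a -> law mu (a \o iter j T) = law mu a.
Proof.
move=> ma; apply/funext => i; elim: j => [|j <-]//.
rewrite /law -[in RHS]muT; last exact: mlabel_iter.
by rewrite comp_iterSr comp_preimage.
Qed.

Lemma measurable_iter j : measurable_fun setT (iter j T).
Proof.
elim: j => [|j ih]; first exact: measurable_id.
exact: (measurableT_comp mT ih).
Qed.

Lemma bmeas_iter (f : Y -> R) j : bmeas f -> bmeas (f \o iter j T).
Proof.
move=> [mf [M fM]]; split; last by exists M => x /=.
exact: (measurableT_comp mf (measurable_iter j)).
Qed.

Lemma avg_iter (f : Y -> R) j : bmeas f -> avg mu (f \o iter j T) = avg mu f.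
Proof.
move=> bf; elim: j => [|j <-]//; have bj := bmeas_iter j bf.
have := bmeas_integrable mu (bmeas_iter j.+1 bf).
rewrite comp_iterSr => bS.
have := @integral_pushforward _ _ Y Y R T mT mu setT (EFin \o (f \o iter j T)).
rewrite preimage_setT => /(_ (iffRL (measurable_EFinP _ _) bj.1) bS measurableT).
move=> E; rewrite /avg /Rintegral; congr fine.
transitivity (\int[pushforward mu T]_y (EFin \o (f \o iter j T)) y)%E; first by rewrite E.
by apply: eq_measure_integral => A mA _; exact: muT.
Qed.

Lemma mlabel_name k (a : Y -> 'I_k) m : mlabel a -> mlabel (name T a m).
Proof.
move=> ma w.
rewrite (_ : _ @^-1` _ = \bigcap_(j in [set: 'I_m]) ((a \o iter j T) @^-1` [set w j])).
  apply: fin_bigcap_measurable => [|j _]; first exact: finite_finset.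
  exact: mlabel_iter.
apply/seteqP; split => x /=; first by move=> <- j _ /=; rewrite ffunE.
by move=> h; apply/ffunP => j; rewrite ffunE; exact: h.
Qed.

(** A name of length [m + p] splits into the name of length [m] of [x] and the name of length [p] of
    [iter m T x]; invariance gives the latter the law of a name started at time 0. *)
Lemma label_entropy_name_sub k (a : Y -> 'I_k) m p : mlabel a ->
  label_entropy mu (name T a (m + p)) <= label_entropy mu (name T a m) + label_entropy mu (name T a p).
Proof.
move=> ma; pose h (w : {ffun 'I_(m + p) -> 'I_k}) :=
  ([ffun j => w (lshift p j)] : {ffun 'I_m -> 'I_k},
   [ffun j => w (rshift m j)] : {ffun 'I_p -> 'I_k}).
have hi : injective h.
  move=> v w [/ffunP vw1 /ffunP vw2]; apply/ffunP => j.
  rewrite -(splitK j); case: (fintype.split j) => i /=.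
    by have := vw1 i; rewrite !ffunE.
  by have := vw2 i; rewrite !ffunE.
have mn q : mlabel (name T a q) by exact: mlabel_name.
rewrite -(label_entropy_inj mu (mn _) hi).
have -> : h \o name T a (m + p) = fun x => (name T a m x, (name T a p \o iter m T) x).
  apply/funext => x /=; congr pair; apply/ffunP => j; rewrite !ffunE//=.
  by rewrite addnC iterD.
apply: le_trans (label_entropy_pair mu (mn m) (@mlabel_iter _ _ m (mn p))) _.
rewrite lerD2l /label_entropy law_iter//; exact: mlabel_name.
Qed.

Lemma label_entropy_name_cvg k (a : Y -> 'I_k) : mlabel a ->
  cvgn (fun m => m%:R^-1 * label_entropy mu (name T a m)).
Proof.
move=> ma; apply: fekete => [m|m p]; first exact/label_entropy_ge0/mlabel_name.
exact: label_entropy_name_sub.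
Qed.

End names.

Lemma preimage_name {Y : Type} (T : Y -> Y) k (a : Y -> 'I_k) m w :
  name T a m @^-1` [set w] = [set x | forall j : 'I_m, a (iter j T x) = w j].
Proof.
apply/seteqP; split => x /=; first by move=> <- j; rewrite ffunE.
by move=> h; apply/ffunP => j; rewrite ffunE.
Qed.

Section partitions.
Context {R : realType} {X : pmetricType R}.
Implicit Types mu : probability (borel X) R.

Lemma open_borel (A : set X) : open A -> measurable (A : set (borel X)).
Proof. by move=> oA; apply: sub_sigma_algebra. Qed.

Lemma closed_borel (A : set X) : closed A -> measurable (A : set (borel X)).
Proof.
by move=> /closed_openC/open_borel/measurableC; rewrite setCK.
Qed.

Lemma continuous_borel (T : X -> X) : continuous T ->
  measurable_fun setT (T : borel X -> borel X).
Proof.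
move=> cT; apply: (@measurability _ _ (borel X) (borel X) setT T (@open X)) => //.
move=> _ [A oA <-]; rewrite setTI; apply: open_borel.
by move/continuousP: cT; exact.
Qed.

Lemma continuous_borel_real (f : X -> R) : continuous f ->
  measurable_fun setT (f : borel X -> R).
Proof.
move=> cf; apply: (measurability _ (RGenOpens.measurableE R)) => //.
move=> _ [_ [a [b ->]] <-]; rewrite setTI; apply: open_borel.
by move/continuousP: cf; apply; exact: interval_open.
Qed.

Lemma continuous_bmeas (f : X -> R) : compact [set: X] -> continuous f ->
  bmeas (f : borel X -> R).
Proof.
move=> cX cf; split; first exact: continuous_borel_real.
have /compact_bounded[M [Mr fM]] : compact (f @` [set: X]).
  by apply: continuous_compact => //; exact: continuous_subspaceT.
exists (M + 1) => x; apply: fM; first by rewrite ltrDl.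
by exists x.
Qed.

Lemma finite_partition_label k (A : 'I_k -> set (borel X)) : finite_partition A ->
  exists2 a : borel X -> 'I_k, mlabel a & A = fun i => a @^-1` [set i].
Proof.
move=> [mA tA UA].
have ex x : exists i, A i x.
  by have : [set: borel X] x by []; rewrite -UA => -[i _ Aix]; exists i.
pose a x := sval (cid (ex x)).
have Aa x : A (a x) x by exact: (svalP (cid (ex x))).
have AE : A = fun i => a @^-1` [set i].
  apply/funext => i; apply/seteqP; split => x /=; last by move=> <-.
  by move=> Aix; apply: (tA (a x) i) => //; exists x.
by exists a => // i; have := mA i; rewrite AE.
Qed.

Lemma label_finite_partition k (a : borel X -> 'I_k) : mlabel a ->
  finite_partition (fun i => a @^-1` [set i]).
Proof.
move=> ma; split => //.
  by move=> i j _ _ [x [/= <- <-]].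
by apply/seteqP; split => x //= _; exists (a x).
Qed.

Lemma label_shannon mu (T : X -> X) k (a : borel X -> 'I_k) m :
  shannon_entropy mu (@join_atom R X T k (fun i => a @^-1` [set i]) m) =
  label_entropy mu (name T a m).
Proof.
rewrite /shannon_entropy /label_entropy; congr (- _); apply: eq_bigr => w _.
by rewrite /law preimage_name.
Qed.

Lemma label_partition_entropy mu (T : X -> X) k (a : borel X -> 'I_k) :
  partition_entropy T mu (fun i => a @^-1` [set i]) =
  lim ((m%:R^-1 * label_entropy mu (name T a m)) @[m --> \oo]).
Proof. by rewrite /partition_entropy; under eq_fun do rewrite label_shannon. Qed.

(** Witnessed by the one-cell partition, all of whose joins have entropy 0. *)
Lemma ks_entropy_ge0 mu (T : X -> X) : (0 <= ks_entropy T mu)%E.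
Proof.
pose a : borel X -> 'I_1 := fun=> ord0.
have ma : mlabel a.
  move=> i; rewrite (_ : _ @^-1` _ = setT); first exact: measurableT.
  by apply/seteqP; split => x //= _; rewrite (ord1 i).
apply: ereal_sup_ubound; exists 1%N, (fun i => a @^-1` [set i]); split.
  exact: label_finite_partition.
rewrite label_partition_entropy; congr EFin; apply/esym/cvg_lim => //.
rewrite (_ : (fun m => _) = fun=> 0); first exact: cvg_cst.
apply/funext => m; rewrite [label_entropy _ _](_ : _ = 0) ?mulr0// /label_entropy big1 ?oppr0// => w _.
rewrite /law (_ : _ @^-1` _ = setT); first by rewrite probability_setT/= ln1 mulr0.
by apply/seteqP; split => x //= _; apply/ffunP => j; rewrite !ord1.
Qed.

Lemma ks_entropy_ub mu (T : X -> X) (B : \bar R) :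
  (forall k (a : borel X -> 'I_k), mlabel a ->
    ((lim ((m%:R^-1 * label_entropy mu (name T a m)) @[m --> \oo]))%:E <= B)%E) ->
  (ks_entropy T mu <= B)%E.
Proof.
move=> h; apply: ub_ereal_sup => _ [k [A [/finite_partition_label[a ma ->] ->]]].
by rewrite label_partition_entropy; exact: h.
Qed.

Lemma le_ks_entropy mu (T : X -> X) k (a : borel X -> 'I_k) : mlabel a ->
  ((lim ((m%:R^-1 * label_entropy mu (name T a m)) @[m --> \oo]))%:E <= ks_entropy T mu)%E.
Proof.
move=> ma; apply: ereal_sup_ubound; exists k, (fun i => a @^-1` [set i]).
by split; [exact: label_finite_partition | rewrite label_partition_entropy].
Qed.

End partitions.

(** * Pressure on compact metric spaces *)

Section metric.
Context {R : realType} {X : pmetricType R}.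

Lemma open_mdist (A : set X) :
  (forall x, A x -> exists2 e : R, 0 < e & forall y, mdist x y < e -> A y) -> open A.
Proof.
move=> h; rewrite openE => x /h[e e0 eA]; apply/nbhs_ballP; exists e => //= y.
by rewrite ballEmdist => /eA.
Qed.

Lemma open_mdistP (A : set X) x : open A -> A x ->
  exists2 e : R, 0 < e & forall y, mdist x y < e -> A y.
Proof.
rewrite openE => /[apply] /nbhs_ballP[e /= e0 eA]; exists e => // y xy.
by apply: eA; rewrite ballEmdist.
Qed.

(** Closed for every [A], and increasing to [A] as [e] decreases to 0 when [A] is open: an explicit
    form of the fact that open sets of a metric space are countable unions of closed sets. *)
Definition erosion (A : set X) (e : R) : set X :=
  [set x | forall y, ~ A y -> e <= mdist x y].

Lemma erosion_sub A e : 0 < e -> erosion A e `<=` A.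
Proof.
by move=> e0 x Ax; apply: contrapT => /Ax; rewrite mdistxx leNgt e0.
Qed.

Lemma closed_erosion A e : closed (erosion A e).
Proof.
rewrite -[erosion A e]setCK; apply: open_closedC; apply: open_mdist => x /=.
rewrite /erosion => /existsNP[y /not_implyP[Ay /negP]]; rewrite -ltNge => xye.
exists (e - mdist x y); first by rewrite subr_gt0.
move=> z xz /(_ y Ay); apply/negP; rewrite -ltNge.
apply: le_lt_trans (metric_triangle z x y) _.
by rewrite (metric_sym z x) -ltrBrDr.
Qed.

Lemma erosion_cover A : open A -> A = \bigcup_k erosion A k.+1%:R^-1.
Proof.
move=> oA; apply/seteqP; split => x; last first.
  by move=> [k _]; apply: erosion_sub; rewrite invr_gt0.
move=> /(open_mdistP oA)[e e0 eA].
exists (Num.truncn e^-1) => // y nAy; rewrite leNgt; apply/negP => xy.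
apply: nAy; apply: eA; apply: lt_le_trans xy _.
rewrite -[leRHS]invrK lef_pV2 ?posrE ?invr_gt0//.
exact/ltW/truncnS_gt.
Qed.

Lemma erosion_nd A : nondecreasing_seq (fun k => erosion A k.+1%:R^-1).
Proof.
move=> i j ij; apply/subsetPset => x h y /h; apply: le_trans.
by rewrite lef_pV2 ?posrE// ler_nat.
Qed.

End metric.

(** * Inner regularity of Borel probability measures by closed sets *)

Section regularity.
Context {R : realType} {X : pmetricType R} (mu : probability (borel X) R).

(** Closed approximations are asked for [A] and its complement together, so that passing to the
    complement only exchanges [C] and [D]. *)
Definition regular (A : set (borel X)) := measurable A /\ forall e : R, 0 < e ->
  exists C D : set X, [/\ closed C, closed D, C `<=` A, D `<=` ~` A &
    (mu (~` (C `|` D)) <= e%:E)%E].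

Let mclosed (C : set X) : closed C -> measurable (C : set (borel X)).
Proof. exact: closed_borel. Qed.

Lemma regular_setC A : regular A -> regular (~` A).
Proof.
move=> [mA rA]; split; first exact: measurableC.
move=> e /rA[C [D [cC cD CA DA CD]]]; exists D, C; split => //; first by rewrite setCK.
by rewrite setUC.
Qed.

(** Continuity from above along the remainders, which decrease to the empty set. *)
Lemma increasing_exhaust (F : nat -> set (borel X)) (e : R) : 0 < e ->
  (forall i, measurable (F i)) -> nondecreasing_seq F ->
  exists N, (mu ((\bigcup_k F k) `\` F N) <= e%:E)%E.
Proof.
move=> e0 mF ndF; pose G k := (\bigcup_k F k) `\` F k.
have mU : measurable (\bigcup_k F k) by apply: bigcupT_measurable.
have mG k : measurable (G k) by apply: measurableD.
have G0 : \bigcap_k G k = set0.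
  apply/seteqP; split => // x Gx; have [[k _ Fx] _] := Gx 0%N I.
  by have [] := Gx k I.
have : mu \o G @ \oo --> mu (\bigcap_k G k).
  apply: nonincreasing_cvg_mu => //.
  - by rewrite (le_lt_trans (probability_le1 mu (mG _)))// ltry.
  - exact: bigcapT_measurable.
  - move=> i j ij; apply/subsetPset => x [Ux nF]; split => //; apply: contra_not nF.
    by have /subsetPset := ndF _ _ ij; exact.
rewrite G0 measure0 => /fine_cvgP[_ /cvgrPdist_le/(_ e e0)[N _ /(_ N (leqnn N))]] /=.
rewrite sub0r normrN => h; exists N; rewrite -/(G N).
have Gf : mu (G N) \is a fin_num by exact: fin_num_measure.
by rewrite -(fineK Gf) lee_fin; apply: le_trans h; exact: ler_norm.
Qed.

Lemma regular_open (A : set X) : open A -> regular A.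
Proof.
move=> oA; split; first exact: open_borel.
move=> e e0; have [N] := @increasing_exhaust (fun k => erosion A k.+1%:R^-1) e e0
  (fun k => mclosed (@closed_erosion _ _ A _)) (erosion_nd A).
rewrite -erosion_cover// => hN.
exists (erosion A N.+1%:R^-1), (~` A); split => //.
- exact: closed_erosion.
- exact: open_closedC.
- by apply: erosion_sub; rewrite invr_gt0.
- by rewrite setCU setCK setIC -setDE.
Qed.

(** The union of all the [C k] may fail to be closed, so it is truncated at [N] at the cost of
    [e / 2]; the other half is shared geometrically between the gaps of the [A k]. On the outer side
    the intersection of the [D k] is already closed. *)
Lemma regular_bigcup (A : nat -> set (borel X)) : (forall k, regular (A k)) ->
  regular (\bigcup_k A k).
Proof.
move=> rA; have mA k := (rA k).1; split; first exact: bigcupT_measurable.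
move=> e e0; have e2 : 0 < e / 2 by rewrite divr_gt0.
have ek k : 0 < e / 2 / (2 ^ k.+1)%:R by rewrite divr_gt0// ltr0n expn_gt0.
pose CD k := cid ((rA k).2 _ (ek k)).
pose C k := sval (CD k); pose DD k := cid (svalP (CD k)); pose D k := sval (DD k).
have cC k : closed (C k) by case: (svalP (DD k)).
have cD k : closed (D k) by case: (svalP (DD k)).
have CA k : C k `<=` A k by case: (svalP (DD k)).
have DA k : D k `<=` ~` A k by case: (svalP (DD k)).
have muCD k : (mu (~` (C k `|` D k)) <= (e / 2 / (2 ^ k.+1)%:R)%:E)%E.
  by case: (svalP (DD k)).
pose U k : set X := \big[setU/set0]_(i < k.+1) C i.
have cU k : closed (U k) by rewrite /U; apply: closed_bigsetU => i _; exact: cC.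
have UE : \bigcup_k U k = \bigcup_k C k.
  rewrite /U; apply/seteqP; split => x [k _].
    by rewrite -bigcup_mkord => -[i _ Cx]; exists i.
  by move=> Cx; exists k => //; rewrite -bigcup_mkord; exists k => /=.
have ndU : nondecreasing_seq U.
  by move=> i j ij; apply/subsetPset; exact: subset_bigsetU.
have [N hN] := @increasing_exhaust U (e / 2) e2 (fun k => mclosed (cU k)) ndU.
exists (U N), (\bigcap_k D k); split => //.
- by apply: closed_bigI => i _; exact: cD.
- move=> x; rewrite /U -bigcup_mkord => -[i _ /CA Ax]; by exists i.
- move=> x Dx [i _]; exact: DA (Dx i I).
- have sub : ~` (U N `|` \bigcap_k D k) `<=`
      ((\bigcup_k U k) `\` U N) `|` \bigcup_k ~` (C k `|` D k).
    move=> x; rewrite setCU => -[nU nD].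
    have [Ux|nUx] := pselect ((\bigcup_k U k) x); first by left.
    right; move/existsNP: nD => [i /not_implyP[_ nDi]]; exists i => //.
    by rewrite setCU; split => //= Cx; apply: nUx; rewrite UE; exists i.
  have mCD k : measurable (~` (C k `|` D k) : set (borel X)).
    by apply: measurableC; apply: measurableU; exact: mclosed.
  have mU : measurable (\bigcup_k U k : set (borel X)).
    by apply: bigcupT_measurable => k; exact: mclosed.
  apply: (@le_trans _ _ (mu (((\bigcup_k U k) `\` U N) `|` \bigcup_k ~` (C k `|` D k)))).
    apply: le_measure => //; rewrite inE.
      apply: measurableC; apply: mclosed; apply: closedU => //.
      by apply: closed_bigI => i _; exact: cD.
    by apply: measurableU; [apply: measurableD => //; exact: mclosed |
       exact: bigcupT_measurable].
  apply: le_trans (measureU2 _ _ _) _.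
  + by apply: measurableD => //; exact: mclosed.
  + exact: bigcupT_measurable.
  + rewrite [in leRHS](splitr e) EFinD; apply: leeD => //.
    apply: le_trans (epsilon_trick0 xpredT (ltW e2)).
    apply: le_trans (measure_sigma_subadditive _ mCD _ (@subset_refl _ _)) _.
      exact: bigcupT_measurable.
    apply: lee_nneseries => k _; last exact: muCD.
    by move=> _; exact: measure_ge0.
Qed.

Lemma borel_regular (A : set (borel X)) : measurable A -> regular A.
Proof.
apply: smallest_sub; last by move=> B; exact: regular_open.
split.
- by apply: regular_open; exact: open0.
- by move=> B rB; rewrite setTD; exact: regular_setC.
- exact: regular_bigcup.
Qed.

End regularity.

Section limn_esup.
Context {R : realType}.
Implicit Types (u : nat -> \bar R) (B : \bar R).

Lemma limn_esup_ge u B : (forall N, exists2 m, (N <= m)%N & (B <= u m)%E) ->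
  (B <= limn_esup u)%E.
Proof.
move=> h; apply: le_ereal_inf_tmp => _ [V [N _ NV] <-].
have [m Nm Bm] := h N; apply: le_trans Bm _; apply: ereal_sup_ubound.
by exists m => //; apply: NV.
Qed.

Lemma limn_esup_gt u B N : (B < limn_esup u)%E ->
  exists2 m, (N <= m)%N & (B < u m)%E.
Proof.
move=> h; have : (B < ereal_sup (u @` [set m | (N <= m)%N]))%E.
  apply: lt_le_trans h _; apply: ereal_inf_lbound.
  by exists [set m | (N <= m)%N] => //; exists N.
by move=> /ereal_sup_gt[_ [m Nm <-] Bm]; exists m.
Qed.

End limn_esup.

Section pressure.
Context {R : realType} {X : pmetricType R} (T : X -> X) (psi : X -> R).

Definition scale_pressure (e : R) : \bar R :=
  limn_esup (fun m => (m%:R^-1)%:E * lne (separated_sum T psi m e))%E.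

Lemma separatedW m e e' (C : set X) : e <= e' -> Defs.separated T m e' C -> Defs.separated T m e C.
Proof.
by move=> ee [fC sC]; split => // x y Cx Cy xy; apply: le_trans ee (sC _ _ Cx Cy xy).
Qed.

Lemma separated_sum_ge0 m e : (0 <= separated_sum T psi m e)%E.
Proof.
apply: ereal_sup_ubound; exists set0; first by split => //; exact: finite_set0.
by rewrite fsbig_set0.
Qed.

Lemma ge0_lne_le (x y : \bar R) : (0 <= x)%E -> (x <= y)%E -> (lne x <= lne y)%E.
Proof.
move=> x0 xy; rewrite lee_lne// in_itv/= leey andbT//.
exact: le_trans xy.
Qed.

Lemma scale_pressure_ni e e' : e <= e' -> (scale_pressure e' <= scale_pressure e)%E.
Proof.
move=> ee; apply: le_ereal_inf_tmp => _ [V VF <-].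
apply: (@le_trans _ _ (ereal_sup [set ((m%:R^-1)%:E * lne (separated_sum T psi m e'))%E | m in V])).
  by apply: ereal_inf_lbound; exists V.
apply: ge_ereal_sup => _ [m Vm <-].
apply: (@le_trans _ _ ((m%:R^-1)%:E * lne (separated_sum T psi m e))%E).
  apply: lee_wpmul2l; first by rewrite lee_fin.
  apply: ge0_lne_le; first exact: separated_sum_ge0.
  by apply: le_ereal_sup => _ [C sC <-]; exists C => //; exact: separatedW sC.
by apply: ereal_sup_ubound; exists m.
Qed.

(** A set separated at a large scale is separated at smaller ones, so the limit over scales is a
    supremum: upper bounds are checked scale by scale, and a lower bound needs one scale. *)
Lemma PtopE : Ptop T psi = ereal_sup (scale_pressure @` `]0, +oo[).
Proof.
apply: cvg_lim => //; apply: nonincreasing_at_right_cvge => // e e' _ _.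
exact: scale_pressure_ni.
Qed.

Lemma Ptop_le B : (forall e, 0 < e -> (scale_pressure e <= B)%E) -> (Ptop T psi <= B)%E.
Proof.
rewrite PtopE => h; apply: ge_ereal_sup => _ [e /= e0 <-]; apply: h.
by move: e0; rewrite in_itv/= andbT.
Qed.

Lemma Ptop_ge B e : 0 < e -> (B <= scale_pressure e)%E -> (B <= Ptop T psi)%E.
Proof.
rewrite PtopE => e0 /le_trans; apply; apply: ereal_sup_ubound.
by exists e => //=; rewrite in_itv/= e0.
Qed.

End pressure.

(** * Uniformity and separated sets on a compact space *)

Section compact_metric.
Context {R : realType} {X : pmetricType R} (cX : compact [set: X]).

(** The Lebesgue number argument, stated for a relation between points so that it yields at once
    uniform continuity, comparison with the Bowen metric and the separation of disjoint closed
    cells. *)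
Lemma uniform_pairs (Q : X -> X -> Prop) :
  (forall x : X, exists2 e : R, 0 < e &
    forall y z, mdist x y < e -> mdist x z < e -> Q y z) ->
  exists2 e : R, 0 < e & forall y z, mdist y z < e -> Q y z.
Proof.
move=> h.
have /compact_near_coveringP nc := cX.
have : \forall e \near (0 : R)^'+, [set: X] `<=` (fun y => forall z, mdist y z < e -> Q y z).
  apply: nc.
  move=> x _; have [e e0 Qe] := h x.
  (* Half of [e] is for the distance from [x] to [y], the other half for the distance from [y] to
     [z]. *)
  exists (ball x (e / 2), [set d | 0 < d < e / 2]) => /=.
    split; first by apply: nbhsx_ballx; rewrite divr_gt0.
    near=> d; apply/andP; split; first by near: d; exact: nbhs_right_gt.
    by near: d; apply: nbhs_right_lt; rewrite divr_gt0.
  move=> [y d] /= []; rewrite ballEmdist /= => xy /andP[d0 de] z yz.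
  apply: Qe; first by apply: lt_trans xy _; rewrite ltr_pdivrMr// ltr_pMr// ltr1n.
  apply: le_lt_trans (metric_triangle x y z) _.
  by rewrite (splitr e) ltrD//; apply: lt_trans yz _.
move=> /(filterI (nbhs_right_gt (0 : R)))/filter_ex[e [/= e0 he]].
by exists e => // y z; exact: he.
Unshelve. all: by end_near. Qed.

Lemma finite_net (e : R) : 0 < e ->
  exists s : seq X, forall x, exists2 c, c \in s & mdist c x < e.
Proof.
move=> e0; have := cX; rewrite compact_cover => /(_ X setT (fun c => ball c e)).
case.
- by move=> c _; apply: open_mdist => x; rewrite ballEmdist /= => cx;
    exists (e - mdist c x); rewrite ?subr_gt0// => y xy; rewrite /=;
    apply: le_lt_trans (metric_triangle c x y) _; rewrite -ltrBrDl.
- by move=> x _; exists x => //; exact: ballxx.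
move=> D _ DX; exists (enum_fset D) => x; have [c /= Dc] := DX x I.
by rewrite ballEmdist /= => cx; exists c.
Qed.

Lemma continuous_unif (f : X -> R) (e : R) : continuous f -> 0 < e ->
  exists2 d : R, 0 < d & forall x y, mdist x y < d -> `|f x - f y| < e.
Proof.
move=> cf e0; apply: uniform_pairs => x.
have e2 : 0 < e / 2 by rewrite divr_gt0.
have /cvgrPdist_lt/(_ _ e2)/nbhs_ballP[d /= d0 h] := cf x.
exists d => // y z xy xz.
have := h y; rewrite ballEmdist => /(_ xy) /= fy.
have := h z; rewrite ballEmdist => /(_ xz) /= fz.
rewrite (_ : f y - f z = (f x - f z) - (f x - f y)); last by ring.
by apply: le_lt_trans (ler_normB _ _) _; rewrite [ltRHS]splitr ltrD.
Qed.

Variables (T : X -> X) (cT : continuous T).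

Lemma continuous_iter j : continuous (iter j T).
Proof.
elim: j => [|j ih] x; first exact: cvg_id.
by apply: continuous_comp; [exact: ih | exact: cT].
Qed.

Lemma bowen_lt m (e : R) x y : 0 < e ->
  (bowen_dist T m x y < e) <-> (forall j, (j < m)%N -> mdist (iter j T x) (iter j T y) < e).
Proof.
move=> e0; rewrite /bowen_dist; split => [h j jm|h].
  by apply: le_lt_trans h; exact: (le_bigmax _ (fun k : 'I_m => mdist (iter k T x) (iter k T y)) (Ordinal jm)).
by apply: bigmax_lt => // i _; exact: h.
Qed.

Lemma bowen_unif m (e : R) : 0 < e ->
  exists2 d : R, 0 < d & forall x y, mdist x y < d -> bowen_dist T m x y < e.
Proof.
move=> e0; apply: uniform_pairs => x.
have e2 : 0 < e / 2 by rewrite divr_gt0.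
suff [d d0 h] : exists2 d : R, 0 < d & forall y, mdist x y < d ->
    forall j, (j < m)%N -> mdist (iter j T x) (iter j T y) < e / 2.
  exists d => // y z xy xz; apply/bowen_lt => // j jm.
  apply: le_lt_trans (metric_triangle _ (iter j T x) _) _.
  by rewrite metric_sym [ltRHS]splitr ltrD ?h.
elim: m => [|m [d d0 ih]]; first by exists 1.
have /nbhs_ballP[d' /= d'0 h] : nbhs x (iter m T @^-1` ball (iter m T x) (e / 2)).
  by apply: continuous_iter; exact: nbhsx_ballx.
exists (Num.min d d'); first by rewrite lt_min d0.
move=> y; rewrite lt_min => /andP[xd xd'] j; rewrite ltnS leq_eqVlt => /predU1P[->|jm].
  by have := h y; rewrite !ballEmdist; apply.
exact: ih.
Qed.

(** A net of mesh [d / 2] bounds the cardinality of separated sets, since two points near the same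
    node are closer than [e] in the Bowen metric. A separated set of largest cardinality then spans:
    a point it missed could be added. *)
Lemma max_separated m (e : R) : 0 < e -> exists C : set X, Defs.separated T m e C /\
  forall x, exists2 c, C c & bowen_dist T m c x < e.
Proof.
move=> e0; have [d d0 hd] := bowen_unif m e0.
have d2 : 0 < d / 2 by rewrite divr_gt0.
have [s hs] := finite_net d2.
pose sep (C : {fset X}) := Defs.separated T m e [set` C].
pose P n := `[< exists2 C : {fset X}, sep C & #|` C| = n >].
have P0 : exists n, P n.
  exists 0%N; apply/asboolP; exists fset0; last by rewrite cardfs0.
  by split; [exact: finite_fset | move=> x y; rewrite /= inE].
have Pub n : P n -> (n <= size s)%N.
  move=> /asboolP[C [_ sC] <-].
  pose g x := sval (cid2 (hs x)).
  have gs x : g x \in s by rewrite /g; case: cid2.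
  have gd x : mdist (g x) x < d / 2 by rewrite /g; case: cid2.
  rewrite -(size_map g); apply: uniq_leq_size; last by move=> _ /mapP[x _ ->].
  rewrite map_inj_in_uniq ?fset_uniq// => x y xC yC gxy.
  apply: contrapT => xy; have := sC x y xC yC xy; rewrite leNgt => /negP; apply.
  apply: hd; apply: le_lt_trans (metric_triangle _ (g x) _) _.
  by rewrite metric_sym [ltRHS]splitr ltrD// gxy.
have [n /asboolP[C sC Cn] nmax] := ex_maxnP P0 Pub.
exists [set` C]; split => // x; apply: contrapT => /forall2NP nx.
have xC : x \notin C.
  apply/negP => xC; have [//|] := nx x; apply; apply/bowen_lt => // j _.
  by rewrite mdistxx.
have : P n.+1.
  apply/asboolP; exists (x |` C)%fset; last by rewrite cardfsU1 xC Cn.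
  have bsym y z : bowen_dist T m y z = bowen_dist T m z y.
    by apply: eq_bigr => i _; rewrite metric_sym.
  split; first exact: finite_fset.
  move=> y z /=; rewrite !inE => /predU1P[->|yC] /predU1P[->|zC] yz //.
  - by rewrite bsym leNgt; apply/negP; have [|] := nx z.
  - by rewrite leNgt; apply/negP; have [|] := nx y.
  - exact: sC.2.
by move=> /nmax; rewrite ltnn.
Qed.

End compact_metric.

(** * Entropy plus energy is at most the pressure *)

Lemma measure_bigsetU_le {R : realType} {d} {Y : measurableType d}
    (mu : {measure set Y -> \bar R}) (I : Type) (s : seq I) (F : I -> set Y) :
  (forall i, measurable (F i)) ->
  (mu (\big[setU/set0]_(i <- s) F i) <= \sum_(i <- s) mu (F i))%E.
Proof.
move=> mF; elim: s => [|i s ih]; first by rewrite !big_nil measure0.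
rewrite !big_cons; apply: le_trans (measureU2 _ (mF i) _) _.
  exact: bigsetU_measurable.
by rewrite leeD2l.
Qed.

Section lower_bound.
Context {R : realType} {X : pmetricType R} (cX : compact [set: X]).
Variables (T : X -> X) (cT : continuous T).
Variable mu : probability (borel X) R.
Hypothesis muT : invariant_measures T mu.
Variables (psi : X -> R) (cpsi : continuous psi).
Variables (k : nat) (a : borel X -> 'I_k) (ma : mlabel a).

Let mT : measurable_fun setT (T : borel X -> borel X) := continuous_borel cT.

(** Shrinking cells to closed subsets buys a positive distance between them, at the cost of a set of
    measure at most [eta], shared as [eta / k] per cell. *)
Lemma inner_cells (eta : R) : 0 < eta -> exists B : 'I_k -> set X,
  [/\ forall i, closed (B i), forall i, B i `<=` a @^-1` [set i] &
      fine (mu (~` (\bigcup_i B i))) <= eta].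
Proof.
move=> eta0; have k0 : (0 < k)%N by case: (a point) => i; apply: leq_ltn_trans.
have e0 : 0 < eta / k%:R by rewrite divr_gt0// ltr0n.
have rg i := (borel_regular mu (ma i)).2 _ e0.
pose B i := sval (cid (rg i)).
have /boolp.choice[D hD] : forall i, exists D : set X,
    [/\ closed (B i), closed D, B i `<=` a @^-1` [set i],
      D `<=` ~` (a @^-1` [set i]) & (mu (~` (B i `|` D)) <= (eta / k%:R)%:E)%E].
  by move=> i; exact: (svalP (cid (rg i))).
exists B; split=> [l|l|]; [by have [] := hD l | by have [] := hD l |].
(* A point outside every [B i] lies in the gap of its own cell [a x], because [D (a x)] avoids that
   cell. *)
have sub : ~` (\bigcup_i B i) `<=` \big[setU/set0]_(i < k) ~` (B i `|` D i).
  move=> x nB; rewrite -bigcup_seq; exists (a x); first by rewrite /= mem_index_enum.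
  move=> [Bx|Dx].
    by apply: nB; exists (a x).
  by have [_ _ _ h _] := hD (a x); exact: (h _ Dx erefl).
have mBD i : measurable (~` (B i `|` D i) : set (borel X)).
  by have [cB cD _ _ _] := hD i; apply: measurableC; apply: measurableU; exact: closed_borel.
have mBU : measurable (~` (\bigcup_i B i) : set (borel X)).
  apply: measurableC; apply: fin_bigcup_measurable; first exact: finite_finset.
  by move=> i _; apply: closed_borel; have [] := hD i.
rewrite -lee_fin fineK ?fin_num_measure//.
apply: (@le_trans _ _ (mu (\big[setU/set0]_(i < k) ~` (B i `|` D i)))).
  by apply: le_measure; rewrite ?inE//; apply: bigsetU_measurable => i _.
apply: (@le_trans _ _ (\sum_(i < k) mu (~` (B i `|` D i)))%E).
  exact: measure_bigsetU_le.
apply: (@le_trans _ _ (\sum_(i < k) (eta / k%:R)%:E)%E).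
  by apply: lee_sum => i _; have [] := hD i.
by rewrite sumEFin sumr_const card_ord lee_fin -[_ *+ k]mulr_natr divfK// pnatr_eq0 -lt0n.
Qed.

(** A small ball around [x] meets only the closed cells that contain [x], and all of these have
    index [a x]. *)
Lemma cells_apart (B : 'I_k -> set X) : (forall i, closed (B i)) ->
  (forall i, B i `<=` a @^-1` [set i]) ->
  exists2 e : R, 0 < e & forall x y, mdist x y < e ->
    forall i j, B i x -> B j y -> i = j.
Proof.
move=> cB Ba; apply: (uniform_pairs cX) => x.
have : forall i, ~ B i x -> exists2 e : R, 0 < e & forall y, mdist x y < e -> ~ B i y.
  by move=> i nB; apply: (open_mdistP (closed_openC (cB i))).
move=> h.
have /boolp.choice[e he] : forall i, exists e : R, 0 < e /\
    forall y, mdist x y < e -> B i y -> B i x.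
  move=> i; have [Bx|/h[e e0 hn]] := pselect (B i x).
    by exists 1.
  by exists e; split => // y /hn.
exists (\big[Num.min/1]_i e i).
  by apply: lt_bigmin => // i _; have [] := he i.
move=> y z xy xz i j Biy Bjz.
have lte l : \big[Num.min/1]_i e i <= e l by apply: bigmin_le.
have Bix : B i x by apply: (he i).2 Biy; apply: lt_le_trans xy _.
have Bjx : B j x by apply: (he j).2 Bjz; apply: lt_le_trans xz _.
by rewrite -(Ba _ _ Bix) -(Ba _ _ Bjx).
Qed.

Variables (delta : R) (delta01 : 0 < delta < 1).

(** A noisy channel: the letter equals the guess [g] with weight [1 - delta], and every other letter
    keeps the positive weight [delta / k]. *)
Let kappa (i g : 'I_k) : R := if i == g then 1 - delta else delta / k%:R.

Let k_gt0 : (0 < k)%N.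
Proof. by case: (a point) => i; apply: leq_ltn_trans. Qed.

Let kappa_gt0 i g : 0 < kappa i g.
Proof.
case/andP: delta01 => d0 d1; rewrite /kappa; case: ifP => _; first by rewrite subr_gt0.
by rewrite divr_gt0// ltr0n.
Qed.

Let kappa_sum g : \sum_i kappa i g <= 1.
Proof.
case/andP: delta01 => d0 d1; rewrite (bigD1 g)//= /kappa eqxx.
apply: (@le_trans _ _ (1 - delta + \sum_(i < k) delta / k%:R)).
  rewrite lerD2l [leRHS](bigD1 g)//=.
  apply: (@le_trans _ _ (\sum_(i < k | i != g) delta / k%:R)).
    by apply: ler_sum => i /negbTE ->.
  by rewrite lerDr divr_ge0// ltW.
by rewrite sumr_const card_ord -[_ *+ k]mulr_natr divfK ?subrK// pnatr_eq0 -lt0n.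
Qed.

Let L := - ln (delta / k%:R * (1 - delta)).

(** [L] bounds the extra price of a wrong guess, uniformly over letters and guesses. *)
Let ln_kappa i g : ln (1 - delta) - L <= ln (kappa i g).
Proof.
case/andP: delta01 => d0 d1.
have d1' : 0 < 1 - delta by rewrite subr_gt0.
have dk : 0 < delta / k%:R by rewrite divr_gt0// ltr0n.
have dk1 : delta / k%:R <= 1.
  rewrite ler_pdivrMr ?ltr0n// mul1r; apply: le_trans (ltW d1) _.
  by rewrite ler1n.
have -> : ln (1 - delta) - L = ln ((1 - delta) * (delta / k%:R * (1 - delta))).
  by rewrite /L opprK [in RHS]lnM// posrE// mulr_gt0.
rewrite ler_ln ?posrE//; last by do 2 apply: mulr_gt0 => //.
have d1'' : 1 - delta <= 1 by lra.
rewrite /kappa; case: ifP => _.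
  by apply: ler_piMr; [exact: ltW | apply: mulr_ile1 => //; exact: ltW].
by rewrite mulrCA; apply: ler_piMr; [exact: ltW | apply: mulr_ile1 => //; exact: ltW].
Qed.

Variables (B : 'I_k -> set X) (cB : forall i, closed (B i)).
Hypothesis Ba : forall i, B i `<=` a @^-1` [set i].
Variables (e tau : R).
Hypothesis e_apart : forall x y, mdist x y < e + e -> forall i j, B i x -> B j y -> i = j.
Hypothesis e_psi : forall x y, mdist x y < e -> `|psi x - psi y| < tau.

(** A letter read off from [y] alone when a closed cell passes within [e] of [y]; [e_apart] makes
    that cell unique. The default [a y] is taken only when no closed cell is near. *)
Let guess (y : X) : 'I_k := xget (a y) [set i | exists2 x, B i x & mdist y x < e].

Let guessP y x i : B i x -> mdist y x < e -> guess y = i.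
Proof.
move=> Bx yx; rewrite /guess; case: xgetP => [j _ [x' Bx' yx']|/(_ i)]; last first.
  by case; exists x.
apply: (e_apart _ Bx' Bx); apply: le_lt_trans (metric_triangle x' y x) _.
by rewrite metric_sym ltrD.
Qed.

Let off : set (borel X) := ~` (\bigcup_i B i).

Let moff : measurable off.
Proof.
apply: measurableC; apply: fin_bigcup_measurable; first exact: finite_finset.
by move=> i _; exact: closed_borel.
Qed.

(* Gibbs' inequality against the mixture, over the points c of a spanning set
   with weights exp(S_m psi c), of the product laws concentrated on the name
   guessed from the orbit of c. *)
Lemma name_entropy_bound m (C : seq X) (e0 : 0 < e) :
  (forall x, exists2 c, c \in C & bowen_dist T m c x < e) ->
  label_entropy mu (name (T : borel X -> borel X) a m) + m%:R * avg mu psi <=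
  ln (\sum_(c <- C) expR (birkhoff_sum T psi m c)) +
  m%:R * (tau - ln (1 - delta) + L * fine (mu off)).
Proof.
move=> spanC; set S := birkhoff_sum T psi m; set Z := \sum_(c <- C) _.
have C0 c : c \in C -> expR (S c) <= Z.
  by move=> cC; rewrite /Z (big_rem _ cC)/= lerDl sumr_ge0// => *; exact: expR_ge0.
have Z0 : 0 < Z.
  by have [c cC _] := spanC point; apply: lt_le_trans (C0 _ cC); exact: expR_gt0.
pose K c (w : {ffun 'I_m -> 'I_k}) := \prod_(j < m) kappa (w j) (guess (iter j T c)).
have K0 c w : 0 < K c w by apply: prodr_gt0.
pose q w := \sum_(c <- C) expR (S c) / Z * K c w.
have t0 c w : 0 < expR (S c) / Z * K c w by rewrite mulr_gt0// divr_gt0// expR_gt0.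
have q0 w : 0 < q w.
  have [c cC _] := spanC point; rewrite /q (big_rem _ cC)/= ltr_pwDl//.
  by apply: sumr_ge0 => *; exact: ltW.
have mn : mlabel (name (T : borel X -> borel X) a m) by exact: mlabel_name.
(* Each product law has mass at most 1 because its factors do, and the weights of the points [c] add
   up to 1. *)
have q1 : \sum_w q w <= \sum_w law mu (name (T : borel X -> borel X) a m) w.
  rewrite law_sum1// /q exchange_big/=.
  apply: (@le_trans _ _ (\sum_(c <- C) expR (S c) / Z)).
    apply: ler_sum => c _; rewrite -mulr_sumr ler_piMr//.
      by rewrite divr_ge0 ?expR_ge0// ltW.
    rewrite -(bigA_distr_bigA (fun (j : 'I_m) i => kappa i (guess (iter j T c))))/=.
    by apply: prodr_ile1 => j _; rewrite kappa_sum sumr_ge0// => i _; exact: ltW.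
  by rewrite -mulr_suml divff// gt_eqF.
pose rhs x := (ln Z + m%:R * (tau - ln (1 - delta))) +
  \sum_(j < m) (L * \1_off (iter j T x) + -1 * psi (iter j T x)).
(* Of the mixture only the term of a point [c] shadowing [x] is kept. It costs [ln Z - S c], then
   [- ln (1 - delta)] per time step and [L] per visit to [off]; replacing [S c] by [S x] costs [tau]
   per step. *)
have key x : - ln (q (name (T : borel X -> borel X) a m x)) <= rhs x.
  have [c cC cx] := spanC x.
  have {}cx j : (j < m)%N -> mdist (iter j T c) (iter j T x) < e.
    by move: cx => /(bowen_lt _ _ _ _ e0); apply.
  rewrite lerNl; apply: (@le_trans _ _ (ln (expR (S c) / Z * K c (name (T : borel X -> borel X) a m x)))); last first.
    rewrite ler_ln ?posrE// /q (big_rem _ cC)/= lerDl.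
    by apply: sumr_ge0 => *; exact: ltW.
  rewrite lnM ?posrE ?divr_gt0 ?expR_gt0// ln_div ?posrE ?expR_gt0// expRK.
  have -> : ln (K c (name (T : borel X -> borel X) a m x)) =
      \sum_(j < m) ln (kappa (a (iter j T x)) (guess (iter j T c))).
    rewrite /K; rewrite -[RHS](expRK (_ : R)) expR_sum; congr ln.
    by apply: eq_bigr => j _; rewrite lnK ?posrE// ffunE.
  have Sx : S x <= S c + m%:R * tau.
    rewrite -lerBlDl /S /birkhoff_sum -sumrB mulr_natl -[X in tau *+ X]card_ord -sumr_const.
    apply: ler_sum => j _; have := e_psi (cx j (ltn_ord j)).
    by rewrite ltr_norml => /andP[+ _]; lra.
  (* Outside [off] the orbit of [x] is in a closed cell and the guess from the orbit of [c] is
     right; [ln_kappa] covers the other times. *)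
  have Kx : \sum_(j < m) (ln (1 - delta) - L * \1_off (iter j T x)) <=
      \sum_(j < m) ln (kappa (a (iter j T x)) (guess (iter j T c))).
    apply: ler_sum => j _; rewrite indicE; case: (boolP (_ \in off)) => [_|].
      by rewrite mulr1.
    rewrite notin_setE mulr0 subr0 => /contrapT[i _ Bi].
    by rewrite (guessP Bi (cx j (ltn_ord j))) (Ba Bi) /kappa eqxx.
  rewrite /rhs big_split/= -!mulr_sumr mulN1r.
  rewrite (_ : \sum_(i < m) psi (iter i T x) = S x)//.
  move: Kx; rewrite sumrB sumr_const card_ord -mulr_sumr -mulr_natl => Kx.
  lra.
have bq : bmeas ((fun w => - ln (q w)) \o name (T : borel X -> borel X) a m).
  exact: bmeas_label.
have boff j : bmeas (\1_off \o iter j T : borel X -> R).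
  apply: (bmeas_iter (T := T : borel X -> borel X)) => //; exact: bmeas_indic.
have bpsi : bmeas (psi : borel X -> R) by exact: continuous_bmeas.
have bpsij j : bmeas (psi \o iter j T : borel X -> R).
  by apply: (bmeas_iter (T := T : borel X -> borel X)).
have bt j : bmeas (fun x : borel X => L * \1_off (iter j T x) + -1 * psi (iter j T x)).
  by apply: bmeasD; apply: bmeasZ; [exact: boff | exact: bpsij].
have brhs : bmeas (rhs : borel X -> R).
  by apply: bmeasD; [exact: bmeas_cst | apply: bmeas_sum => j].
have avg_rhs : avg mu rhs = ln Z + m%:R * (tau - ln (1 - delta)) +
    m%:R * (L * fine (mu off) - avg mu psi).
  rewrite /rhs avgD ?avg_cst//; last 2 first.
  - exact: bmeas_cst.
  - by apply: bmeas_sum => j.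
  congr (_ + _); rewrite avg_sum// mulr_natl -[X in _ *+ X]card_ord -sumr_const.
  apply: eq_bigr => j _; rewrite avgD; [|exact: bmeasZ (boff j)|exact: bmeasZ (bpsij j)].
  rewrite !avgZ; [|exact: bpsij|exact: boff].
  rewrite (avg_iter (T := T : borel X -> borel X) mT muT j bpsi).
  rewrite (avg_iter (T := T : borel X -> borel X) mT muT j (bmeas_indic moff)).
  by rewrite avg_indic// mulN1r.
have Hq : label_entropy mu (name (T : borel X -> borel X) a m) <=
    avg mu ((fun w => - ln (q w)) \o name (T : borel X -> borel X) a m).
  rewrite avg_label// /label_entropy lerNl -sumrN.
  under eq_bigr do rewrite mulrN opprK.
  by apply: gibbs => // w; [exact: law_ge0 | exact: ltW].
have := le_avg mu bq brhs key; rewrite avg_rhs => Hr.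
lra.
Qed.

End lower_bound.

Section goodwyn.
Context {R : realType} {X : pmetricType R} (cX : compact [set: X]).
Variables (T : X -> X) (cT : continuous T).
Variables (mu : probability (borel X) R) (psi : X -> R).
Hypotheses (muT : invariant_measures T mu) (cpsi : continuous psi).

(** The error [s] has four equal shares: the distance of the entropy at time [m] from its limit, the
    oscillation of [psi] at scale [e], [- ln (1 - delta)], and [L] times the measure missed by the
    closed cells. The order of choices is [delta], then [eta], then [e], then [m]. *)
Lemma label_entropy_le_Ptop (k : nat) (a : borel X -> 'I_k) : mlabel a ->
  ((lim ((m%:R^-1 * label_entropy mu (name (T : borel X -> borel X) a m)) @[m --> \oo]) + avg mu psi)%:E
    <= Ptop T psi)%E.
Proof.
move=> ma; set u := (fun m => _); set l : R := lim _.
have ul : u @ \oo --> l.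
  exact: (label_entropy_name_cvg (continuous_borel cT : measurable_fun setT (T : borel X -> borel X)) muT).
apply/lee_addgt0Pr => s s0; rewrite -leeBlDr// -EFinB.
have s4 : 0 < s / 4 by rewrite divr_gt0.
(* Chosen so that [- ln (1 - delta)] is exactly [s / 4]. *)
pose delta : R := 1 - expR (- (s / 4)).
have delta01 : 0 < delta < 1.
  by rewrite /delta subr_gt0 -[ltRHS]expR0 ltr_expR oppr_lt0 s4/= gtrBl expR_gt0.
have lnd : ln (1 - delta) = - (s / 4).
  by rewrite /delta opprB addrC subrK expRK.
pose L := - ln (delta / k%:R * (1 - delta)).
(* [L] depends only on [delta] and [k], so the measure lost to closed cells can be fixed after it;
   the [+ 1] keeps the divisor positive. *)
pose eta := s / 4 / (`|L| + 1).
have L1 : 0 < `|L| + 1 by rewrite ltr_wpDl.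
have eta0 : 0 < eta by rewrite divr_gt0.
have [B [cB Ba muB]] := inner_cells mu ma eta0.
have [e1 e10 he1] := cells_apart cX cB Ba.
have [e2 e20 he2] := continuous_unif cX cpsi s4.
pose e := Num.min (e1 / 2) e2.
have e0 : 0 < e by rewrite lt_min divr_gt0.
have ee : e + e <= e1.
  by rewrite [leRHS]splitr; apply: lerD; rewrite ge_min lexx.
apply: (Ptop_ge e0); apply: limn_esup_ge => N.
have /cvgrPdist_lt/(_ _ s4)[N' _ hN'] := ul.
pose m := (maxn N N').+1; exists m; first by rewrite /m leqW// leq_maxl.
have Hm : l - s / 4 <= m%:R^-1 * label_entropy mu (name (T : borel X -> borel X) a m).
  have := hN' m; rewrite /= /m leqW ?leq_maxr// => /(_ isT).
  by rewrite ltr_norml /u => /andP[_ /ltW]; rewrite !lerBlDr addrC.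
(* [C] serves twice: it spans, as [name_entropy_bound] requires, and it is separated, so its
   exponential sum is at most [separated_sum]. *)
have [C [sC spanC]] := max_separated cX cT m e0.
have fC := sC.1.
have q1 x y : mdist x y < e + e -> forall i j, B i x -> B j y -> i = j.
  by move=> xy; apply: he1; apply: lt_le_trans xy ee.
have q2 x y : mdist x y < e -> `|psi x - psi y| < s / 4.
  by move=> xy; apply: he2; apply: lt_le_trans xy _; rewrite ge_min lexx orbT.
have q3 x : exists2 c, c \in (fset_set C : seq X) & bowen_dist T m c x < e.
  by have [c Cc cx] := spanC x; exists c => //; rewrite in_fset_set// inE.
have Hbound := name_entropy_bound cX cT muT cpsi ma delta01 cB Ba q1 q2 e0 q3.
rewrite -/L lnd in Hbound; set Z := \sum_(c <- _) _ in Hbound.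
have Z0 : 0 < Z.
  have [c Cc _] := spanC point.
  have cC : c \in (fset_set C : seq X) by rewrite in_fset_set// inE.
  rewrite /Z (big_rem _ cC)/= ltr_pwDl ?expR_gt0//.
  by apply: sumr_ge0 => *; exact: expR_ge0.
apply: (@le_trans _ _ ((m%:R^-1)%:E * lne Z%:E)%E); last first.
  apply: lee_wpmul2l; first by rewrite lee_fin.
  apply: ge0_lne_le; first by rewrite lee_fin ltW.
  by apply: ereal_sup_ubound; exists C => //; rewrite fsbig_finite.
rewrite lne_EFin// -EFinM lee_fin.
have m0 : 0 < m%:R :> R by rewrite ltr0n.
have LB : L * fine (mu (~` (\bigcup_i B i))) <= s / 4.
  apply: le_trans (ler_norm _) _; rewrite normrM (ger0_norm (fine_ge0 _))//.
  apply: (@le_trans _ _ (`|L| * eta)); first by rewrite ler_wpM2l.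
  by rewrite /eta mulrA ler_pdivrMr// mulrC ler_wpM2l ?ltW// ltrDl.
rewrite mulrC ler_pdivlMr//.
move: Hm; rewrite [_^-1 * _]mulrC ler_pdivlMr//.
move: LB Hbound; set o := L * _; set M : R := m%:R; set h := label_entropy _ _ => LB Hbound Hm.
have : M * (s / 4 - - (s / 4) + o) <= M * (s / 4 + s / 4 + s / 4).
  by apply: ler_wpM2l; [exact: ltW | lra].
lra.
Qed.

Lemma goodwyn : (ks_entropy T mu + (mean mu psi)%:E <= Ptop T psi)%E.
Proof.
rewrite -leeBrDr//; apply: ks_entropy_ub => k a ma.
by rewrite leeBrDr// -EFinD; exact: label_entropy_le_Ptop.
Qed.

End goodwyn.

(** * Invariant measures as limits of empirical averages *)

Section content_to_measure.
Context {R : realType} {X : pmetricType R} (cX : compact [set: X]).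
Variable l : set X -> R.
Hypothesis l_set0 : l set0 = 0.
Hypothesis l_setT : l setT = 1.
Hypothesis l_mono : forall A B, A `<=` B -> l A <= l B.
Hypothesis l_setU : forall A B, A `&` B = set0 -> l (A `|` B) = l A + l B.

Let l_le A B : l (A `|` B) <= l A + l B.
Proof.
rewrite (_ : A `|` B = A `|` (B `\` A)) ?l_setU.
- by rewrite lerD2l; apply: l_mono; exact: subDsetl.
- by rewrite setDE setICA setICr setI0.
- by rewrite setUDr setDv setD0.
Qed.

(* l is finitely additive on all subsets; regularizing it turns it into a Borel
   measure that agrees with it on the sets with null frontier. *)
Definition inner_content (V : set X) : \bar R :=
  ereal_sup [set (l K)%:E | K in [set K | closed K /\ K `<=` V]].

Definition outer_content (A : set X) : \bar R :=
  ereal_inf (inner_content @` [set V | open V /\ A `<=` V]).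

Let inner_content_closed V K : closed K -> K `<=` V -> ((l K)%:E <= inner_content V)%E.
Proof. by move=> cK KO; apply: ereal_sup_ubound; exists K. Qed.

Let inner_content_ge0 V : (0 <= inner_content V)%E.
Proof.
apply: le_trans (@inner_content_closed V set0 _ _) => //; first by rewrite l_set0.
exact: closed0.
Qed.

Let inner_content_mono V V' : V `<=` V' -> (inner_content V <= inner_content V')%E.
Proof.
move=> OO; apply: le_ereal_sup => _ [K [cK KO] <-]; exists K => //.
by split => //; exact: subset_trans OO.
Qed.

Lemma inner_content_le V : (inner_content V <= (l V)%:E)%E.
Proof. by apply: ge_ereal_sup => _ [K [_ KO] <-]; rewrite lee_fin l_mono. Qed.

Let compact_closed_sub (K : set X) : closed K -> compact K.
Proof. by move=> cK; exact: (subclosed_compact cK cX). Qed.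

(** By compactness a closed [K] inside the union is covered by erosions of finitely many [V i];
    these are closed, and finite subadditivity of [l] concludes. *)
Lemma inner_content_bigcup (V : nat -> set X) : (forall i, open (V i)) ->
  (inner_content (\bigcup_i V i) <= \sum_(i <oo) inner_content (V i))%E.
Proof.
move=> oO; apply: ge_ereal_sup => _ [K [cK KO] <-].
have /compact_near_coveringP nc := compact_closed_sub cK.
(* One index [n] both truncates the union and sets the depth of the erosions, so that compactness is
   applied along a single parameter. *)
pose P n x := exists2 i, (i < n)%N & erosion (V i) n.+1%:R^-1 x.
have : \forall n \near \oo, K `<=` P n.
  apply: nc => x /KO[i _ Ox]; have [e e0 eO] := open_mdistP (oO i) Ox.
  have e2 : 0 < e / 2 by rewrite divr_gt0.
  exists (ball x (e / 2), [set n | (i < n)%N /\ n.+1%:R^-1 < e / 2]) => /=.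
    split; first exact: nbhsx_ballx.
    near=> n; split; first by near: n; exact: nbhs_infty_gt.
    by near: n; exact: near_infty_natSinv_lt (PosNum e2).
  move=> [y n] /= []; rewrite ballEmdist /= => xy [i_n n2]; exists i => // z nOz.
  apply: contrapT => /negP; rewrite -ltNge => yz; apply: nOz; apply: eO.
  apply: le_lt_trans (metric_triangle x y z) _; rewrite [ltRHS]splitr ltrD//.
  exact: lt_trans yz n2.
move=> /filter_ex[n KP].
apply: (@le_trans _ _ (\sum_(i < n) inner_content (V i))%E); last first.
  by rewrite -(big_mkord xpredT (fun i => inner_content (V i))); apply: nneseries_lim_ge.
apply: (@le_trans _ _ (\sum_(i < n) (l (erosion (V i) n.+1%:R^-1))%:E)%E); last first.
  apply: lee_sum => i _; apply: inner_content_closed; first exact: closed_erosion.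
  by apply: erosion_sub; rewrite invr_gt0.
rewrite sumEFin lee_fin; apply: (@le_trans _ _ (l (\big[setU/set0]_(i < n) erosion (V i) n.+1%:R^-1))).
  apply: l_mono => x /KP[i i_n ix]; rewrite -(bigcup_mkord n (fun i => erosion (V i) n.+1%:R^-1)).
  by exists i.
elim/big_ind2 : _ => [|A a B b Aa Bb|//]; first by rewrite l_set0.
by apply: le_trans (l_le _ _) _; exact: lerD.
Unshelve. all: by end_near. Qed.

Lemma outer_content_open V : open V -> outer_content V = inner_content V.
Proof.
move=> oO; apply/eqP; rewrite eq_le; apply/andP; split.
  by apply: ereal_inf_lbound; exists V => //; split.
by apply: le_ereal_inf_tmp => _ [V' [oO' OO'] <-]; exact: inner_content_mono.
Qed.

Let outer_content_ge0 A : (0 <= outer_content A)%E.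
Proof. by apply: le_ereal_inf_tmp => _ [V [oO AO] <-]. Qed.

Let outer_content_mono : {homo outer_content : A B / A `<=` B >-> (A <= B)%E}.
Proof.
move=> A B AB; apply: le_ereal_inf => _ [V [oO BO] <-]; exists V => //.
by split => //; exact: subset_trans BO.
Qed.

Let outer_content_le1 A : (outer_content A <= 1)%E.
Proof.
apply: (@le_trans _ _ (outer_content setT)); first exact: outer_content_mono.
rewrite outer_content_open; last exact: openT.
by apply: le_trans (inner_content_le _) _; rewrite l_setT.
Qed.

Let outer_content_fin A : outer_content A \is a fin_num.
Proof.
by rewrite ge0_fin_numE//; apply: le_lt_trans (outer_content_le1 A) _; rewrite ltry.
Qed.

Let outer_content0 : outer_content set0 = 0%E.
Proof.
apply/eqP; rewrite eq_le outer_content_ge0 andbT outer_content_open; last exact: open0.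
by apply: le_trans (inner_content_le _) _; rewrite l_set0.
Qed.

Let outer_content_approx A (e : R) : 0 < e -> exists V, [/\ open V, A `<=` V &
  (inner_content V <= outer_content A + e%:E)%E].
Proof.
move=> e0; have [_ [V [oO AO] <-] h] := lb_ereal_inf_adherent e0 (outer_content_fin A).
by exists V; split => //; exact: ltW.
Qed.

Let outer_content_sub : sigma_subadditive outer_content.
Proof.
move=> A; apply/lee_addgt0Pr => e e0.
have h i : exists V, [/\ open V, A i `<=` V &
    (inner_content V <= outer_content (A i) + (e / (2 ^ i.+1)%:R)%:E)%E].
  by apply: outer_content_approx; rewrite divr_gt0// ltr0n expn_gt0.
have [V hO] := boolp.choice h.
apply: (@le_trans _ _ (inner_content (\bigcup_i V i))).
  apply: ereal_inf_lbound; exists (\bigcup_i V i) => //; split.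
    by apply: bigcup_open => i _; have [] := hO i.
  by move=> x [i _ Ax]; exists i => //; have [_ AO _] := hO i; exact: AO.
apply: le_trans (inner_content_bigcup _) _; first by move=> i; have [] := hO i.
apply: le_trans (epsilon_trick xpredT _ (ltW e0)); last by [].
by apply: lee_nneseries => // i _; have [] := hO i.
Qed.

HB.instance Definition _ := isOuterMeasure.Build R X outer_content
  outer_content0 outer_content_ge0 outer_content_mono outer_content_sub.

(** The test set may be replaced by an open [G]. A closed [K] in the part of [G] inside [V] and a
    closed [K'] in [G] minus [K] are disjoint, so [l] adds; and [G] minus [K] is an open set
    containing the part of [G] outside [V]. *)
Let open_caratheodory (V : set X) : open V -> (outer_content).-caratheodory V.
Proof.
move=> oO; apply: le_caratheodory_measurable => A; apply: le_ereal_inf_tmp => _ [G [oG AG] <-].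
apply: (@le_trans _ _ (inner_content (G `&` V) + outer_content (G `&` ~` V))%E).
  apply: leeD; last by apply: outer_content_mono; exact: setSI.
  rewrite -outer_content_open; last exact: openI.
  by apply: outer_content_mono; exact: setSI.
rewrite -leeBrDr; last exact: outer_content_fin.
apply: ge_ereal_sup => _ [K [cK KGO] <-].
rewrite leeBrDr; last exact: outer_content_fin.
rewrite addeC -leeBrDr//.
apply: (@le_trans _ _ (inner_content (G `&` ~` K))).
  apply: ereal_inf_lbound; exists (G `&` ~` K) => //; split.
    by apply: openI => //; exact: closed_openC.
  by move=> x [Gx nO]; split => // /KGO[].
apply: ge_ereal_sup => _ [K' [cK' K'G] <-].
rewrite leeBrDr// -EFinD -l_setU.
  apply: inner_content_closed; first exact: closedU.
  by move=> x [/K'G[]|/KGO[]].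
by apply/seteqP; split => // x [/K'G[_ nK]].
Qed.

Let borel_caratheodory (A : set (borel X)) : measurable A ->
  (outer_content).-caratheodory A.
Proof.
apply: smallest_sub; last exact: open_caratheodory.
split.
- exact: caratheodory_measurable_set0.
- by move=> B mB; rewrite setTD; exact: caratheodory_measurable_setC.
- by move=> F mF; exact: caratheodory_measurable_bigcup.
Qed.

Let mm (A : set (borel X)) : \bar R := outer_content A.

Let mm_sigma_additive : semi_sigma_additive mm.
Proof.
move=> F mF tF mUF; apply: (@caratheodory_measure_sigma_additive R X outer_content) => //.
- by move=> i; exact: borel_caratheodory.
- exact: borel_caratheodory.
Qed.

HB.instance Definition _ := isMeasure.Build _ (borel X) R mm
  outer_content0 outer_content_ge0 mm_sigma_additive.

Let mm_setT : mm setT = 1%E.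
Proof.
apply/eqP; rewrite eq_le; apply/andP; split; first exact: outer_content_le1.
rewrite /mm outer_content_open; last exact: openT.
rewrite -[X in (X%:E <= _)%E]l_setT; apply: inner_content_closed => //; exact: closedT.
Qed.

HB.instance Definition _ := Measure_isProbability.Build _ (borel X) R mm mm_setT.

Variables (T : X -> X) (cT : continuous T).
Hypothesis lT : forall A, l (T @^-1` A) = l A.

(** If a closed [K] lies over [V], its image is compact, hence closed, and lies in [V]; moreover [K]
    is inside the preimage of its image, which has the same [l] as the image. *)
Let outer_content_preim A : (outer_content (T @^-1` A) <= outer_content A)%E.
Proof.
apply: le_ereal_inf_tmp => _ [V [oO AO] <-].
apply: (@le_trans _ _ (inner_content (T @^-1` V))).
  apply: ereal_inf_lbound; exists (T @^-1` V) => //; split.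
    by move/continuousP: cT; exact.
  exact: preimage_subset.
apply: ge_ereal_sup => _ [K [cK KTO] <-].
have cTK : closed (T @` K).
  apply: compact_closed; first exact: metric_hausdorff.
  by apply: continuous_compact; [exact: continuous_subspaceT | exact: compact_closed_sub].
apply: (@le_trans _ _ (l (T @` K))%:E).
  by rewrite lee_fin -[leRHS]lT; apply: l_mono => x Kx; exists x.
by apply: inner_content_closed => // _ [x Kx <-]; exact: KTO.
Qed.

(** These are the inequalities of the portmanteau theorem; together they force equality on sets with
    null frontier. The closed case follows from the open one by complementation. *)
Lemma content_measure : exists mu : probability (borel X) R,
  [/\ invariant_measures T mu,
      forall V : set X, open V -> fine (mu V) <= l V &
      forall C : set X, closed C -> l C <= fine (mu C)].
Proof.
exists mm; have hO (V : set X) : open V -> fine (mm V) <= l V.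
  move=> oO; rewrite -lee_fin fineK; last exact: outer_content_fin.
  by rewrite /mm outer_content_open//; exact: inner_content_le.
have fC (A : set (borel X)) : measurable A -> fine (mm (~` A)) = 1 - fine (mm A).
  move=> mA; have := @probability_setC _ _ _ mm A mA => /= ->.
  by rewrite fineB// ; exact: outer_content_fin.
split => //.
- move=> A mA; apply/eqP; rewrite eq_le; apply/andP; split; first exact: outer_content_preim.
  have mTA : measurable (T @^-1` A : set (borel X)).
    by rewrite -[X in measurable X]setTI; exact: (continuous_borel cT).
  (* Applied to the complement, the one-sided bound gives the missing inequality, total mass being
     1. *)
  have := outer_content_preim (~` A); rewrite preimage_setC.
  rewrite -(fineK (outer_content_fin _)) -[X in (_ <= X)%E](fineK (outer_content_fin _)) lee_fin.
  rewrite (fC _ mA) (fC _ mTA) lerD2l lerN2 => h.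
  by rewrite -[leLHS](fineK (outer_content_fin A)) -[leRHS](fineK (outer_content_fin (T @^-1` A))) lee_fin.
- move=> C cC; have := hO _ (closed_openC cC); rewrite fC; last exact: closed_borel.
  have : l (C `|` ~` C) = l C + l (~` C) by rewrite l_setU// setICr.
  by rewrite setUCr l_setT => ->; lra.
Qed.

End content_to_measure.

Definition bounded_fct {R : realType} {X : Type} (f : X -> R) :=
  exists M, forall x, `|f x| <= M.

Section bounded_fct.
Context {R : realType} {X : Type}.
Implicit Types f g : X -> R.

Lemma bounded_fctD f g : bounded_fct f -> bounded_fct g -> bounded_fct (fun x => f x + g x).
Proof.
by move=> [M fM] [N gN]; exists (M + N) => x; apply: le_trans (ler_normD _ _) _; exact: lerD.
Qed.

Lemma bounded_fctZ c f : bounded_fct f -> bounded_fct (fun x => c * f x).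
Proof. by move=> [M fM]; exists (`|c| * M) => x; rewrite normrM ler_wpM2l. Qed.

Lemma bounded_fct_cst (c : R) : bounded_fct (fun _ : X => c).
Proof. by exists `|c|. Qed.

Lemma bounded_fct_indic (A : set X) : bounded_fct (\1_A : X -> R).
Proof. by exists 1 => x; rewrite indicE; case: (_ \in _); rewrite ?normr1 ?normr0. Qed.

Lemma bounded_fct_label (I : finType) (b : X -> I) (phi : I -> R) : bounded_fct (phi \o b).
Proof.
exists (\sum_i `|phi i|) => x /=; rewrite (bigD1 (b x))//= lerDl.
by apply: sumr_ge0.
Qed.

End bounded_fct.

(** * Ultrafilter limits of empirical averages *)

Section ultralimit.
Context {R : realType}.

Lemma ultra_fmap (S V : Type) (f : S -> V) (F : set_system S) :
  UltraFilter F -> UltraFilter (f @ F).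
Proof.
move=> FU; split; first exact: fmap_proper_filter.
move=> G GF sub; apply/seteqP; split => // A GA.
have [//|FnA] := @in_ultra_setVsetC _ F (f @^-1` A) FU.
have /filter_ex[x []//] : G (A `&` ~` A) by apply: filterI => //; exact: sub.
Qed.

Lemma ultra_cvg (S : Type) (F : set_system S) (u : S -> R) :
  UltraFilter F -> bounded_fct u -> cvg (u @ F).
Proof.
move=> FU [M uM]; have := @segment_compact R (- M) M.
rewrite compact_ultra => /(_ _ (ultra_fmap u FU)).
case=> [|p [_ up]]; last by apply/cvg_ex; exists p.
apply: (@filterS _ F _ setT); last exact: filterT.
by move=> x _ /=; rewrite in_itv/= -ler_norml; exact: uM.
Qed.

End ultralimit.

(** A [T]-invariant mean on all bounded functions, measurable or not. Nothing is prescribed on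
    unbounded functions, and additivity is only finite. *)
Record state {R : realType} {X : Type} (T : X -> X) (L : (X -> R) -> R) : Prop := State {
  stateD : forall f g, bounded_fct f -> bounded_fct g -> L (fun x => f x + g x) = L f + L g;
  stateZ : forall c f, bounded_fct f -> L (fun x => c * f x) = c * L f;
  state_mono : forall f g, bounded_fct f -> bounded_fct g ->
    (forall x, f x <= g x) -> L f <= L g;
  state1 : L (fun=> 1) = 1;
  stateT : forall f, bounded_fct f -> L (f \o T) = L f }.

Section empirical.
Context {R : realType} {X : eqType} (T : X -> X).

(** The Krylov-Bogolyubov average: the weighted point masses on [s], pushed forward by the first [N]
    iterates. *)
Definition empirical (N : nat) (s : seq X) (w : X -> R) (f : X -> R) : R :=
  N%:R^-1 * \sum_(t < N) \sum_(x <- s) w x * f (iter t T x).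

Variables (N : nat) (s : seq X) (w : X -> R).
Hypotheses (w0 : forall x, 0 <= w x) (w1 : \sum_(x <- s) w x = 1) (N0 : (0 < N)%N).
Local Notation E := (empirical N s w).

Let NR : 0 < N%:R :> R. Proof. by rewrite ltr0n. Qed.

Lemma empiricalD f g : E (fun x => f x + g x) = E f + E g.
Proof.
rewrite /empirical -mulrDr -big_split; congr (_ * _); apply: eq_bigr => t _ /=.
by rewrite -big_split; apply: eq_bigr => x _ /=; rewrite mulrDr.
Qed.

Lemma empiricalZ c f : E (fun x => c * f x) = c * E f.
Proof.
rewrite /empirical [RHS]mulrCA [in RHS]mulr_sumr; congr (_ * _).
apply: eq_bigr => t _ /=; rewrite [in RHS]mulr_sumr.
by apply: eq_bigr => x _ /=; rewrite mulrCA.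
Qed.

Lemma empirical_mono f g : (forall x, f x <= g x) -> E f <= E g.
Proof.
move=> fg; apply: ler_wpM2l; first by rewrite invr_ge0 ltW.
by apply: ler_sum => t _; apply: ler_sum => x _; exact: ler_wpM2l.
Qed.

Lemma empirical_cst c : E (fun=> c) = c.
Proof.
rewrite /empirical; under eq_bigr do rewrite -mulr_suml w1 mul1r.
by rewrite sumr_const card_ord -[c *+ N]mulr_natl mulKf// gt_eqF.
Qed.

Lemma empirical_le f M : (forall x, `|f x| <= M) -> `|E f| <= M.
Proof.
move=> fM; rewrite ler_norml; apply/andP; split.
  rewrite -[leLHS]empirical_cst; apply: empirical_mono => x.
  by have := fM x; rewrite ler_norml => /andP[].
rewrite -[leRHS]empirical_cst; apply: empirical_mono => x.
by have := fM x; rewrite ler_norml => /andP[].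
Qed.

(** The sum over time telescopes, leaving the terms at times [N] and 0. *)
Lemma empirical_shift f M : (forall x, `|f x| <= M) ->
  `|E (f \o T) - E f| <= N%:R^-1 * (M + M).
Proof.
move=> fM; rewrite /empirical -mulrBr normrM ger0_norm; last by rewrite invr_ge0 ltW.
apply: ler_wpM2l; first by rewrite invr_ge0 ltW.
pose u t := \sum_(x <- s) w x * f (iter t T x).
have uM t : `|u t| <= M.
  apply: le_trans (ler_norm_sum _ _ _) _.
  rewrite -[leRHS]mul1r -w1 mulr_suml; apply: ler_sum => x _.
  by rewrite normrM ger0_norm// ler_wpM2l.
rewrite (_ : \sum_(t < N) _ - _ = u N - u 0%N).
  by apply: le_trans (ler_normB _ _) _; exact: lerD.
rewrite -sumrB -(telescope_sumr u (leq0n N)) big_mkord.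
by apply: eq_bigr => t _; congr (_ - _).
Qed.

End empirical.

(** The condition [j < N j] makes the defect of invariance vanish in the limit. The second
    conclusion passes to the limit lower bounds known up to an error of order [1 / j]. *)
Lemma ultralimit_state {R : realType} {X : eqType} (T : X -> X)
    (N : nat -> nat) (s : nat -> seq X) (w : nat -> X -> R) :
  (forall j, (j < N j)%N) -> (forall j x, 0 <= w j x) ->
  (forall j, \sum_(x <- s j) w j x = 1) ->
  exists2 L, state T L & forall f, bounded_fct f -> forall c K J,
    (forall j, (J <= j)%N -> c - j.+1%:R^-1 * K <= empirical T (N j) (s j) (w j) f) ->
    c <= L f.
Proof.
move=> Nj w0 w1; pose E j := empirical T (N j) (s j) (w j).
have N0 j : (0 < N j)%N by apply: leq_ltn_trans (Nj j).
(* An ultrafilter makes the averages of every bounded function converge simultaneously, which no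
   choice of subsequence guarantees. *)
have [U [UU subU]] := ultraFilterLemma (eventually_filter : ProperFilter \oo).
pose L f := lim ((fun j => E j f) @ U).
have cvgE f : bounded_fct f -> (fun j => E j f) @ U --> L f.
  move=> [M fM]; apply: ultra_cvg.
  by exists M => j; apply: empirical_le.
have inv_cvg K : (fun j : nat => j.+1%:R^-1 * K : R) @ U --> (0 : R).
  have : (fun j : nat => j.+1%:R^-1 * K : R) @ \oo --> (0 : R).
    by rewrite -[X in _ --> X](mul0r K); apply: cvgMr_tmp; exact: cvg_harmonic.
  by move=> h A /h; exact: subU.
exists L.
  split.
  - move=> f g bf bg; apply/cvg_lim => //.
    rewrite (_ : (fun j => _) = (fun j => E j f + E j g)).
      by apply: cvgD; exact: cvgE.
    by apply/funext => j; exact: empiricalD.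
  - move=> c f bf; apply/cvg_lim => //.
    rewrite (_ : (fun j => _) = (fun j => c * E j f)).
      by apply: cvgMl_tmp; exact: cvgE.
    by apply/funext => j; exact: empiricalZ.
  - move=> f g bf bg fg; apply: (ler_cvg_to (cvgE _ bf) (cvgE _ bg)).
    by apply: filterS filterT => j _; apply: empirical_mono => //; exact: w0.
  - apply/cvg_lim => //; rewrite (_ : (fun j => _) = (fun=> 1)); first exact: cvg_cst.
    by apply/funext => j; apply: empirical_cst; [exact: w1 | exact: N0].
  - move=> f bf; have [M0 fM0] := bf; pose M := `|M0|.
    have fM x : `|f x| <= M by apply: le_trans (fM0 x) (ler_norm _).
    have bfT : bounded_fct (f \o T) by exists M => x /=.
    have : (fun j => E j (f \o T) - E j f) @ U --> L (f \o T) - L f.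
      by apply: cvgB; exact: cvgE.
    have : (fun j => E j (f \o T) - E j f) @ U --> (0 : R).
      apply/norm_cvg0P; apply: (@squeeze_cvgr _ _ _ _ (fun=> 0) (fun j => j.+1%:R^-1 * (M + M))).
      - apply: filterS filterT => j _; rewrite normr_ge0/=.
        apply: le_trans (empirical_shift T (w0 j) (w1 j) (N0 j) fM) _.
        by apply: ler_wpM2r; [rewrite addr_ge0// normr_ge0 | rewrite lef_pV2 ?posrE ?ltr0n// ler_nat].
      - exact: cvg_cst.
      - exact: inv_cvg.
    move=> h1 h2; apply/eqP; rewrite -subr_eq0; apply/eqP.
    exact: (cvg_unique _ h2 h1).
move=> f bf c K J h.
have h1 : (fun j => c - j.+1%:R^-1 * K) @ U --> c.
  by rewrite -[X in _ --> X]subr0; apply: cvgB; [exact: cvg_cst | exact: inv_cvg].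
apply: (ler_cvg_to h1 (cvgE _ bf)); apply: subU; exists J => // j /=; exact: h.
Qed.

(** * Fine partitions with null frontiers *)

Section spheres.
Context {R : realType} {X : pmetricType R} (mu : probability (borel X) R).

Lemma mdist_continuous (c : X) : continuous (mdist c : X -> R).
Proof.
move=> x; apply/cvgrPdist_lt => e e0; apply/nbhs_ballP; exists e => //= y.
rewrite ballEmdist /= => xy; apply: le_lt_trans xy.
rewrite ler_norml; apply/andP; split.
  by rewrite lerBrDr addrC -lerBrDr opprK; exact: metric_triangle.
rewrite lerBlDr (metric_sym x y) addrC; exact: metric_triangle.
Qed.

(** The law of the distance to [c] has countably many atoms, whereas an open interval has positive
    Lebesgue measure. *)
Lemma null_sphere (c : X) (a b : R) : a < b ->
  exists2 r, a < r < b & mu [set x | mdist c x = r] = 0%E.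
Proof.
move=> ab; have md := continuous_borel_real (@mdist_continuous c).
pose D : {RV mu >-> R} := HB.pack (mdist c : borel X -> R) (isMeasurableFun.Build _ _ _ _ _ md).
have cD := pmf_gt0_countable D.
apply: contrapT => nex.
have sub : [set` `]a, b[] `<=` [set r | 0 < pmf D r].
  move=> r /=; rewrite in_itv/= => rab; rewrite lt_neqAle; apply/andP; split; last first.
    exact: fine_ge0.
  apply/negP => /eqP h; apply: nex; exists r => //.
  have mS : measurable ([set x | mdist c x = r] : set (borel X)).
    by have := md measurableT _ (measurable_set1 r); rewrite setTI.
  by rewrite -[LHS](fineK (fin_num_measure mu _ mS)); congr EFin; rewrite [RHS]h.
have : lebesgue_measure (`]a, b[%classic : set R) = 0%E.
  by apply: countable_lebesgue_measure0; exact: sub_countable (subset_card_le sub) cD.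
by rewrite lebesgue_measure_itv/= lte_fin ab -EFinB => /eqP; rewrite eqe subr_eq0 gt_eqF.
Qed.

(* Sets with a mu-null frontier. *)
Definition continuity_set (A : set (borel X)) := measurable A /\
  exists V C : set X, [/\ open V, closed C, V `<=` A, A `<=` C & mu (C `\` V) = 0%E].

Lemma continuity_setC A : continuity_set A -> continuity_set (~` A).
Proof.
move=> [mA [V [C [oV cC VA AC h]]]]; split; first exact: measurableC.
exists (~` C), (~` V); split.
- exact: closed_openC.
- exact: open_closedC.
- exact: subsetC.
- exact: subsetC.
- by rewrite setDE setCK setIC -setDE.
Qed.

Let measure_sub0 (A B : set (borel X)) : measurable A -> measurable B ->
  A `<=` B -> mu B = 0%E -> mu A = 0%E.
Proof.
move=> mA mB AB B0; apply/eqP; rewrite eq_le measure_ge0 andbT -B0.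
by apply: le_measure; rewrite ?inE.
Qed.

Lemma continuity_setI A B : continuity_set A -> continuity_set B ->
  continuity_set (A `&` B).
Proof.
move=> [mA [V [C [oV cC VA AC h]]]] [mB [V' [C' [oV' cC' VA' AC' h']]]].
split; first exact: measurableI.
have mD (C1 V1 : set X) : closed C1 -> open V1 -> measurable (C1 `\` V1 : set (borel X)).
  by move=> cC1 oV1; apply: measurableD; [exact: closed_borel | exact: open_borel].
exists (V `&` V'), (C `&` C'); split.
- exact: openI.
- exact: closedI.
- exact: setISS.
- exact: setISS.
- apply: (@measure_sub0 _ ((C `\` V) `|` (C' `\` V'))).
  + by apply: mD; [exact: closedI | exact: openI].
  + by apply: measurableU; exact: mD.
  + move=> x [[Cx C'x] nV]; have [Vx|nVx] := pselect (V x); [right|left]; split => //.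
    by move=> V'x; apply: nV.
  + apply/eqP; rewrite eq_le measure_ge0 andbT.
    apply: (le_trans (measureU2 _ (mD _ _ cC oV) (mD _ _ cC' oV'))).
    apply: (@le_trans _ _ (mu (C `\` V) + mu (C' `\` V'))%E); first exact: lexx.
    by rewrite h h' adde0.
Qed.

Lemma continuity_setT : continuity_set setT.
Proof.
split; first exact: measurableT.
by exists setT, setT; split; [exact: openT|exact: closedT|by []|by []|rewrite setDv measure0].
Qed.

Lemma continuity_set_bigcap (I : finType) (F : I -> set (borel X)) :
  (forall i, continuity_set (F i)) -> continuity_set (\bigcap_i F i).
Proof.
move=> h; rewrite (_ : \bigcap_i F i = \big[setI/setT]_i F i).
  by elim/big_ind : _ => //; [exact: continuity_setT | exact: continuity_setI].
rewrite -bigcap_seq (_ : [set` index_enum I] = setT)//.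
by apply/seteqP; split => i //= _; exact: mem_index_enum.
Qed.

(** The sandwich between [V] and [C] pulls back through [T] and invariance preserves the measure of
    the gap. Interiors and closures need not commute with preimages, hence the definition by a
    sandwich. *)
Lemma continuity_set_preimage (T : X -> X) A : continuous T ->
  invariant_measures T mu -> continuity_set A -> continuity_set (T @^-1` A).
Proof.
move=> cT muT [mA [V [C [oV cC VA AC h]]]]; split.
  by rewrite -[X in measurable X]setTI; exact: (continuous_borel cT).
exists (T @^-1` V), (T @^-1` C); split.
- by move/continuousP: cT; exact.
- by move/continuous_closedP: cT; exact.
- exact: preimage_subset.
- exact: preimage_subset.
- rewrite (_ : _ `\` _ = T @^-1` (C `\` V))// -h; apply: muT.
  by apply: measurableD; [exact: closed_borel | exact: open_borel].
Qed.

Definition continuity_label (I : Type) (a : borel X -> I) :=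
  forall i, continuity_set (a @^-1` [set i]).

Lemma continuity_mlabel (I : Type) (a : borel X -> I) : continuity_label a -> mlabel a.
Proof. by move=> h i; exact: (h i).1. Qed.

(** Points are labelled by the first ball of a finite list that contains them. Radii above [e / 4]
    make the balls around an [e / 4]-net cover; radii below [e / 2] make the cells small; null
    spheres make the frontiers null. *)
Lemma fine_partition (e : R) : compact [set: X] -> 0 < e -> exists k (a : borel X -> 'I_k),
  continuity_label a /\ forall x y, a x = a y -> mdist (x : X) y < e.
Proof.
move=> cX e0; have e4 : 0 < e / 4 by rewrite divr_gt0.
have [s hs] := finite_net cX e4.
have /boolp.choice[r hr] : forall c, exists r, e / 4 < r < e / 2 /\
    mu [set x | mdist c x = r] = 0%E.
  move=> c; have [|r h1 h2] := @null_sphere c (e / 4) (e / 2); last by exists r.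
  by lra.
pose P x c := mdist c x < r c.
have hP x : has (P x) s.
  have [c cs cx] := hs x; apply/hasP; exists c => //; rewrite /P.
  by apply: lt_trans cx _; have [/andP[]] := hr c.
pose a (x : borel X) : 'I_(size s) := Ordinal (etrans (esym (has_find (P x) s)) (hP x)).
exists (size s), a; split; last first.
  move=> x y axy; have [Px Py] : P x (nth point s (a x)) /\ P y (nth point s (a x)).
    split; first exact: nth_find.
    by rewrite axy; exact: nth_find.
  set c := nth point s (a x) in Px Py; have [/andP[_ rc] _] := hr c.
  apply: le_lt_trans (metric_triangle x c y) _; rewrite [ltRHS]splitr metric_sym.
  by apply: ltrD; [apply: lt_trans Px _ | apply: lt_trans Py _].
have cball c : continuity_set [set x | P x c].
  have oB : open [set x | P x c].
    apply: open_mdist => x /= cx; exists (r c - mdist c x); first by rewrite subr_gt0.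
    move=> y xy; rewrite /P; apply: le_lt_trans (metric_triangle c x y) _.
    by rewrite -ltrBrDl.
  split; first exact: open_borel.
  have cB : closed [set x | mdist c x <= r c].
    move/continuous_closedP : (@mdist_continuous c) => h.
    by apply: (h [set y | y <= r c]); exact: closed_le.
  exists [set x | P x c], [set x | mdist c x <= r c]; split; [by []|by []|by []| |].
  - by move=> x; rewrite /P /=; exact: ltW.
  - rewrite (_ : _ `\` _ = [set x | mdist c x = r c]); first by have [] := hr c.
    rewrite /P; apply/seteqP; split => x /=; last by move=> ->; rewrite lexx ltxx.
    by move=> -[h1 /negP]; rewrite -leNgt => h2; apply/eqP; rewrite eq_le h1.
move=> i.
(* The fibre is the ball of index [i] minus the earlier balls; later indices remove the empty
   set. *)
rewrite (_ : a @^-1` [set i] = [set x | P x (nth point s i)] `&`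
    \bigcap_(j in [set: 'I_(size s)]) ~` (if (j < i)%N then [set x | P x (nth point s j)] else set0)).
  apply: continuity_setI; first exact: cball.
  apply: continuity_set_bigcap => j; apply: continuity_setC; case: ifP => _; first exact: cball.
  by rewrite -setCT; apply: continuity_setC; exact: continuity_setT.
apply/seteqP; split => x /=.
  move=> <-; split; first exact: nth_find.
  by move=> j _; case: ifP => [ji|_ []] /=; rewrite (before_find point ji).
move=> [Pi nj]; apply/val_inj => /=.
have fi : (find (P x) s <= i)%N.
  by rewrite leqNgt; apply/negP => /(before_find point); rewrite Pi.
apply/eqP; rewrite eqn_leq fi/= leqNgt; apply/negP => fi'.
have := nj (Ordinal (ltn_trans fi' (ltn_ord i))) I; rewrite /= fi'; apply.
exact: nth_find.
Unshelve. all: by []. Qed.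

Section name_continuity.
Variables (T : X -> X) (cT : continuous T) (muT : invariant_measures T mu).

Lemma continuity_label_iter (I : Type) (a : borel X -> I) j :
  continuity_label a -> continuity_label (a \o iter j T).
Proof.
move=> ca; elim: j => [//|j ih] i.
rewrite (comp_iterSr T) comp_preimage.
exact: continuity_set_preimage.
Qed.

Lemma continuity_label_name k (a : borel X -> 'I_k) m :
  continuity_label a -> continuity_label (name (T : borel X -> borel X) a m).
Proof.
move=> ca w; rewrite (_ : _ @^-1` _ = \bigcap_(j in [set: 'I_m]) ((a \o iter j T) @^-1` [set w j])).
  by apply: continuity_set_bigcap => j; exact: continuity_label_iter.
rewrite preimage_name; apply/seteqP; split => x /= h; first by move=> j _; exact: h.
by move=> j; exact: h.
Qed.

End name_continuity.

End spheres.

(** * Misiurewicz's inequality *)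

Section state_sums.
Context {R : realType} {X : Type} (T : X -> X) (L : (X -> R) -> R) (sL : state T L).

Lemma state_cst c : L (fun=> c) = c.
Proof.
have -> : (fun _ : X => c) = (fun x => c * 1) by apply/funext => x; rewrite mulr1.
by rewrite (stateZ sL c (bounded_fct_cst 1)) (state1 sL) mulr1.
Qed.

Lemma state_label (I : finType) (b : X -> I) (phi : I -> R) :
  L (phi \o b) = \sum_i L \1_(b @^-1` [set i]) * phi i.
Proof.
have bs (r : seq I) : bounded_fct (fun x => \sum_(i <- r) phi i * \1_(b @^-1` [set i]) x : R).
  elim: r => [|i r ih]; first by under eq_fun do rewrite big_nil; exact: bounded_fct_cst.
  under eq_fun do rewrite big_cons.
  apply: bounded_fctD ih; apply: bounded_fctZ; exact: bounded_fct_indic.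
suff h (r : seq I) : L (fun x => \sum_(i <- r) phi i * \1_(b @^-1` [set i]) x) =
    \sum_(i <- r) L \1_(b @^-1` [set i]) * phi i.
  rewrite -h; congr L; apply/funext => x /=.
  rewrite (bigD1 (b x))//= indicE mem_set//= mulr1 big1 ?addr0// => i ib.
  by rewrite indicE memNset ?mulr0//= => bx; rewrite bx eqxx in ib.
elim: r => [|i r ih].
  by under eq_fun do rewrite big_nil; rewrite big_nil (state_cst 0).
under eq_fun do rewrite big_cons.
rewrite (stateD sL) ?ih ?big_cons//.
  by rewrite (stateZ sL) 1?mulrC//; exact: bounded_fct_indic.
by apply: bounded_fctZ; exact: bounded_fct_indic.
Qed.

End state_sums.

Section invariant_limit.
Context {R : realType} {X : pmetricType R} (cX : compact [set: X]).
Variables (T : X -> X) (cT : continuous T).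
Variables (L : (X -> R) -> R) (sL : state T L).

(** For a continuity set squeezed between [V] and [C], one has [mu V <= l V <= l A <= l C <= mu C],
    and the two ends coincide. *)
Lemma state_measure : exists2 mu : probability (borel X) R, invariant_measures T mu &
  forall A, continuity_set mu A -> L \1_A = fine (mu A).
Proof.
pose l (A : set X) := L \1_A.
have bi (A : set X) : bounded_fct (\1_A : X -> R) by exact: bounded_fct_indic.
have l0 : l set0 = 0 by rewrite /l indic0; exact: (state_cst sL 0).
have lT : l setT = 1 by rewrite /l indicT; exact: state1 sL.
have lm A B : A `<=` B -> l A <= l B.
  move=> AB; apply: (state_mono sL) => // x; rewrite !indicE ler_nat.
  by case: (boolP (x \in A)) => // /set_mem/AB/mem_set ->.
have lU A B : A `&` B = set0 -> l (A `|` B) = l A + l B.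
  move=> AB; rewrite /l -(stateD sL)//; congr L; apply/funext => x.
  rewrite !indicE in_setU; case: (boolP (x \in A)) => xA; case: (boolP (x \in B)) => xB //=;
    rewrite ?addr0 ?add0r//.
  have : (A `&` B) x by split; exact: set_mem.
  by rewrite AB.
have lTT A : l (T @^-1` A) = l A.
  rewrite /l -[RHS](stateT sL)//; congr L.
have [mu [muT hO hC]] := content_measure cX l0 lT lm lU cT lTT.
exists mu => // A [mA [V [C [oV cC VA AC h0]]]].
have mV := open_borel oV; have mC := closed_borel cC.
have CV : fine (mu C) = fine (mu V).
  have := measureU mu (measurableD mC mV) mV.
  rewrite setDE -setIA setICl setI0 => /(_ erefl).
  rewrite -setDE setUC setDUK; last exact: subset_trans VA AC.
  by move=> ->; rewrite [X in (X + _)%E](_ : _ = 0%E)// add0e.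
have VAm : fine (mu V) <= fine (mu A).
  by rewrite fine_le ?fin_num_measure// le_measure ?inE.
have ACm : fine (mu A) <= fine (mu C).
  by rewrite fine_le ?fin_num_measure// le_measure ?inE.
have lV : l V <= l A by exact: lm.
have lC : l A <= l C by exact: lm.
have := hO _ oV; have := hC _ cC; rewrite -/(l A) => h1 h2.
by apply/eqP; rewrite eq_le; apply/andP; split; lra.
Qed.

Lemma state_measure_label (mu : probability (borel X) R) (I : finType) (b : borel X -> I)
    (phi : I -> R) :
  (forall A, continuity_set mu A -> L \1_A = fine (mu A)) -> continuity_label mu b ->
  L (phi \o b) = avg mu (phi \o b).
Proof.
move=> hL cb; rewrite (state_label sL) avg_label; last exact: continuity_mlabel.
by apply: eq_bigr => i _; rewrite hL.
Qed.

(** Up to [e / 2], [psi] is a function of a fine continuity label, and on such functions [L] and the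
    integral agree. *)
Lemma state_measure_le (mu : probability (borel X) R) (psi : X -> R) :
  (forall A, continuity_set mu A -> L \1_A = fine (mu A)) -> continuous psi ->
  L psi <= avg mu psi.
Proof.
move=> hL cpsi; apply/ler_addgt0Pr => e e0; have e2 : 0 < e / 2 by rewrite divr_gt0.
have bpsi := continuous_bmeas cX cpsi.
have [d d0 hd] := continuous_unif cX cpsi e2.
have [k [a [ca hka]]] := fine_partition mu cX d0.
(* The value of [psi] at a chosen point of each cell; the default concerns empty cells only. *)
pose phi i := psi (xget point (a @^-1` [set i])).
have phiE x : `|phi (a x) - psi x| < e / 2.
  apply: hd; apply: hka; rewrite /phi; case: xgetP => [y _ ->//|/(_ x)].
  by case.
have bp : bmeas (phi \o a) by apply: bmeas_label; exact: continuity_mlabel ca.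
have bc : bmeas (fun _ : borel X => e / 2) by exact: bmeas_cst.
have hphi := state_measure_label phi hL ca.
apply: (@le_trans _ _ (L (phi \o a) + e / 2)).
  rewrite -[e / 2](state_cst sL) -(stateD sL); last 2 first.
  - exact: bounded_fct_label.
  - exact: bounded_fct_cst.
  apply: (state_mono sL) => [||x]; first exact: bpsi.2.
    by apply: bounded_fctD; [exact: bounded_fct_label | exact: bounded_fct_cst].
  by have := phiE x; rewrite ltr_norml /= => /andP[]; lra.
rewrite hphi [in leRHS](splitr e) addrA lerD2r -[e / 2](avg_cst mu) -avgD//.
apply: le_avg => // [|x]; first exact: bmeasD.
by have := phiE x; rewrite ltr_norml /= => /andP[]; lra.
Qed.

End invariant_limit.

(** * Words weighted by a backward Markov kernel *)

Section words.
Context {R : realType} (k : nat).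

Definition word_cons m (i : 'I_k) (v : {ffun 'I_m -> 'I_k}) : {ffun 'I_m.+1 -> 'I_k} :=
  [ffun j => if unlift ord0 j is Some j' then v j' else i].

Lemma word_cons0 m i (v : {ffun 'I_m -> 'I_k}) : word_cons i v ord0 = i.
Proof. by rewrite ffunE unlift_none. Qed.

Lemma word_consS m i (v : {ffun 'I_m -> 'I_k}) j : word_cons i v (lift ord0 j) = v j.
Proof. by rewrite ffunE liftK. Qed.

Lemma sum_word_cons m (f : {ffun 'I_m.+1 -> 'I_k} -> R) :
  \sum_w f w = \sum_i \sum_v f (word_cons i v).
Proof.
rewrite pair_bigA/= (reindex (fun p => word_cons p.1 p.2))//=.
exists (fun w => (w ord0, [ffun j => w (lift ord0 j)])) => [[i v]|w] _ /=.
  by rewrite word_cons0; congr pair; apply/ffunP => j; rewrite ffunE word_consS.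
apply/ffunP => j; case: (unliftP ord0 j) => [j' ->|->]; last by rewrite word_cons0.
by rewrite word_consS ffunE.
Qed.

Lemma word_inj m : injective (fun p : 'I_k * {ffun 'I_m -> 'I_k} => word_cons p.1 p.2).
Proof.
move=> [i v] [j w] /= /ffunP h; congr pair; first by have := h ord0; rewrite !word_cons0.
by apply/ffunP => t; have := h (lift ord0 t); rewrite !word_consS.
Qed.

Lemma name_cons (X : Type) (T : X -> X) (a : X -> 'I_k) m x :
  name T a m.+1 x = word_cons (a x) (name T a m (T x)).
Proof.
apply/ffunP => j; case: (unliftP ord0 j) => [j' ->|->].
  by rewrite word_consS !ffunE lift0 iterSr.
by rewrite word_cons0 ffunE.
Qed.

Definition word_prefix p m (v : {ffun 'I_(m + p) -> 'I_k}) : {ffun 'I_p -> 'I_k} :=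
  [ffun j : 'I_p => v (widen_ord (leq_addl m p) j)].

(* Weight of a word under a Markov-type kernel giving each letter in terms of
   the p letters that follow it. *)
Fixpoint word_weight p (kappa : 'I_k -> {ffun 'I_p -> 'I_k} -> R) m :
    {ffun 'I_(m + p) -> 'I_k} -> R :=
  if m is m'.+1 then fun w =>
    let v : {ffun 'I_(m' + p) -> 'I_k} := [ffun j => w (lift ord0 j)] in
    kappa (w ord0) (word_prefix v) * word_weight kappa v
  else fun=> 1.

Lemma word_weight_gt0 p (kappa : 'I_k -> {ffun 'I_p -> 'I_k} -> R) m w :
  (forall i u, 0 < kappa i u) -> 0 < @word_weight p kappa m w.
Proof.
by move=> k0; elim: m w => [|m ih] w //=; rewrite mulr_gt0.
Qed.

(** The first [m] letters are summed out one at a time by the kernel; the last [p] letters carry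
    weight 1, and there are [k ^ p] choices for them. *)
Lemma word_weight_sum p (kappa : 'I_k -> {ffun 'I_p -> 'I_k} -> R) m :
  (forall i u, 0 < kappa i u) -> (forall u, \sum_i kappa i u <= 1) ->
  \sum_w @word_weight p kappa m w <= k%:R ^+ p.
Proof.
move=> k0 k1; elim: m => [|m ih] /=.
  by rewrite sumr_const card_ffun !card_ord natrX.
apply: le_trans ih; rewrite sum_word_cons exchange_big/=; apply: ler_sum => v _.
have -> : \sum_(i < k) kappa (word_cons i v ord0)
      (word_prefix (m := m) [ffun j => word_cons i v (lift ord0 j)]) *
      word_weight kappa (m := m) [ffun j => word_cons i v (lift ord0 j)] =
    \sum_(i < k) kappa i (word_prefix v) * word_weight kappa v.
  apply: eq_bigr => i _; rewrite word_cons0.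
  have -> : [ffun j => word_cons i v (lift ord0 j)] = v.
    by apply/ffunP => j; rewrite ffunE word_consS.
  by [].
rewrite -mulr_suml -[leRHS]mul1r ler_wpM2r//.
by apply: ltW; apply: word_weight_gt0.
Qed.

Lemma word_weight_name (X : Type) (T : X -> X) (a : X -> 'I_k) p
    (kappa : 'I_k -> {ffun 'I_p -> 'I_k} -> R) m x :
  word_weight kappa (name T a (m + p) x) =
  \prod_(t < m) kappa (a (iter t T x)) (name T a p (T (iter t T x))).
Proof.
elim: m x => [|m ih] x; first by rewrite big_ord0.
rewrite big_ord_recl /=.
have -> : [ffun j => name T a (m.+1 + p) x (lift ord0 j)] = name T a (m + p) (T x).
  by apply/ffunP => j; rewrite ffunE (name_cons T a (m + p) x) word_consS.
congr (_ * _).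
  rewrite (name_cons T a (m + p) x) word_cons0; congr kappa.
  by apply/ffunP => j; rewrite !ffunE.
by rewrite ih; apply: eq_bigr => t _; rewrite -!iterSr.
Qed.

End words.

Section name_counting.
Context {R : realType} {X : pmetricType R} (T : X -> X) (psi : X -> R).
Variables (k p : nat) (a : X -> 'I_k) (kappa : 'I_k -> {ffun 'I_p -> 'I_k} -> R).
Hypotheses (k0 : forall i u, 0 < kappa i u) (k1 : forall u, \sum_i kappa i u <= 1).

(** The information carried by the letter of [x] once the next [p] letters are known, measured with
    [kappa]. *)
Let g x := - ln (kappa (a x) (name T a p (T x))).

Let kappa_le1 i u : kappa i u <= 1.
Proof.
apply: le_trans (k1 u); rewrite (bigD1 i)//= lerDl sumr_ge0// => j _; exact: ltW.
Qed.

(* Gibbs' inequality against word_weight replaces Misiurewicz's concavity and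
   subadditivity estimate for the entropy of averaged measures. *)
Lemma log_sum_le_empirical (M : nat) (s : seq X) : s != [::] -> uniq s ->
  {in s &, injective (name T a (M + p))} ->
  ln (\sum_(x <- s) expR (birkhoff_sum T psi (M + p) x)) <= p%:R * ln k%:R +
    (M + p)%:R * empirical T (M + p) s (fun x => expR (birkhoff_sum T psi (M + p) x) /
      \sum_(y <- s) expR (birkhoff_sum T psi (M + p) y)) (fun x => g x + psi x).
Proof.
move=> s0 us sinj; set S := birkhoff_sum T psi (M + p).
set Z := \sum_(x <- s) expR (S x); set w := fun x => expR (S x) / Z.
have Z0 : 0 < Z.
  rewrite /Z; case: (s) s0 => // x s' _; rewrite big_cons ltr_pwDl ?expR_gt0//.
  by apply: sumr_ge0 => *; exact: expR_ge0.
have w0 x : 0 < w x by rewrite divr_gt0// expR_gt0.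
have w1 : \sum_(x <- s) w x = 1 by rewrite -mulr_suml divff// gt_eqF.
have sw c : c = \sum_(x <- s) w x * c by rewrite -mulr_suml w1 mul1r.
have kR : 0 < k%:R :> R.
  by case: (s) s0 => // x s' _; rewrite ltr0n; case: (a x) => i; apply: leq_ltn_trans.
have kp : 0 < k%:R ^+ p :> R by rewrite exprn_gt0.
pose W x := \prod_(t < M) kappa (a (iter t T x)) (name T a p (T (iter t T x))).
have W0 x : 0 < W x by apply: prodr_gt0.
(* Distinct points of [s] have distinct names, so the left side is part of the sum over all words,
   which [k ^ p] normalises. *)
have q1 : \sum_(x <- s) W x / k%:R ^+ p <= \sum_(x <- s) w x.
  rewrite w1 -mulr_suml ler_pdivrMr// mul1r.
  apply: le_trans (word_weight_sum M k0 k1).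
  under eq_bigr do rewrite /W -word_weight_name.
  rewrite -(big_map (name T a (M + p)) xpredT (fun v => word_weight kappa v)).
  rewrite big_uniq/=; last by rewrite map_inj_in_uniq.
  rewrite [leRHS](bigID (mem (map (name T a (M + p)) s)))/= lerDl.
  by apply: sumr_ge0 => v _; apply: ltW; exact: word_weight_gt0.
have := gibbs (fun x => ltW (w0 x)) (fun x => ltW (divr_gt0 (W0 x) kp)) _ q1.
move=> /(_ (fun x _ => divr_gt0 (W0 x) kp)).
have -> : \sum_(x <- s) w x * ln (w x) = \sum_(x <- s) w x * S x - ln Z.
  rewrite [ln Z]sw -sumrB; apply: eq_bigr => x _.
  by rewrite -mulrBr; congr (_ * _); rewrite /w ln_div ?posrE ?expR_gt0// expRK.
have -> : \sum_(x <- s) w x * ln (W x / k%:R ^+ p) =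
    \sum_(x <- s) w x * ln (W x) - p%:R * ln k%:R.
  rewrite [p%:R * _]sw -sumrB; apply: eq_bigr => x _.
  by rewrite -mulrBr; congr (_ * _); rewrite ln_div ?posrE// lnXn// mulr_natl.
have -> : (M + p)%:R * empirical T (M + p) s w (fun x => g x + psi x) =
    \sum_(x <- s) w x * (\sum_(t < M + p) g (iter t T x)) + \sum_(x <- s) w x * S x.
  rewrite /empirical; have [Mp|Mp] := eqVneq (M + p)%N 0%N.
    rewrite !Mp mul0r; apply/esym; rewrite -big_split big1// => x _ /=.
    by rewrite /S /birkhoff_sum Mp !big_ord0 !mulr0 addr0.
  rewrite mulVKf ?pnatr_eq0// exchange_big/= -big_split/=; apply: eq_bigr => x _.
  rewrite -mulrDr -big_split/= mulr_sumr.
  by apply: eq_bigr => t _; rewrite mulrDr.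
(* [W] involves the first [M] times and the average all [M + p]; the [p] extra terms are nonnegative
   because [kappa <= 1]. *)
have : \sum_(x <- s) w x * - ln (W x) <= \sum_(x <- s) w x * (\sum_(t < M + p) g (iter t T x)).
  apply: ler_sum => x _; apply: ler_wpM2l; first exact: ltW.
  have -> : - ln (W x) = \sum_(t < M) g (iter t T x).
    rewrite /W -[RHS]opprK; congr (- _); rewrite -sumrN -[RHS](expRK (_ : R)) expR_sum.
    by congr ln; apply: eq_bigr => t _; rewrite /g opprK lnK// posrE.
  rewrite big_split_ord/= lerDl sumr_ge0// => t _.
  by rewrite oppr_ge0 ln_le0.
have -> : \sum_(x <- s) w x * - ln (W x) = - \sum_(x <- s) w x * ln (W x).
  by rewrite -sumrN; apply: eq_bigr => x _; rewrite mulrN.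
lra.
Qed.

End name_counting.

(** * Conditional entropy of a letter given the following ones *)

Section conditional_entropy.
Context {R : realType} {d} {Y : measurableType d} (mu : probability Y R).
Variable T : Y -> Y.
Hypothesis mT : measurable_fun setT T.
Hypothesis muT : forall A, measurable A -> mu (T @^-1` A) = mu A.
Variables (k : nat) (a : Y -> 'I_k) (ma : mlabel a) (p : nat).
Variables (eta : R) (eta01 : 0 < eta < 1).

Definition step_label (x : Y) := (a x, name T a p (T x)).

(* The conditional law of a letter given the p following ones, mixed with the
   uniform law to keep the weights positive; on null words u the quotient is 0. *)
Definition step_kernel (i : 'I_k) (u : {ffun 'I_p -> 'I_k}) : R :=
  (1 - eta) * (law mu step_label (i, u) / law mu (name T a p) u) + eta / k%:R.

Let mn : mlabel (name T a p).
Proof. exact: mlabel_name. Qed.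

Lemma mlabel_step : mlabel step_label.
Proof. by apply: mlabel_pair => //; exact: (@mlabel_iter _ _ _ mT _ _ 1 mn). Qed.

Let k_gt0 : (0 < k)%N.
Proof. by case: (a point) => i; apply: leq_ltn_trans. Qed.

Let law_snd : law mu (snd \o step_label) = law mu (name T a p).
Proof. exact: (@law_iter _ _ _ mu _ mT muT _ _ 1 mn). Qed.

Lemma step_kernel_gt0 i u : 0 < step_kernel i u.
Proof.
case/andP: eta01 => e0 e1; apply: ltr_wpDl; last by rewrite divr_gt0// ltr0n.
by rewrite mulr_ge0 ?subr_ge0 ?(ltW e1)// divr_ge0// law_ge0.
Qed.

Lemma step_kernel_sum u : \sum_i step_kernel i u <= 1.
Proof.
case/andP: eta01 => e0 e1; rewrite /step_kernel big_split/= sumr_const card_ord.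
rewrite -[_ *+ k]mulr_natr divfK ?pnatr_eq0 -?lt0n// -mulr_sumr -mulr_suml.
have -> : \sum_i law mu step_label (i, u) = law mu (name T a p) u.
  (* Testing against the indicator of [u] extracts the marginal of the pair law. *)
  have := law_comp_sum mu snd (fun v => (v == u)%:R) mlabel_step; rewrite law_snd.
  rewrite (bigD1 u)//= eqxx mulr1 [X in _ = _ + X]big1 ?addr0.
    move=> <-; rewrite (eq_bigr (fun q => law mu step_label (q.1, q.2) * (q.2 == u)%:R)); last by case.
    rewrite -(pair_bigA _ (fun i v => law mu step_label (i, v) * (v == u)%:R))/=.
    apply: eq_bigr => i _; rewrite (bigD1 u)//= eqxx mulr1 big1 ?addr0// => v /negbTE ->.
    by rewrite mulr0.
  by move=> v /negbTE ->; rewrite mulr0.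
have [->|l0] := eqVneq (law mu (name T a p) u) 0; first by rewrite mul0r mulr0; lra.
by rewrite divff//; lra.
Qed.

Lemma label_entropy_step : label_entropy mu step_label = label_entropy mu (name T a p.+1).
Proof.
rewrite -(label_entropy_inj mu mlabel_step (@word_inj k p)); congr label_entropy.
by apply/funext => x; rewrite name_cons.
Qed.

(** The kernel is at least [1 - eta] times the conditional law, and the average of minus the
    logarithm of the conditional law is the increment of the entropy of names. *)
Lemma avg_step_kernel :
  avg mu ((fun iu => - ln (step_kernel iu.1 iu.2)) \o step_label) <=
  label_entropy mu (name T a p.+1) - label_entropy mu (name T a p) - ln (1 - eta).
Proof.
case/andP: eta01 => e0 e1; rewrite avg_label; last exact: mlabel_step.
have hp (iu : 'I_k * {ffun 'I_p -> 'I_k}) :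
    law mu step_label iu <= law mu (name T a p) iu.2.
  by rewrite -law_snd; apply: (law_comp_le mu snd); exact: mlabel_step.
pose P := law mu step_label.
apply: (@le_trans _ _ (\sum_iu (P iu * - ln (1 - eta) - P iu * ln (P iu) +
    P iu * ln (law mu (name T a p) iu.2)))).
  apply: ler_sum => -[i u] _; rewrite -mulrBr -mulrDr.
  have [P0|P0] := eqVneq (P (i, u)) 0; first by rewrite -/P P0 !mul0r.
  have {}P0 : 0 < P (i, u) by rewrite lt_neqAle eq_sym P0 law_ge0.
  have L0 : 0 < law mu (name T a p) u by apply: lt_le_trans P0 (hp (i, u)).
  apply: ler_wpM2l; first exact: ltW.
  have : ln ((1 - eta) * (P (i, u) / law mu (name T a p) u)) <= ln (step_kernel i u).
    rewrite ler_ln ?posrE; [|by rewrite mulr_gt0 ?divr_gt0 ?subr_gt0|exact: step_kernel_gt0].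
    by rewrite /step_kernel lerDl divr_ge0// ltW.
  rewrite lnM ?posrE ?divr_gt0 ?subr_gt0// ln_div ?posrE//=; lra.
rewrite big_split sumrB /= -mulr_suml (law_sum1 mu mlabel_step) mul1r.
rewrite (law_comp_sum mu snd (fun v => ln (law mu (name T a p) v)) mlabel_step).
by rewrite law_snd -label_entropy_step /label_entropy; lra.
Qed.

End conditional_entropy.

Lemma ereal_between_real {R : realType} (x y : \bar R) : (x < y)%E ->
  exists2 c : R, (x < c%:E)%E & (c%:E < y)%E.
Proof.
move: x y => [x| |] [y| |]//= xy.
- by rewrite lte_fin in xy; have [h1 h2] := midf_lt xy; exists ((x + y) / 2); rewrite lte_fin.
- by exists (x + 1); rewrite ?ltry// lte_fin ltrDl.
- by exists (y - 1); rewrite ?ltNyr// lte_fin gtrBl.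
- by exists 0; rewrite ?ltry ?ltNyr.
Qed.

Section upper_bound.
Context {R : realType} {X : pmetricType R} (cX : compact [set: X]).
Variables (T : X -> X) (cT : continuous T) (psi : X -> R) (cpsi : continuous psi).

Lemma scale_pressure_gt e (c : R) : (c%:E < scale_pressure T psi e)%E ->
  forall j : nat, exists m, (j < m)%N /\ exists C, Defs.separated T m e C /\
    m%:R * c < ln (\sum_(x <- fset_set C) expR (birkhoff_sum T psi m x)) /\
    0 < \sum_(x <- fset_set C) expR (birkhoff_sum T psi m x).
Proof.
move=> /[swap] j /(@limn_esup_gt _ _ _ j.+1)[m jm hm]; exists m; split => //.
have m0 : 0 < m%:R :> R by rewrite ltr0n; apply: leq_ltn_trans jm.
have : ((expR (m%:R * c))%:E < separated_sum T psi m e)%E.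
  rewrite ltNge; apply/negP => h; move: hm; apply/negP; rewrite -leNgt.
  have := ge0_lne_le (separated_sum_ge0 _ _ _ _) h.
  rewrite lne_EFin ?expR_gt0// expRK => h'.
  apply: (@le_trans _ _ ((m%:R^-1)%:E * (m%:R * c)%:E)%E).
    by apply: lee_wpmul2l => //; rewrite lee_fin invr_ge0 ltW.
  by rewrite -EFinM mulKf// gt_eqF.
move=> /ereal_sup_gt[_ [C sC <-]].
rewrite lte_fin fsbig_finite; last exact: sC.1.
move=> hC; exists C; split => //; split; last by apply: lt_trans hC; exact: expR_gt0.
rewrite -[ltLHS]expRK ltr_ln ?posrE ?expR_gt0//.
by apply: lt_trans hC; exact: expR_gt0.
Qed.

(** Normalised exponential weights on separated sets yield, in the limit, a measure for which every
    increment of the entropy of names is at least [c - avg mu psi]. *)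
Lemma misiurewicz e (c : R) : 0 < e -> (c%:E < scale_pressure T psi e)%E ->
  exists2 mu, invariant_measures T mu & (c%:E <= ks_entropy T mu + (mean mu psi)%:E)%E.
Proof.
move=> e0 /scale_pressure_gt/boolp.choice[N hN].
have jN j : (j < N j)%N := (hN j).1.
have [C hC] := boolp.choice (fun j => (hN j).2).
pose s j : seq X := fset_set (C j).
pose S j := birkhoff_sum T psi (N j).
pose Z j := \sum_(x <- s j) expR (S j x).
have Z0 j : 0 < Z j := (hC j).2.2.
pose w j x := expR (S j x) / Z j.
have w0 j x : 0 <= w j x by rewrite divr_ge0 ?expR_ge0// ltW.
have w1 j : \sum_(x <- s j) w j x = 1 by rewrite -mulr_suml -/(Z j) divff// gt_eqF ?Z0.
have [L sL hL] := ultralimit_state T jN w0 w1.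
have [mu muT hmu] := state_measure cX cT sL.
exists mu => //.
(* The partition is chosen after [mu], so its frontiers can be null for that very measure; cells of
   diameter below [e] make names separate points. *)
have [k [a [ca hka]]] := fine_partition mu cX e0.
have ma := continuity_mlabel ca.
have mT : measurable_fun setT (T : borel X -> borel X) := continuous_borel cT.
pose nm p := name (T : borel X -> borel X) a p.
have bpsi := continuous_bmeas cX cpsi.
have step p : c - avg mu psi <= label_entropy mu (nm p.+1) - label_entropy mu (nm p).
  apply/ler_addgt0Pr => tau tau0.
  pose eta : R := 1 - expR (- tau).
  have eta01 : 0 < eta < 1.
    by rewrite /eta subr_gt0 -[ltRHS]expR0 ltr_expR oppr_lt0 tau0/= gtrBl expR_gt0.
  have lne' : - ln (1 - eta) = tau by rewrite /eta opprB addrC subrK expRK opprK.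
  pose kap := step_kernel mu (T : borel X -> borel X) a (p := p) eta.
  have kap0 i u : 0 < kap i u by exact: step_kernel_gt0.
  have kap1 u : \sum_i kap i u <= 1 by exact: step_kernel_sum.
  pose b := step_label (T : borel X -> borel X) a p.
  pose phi (iu : 'I_k * {ffun 'I_p -> 'I_k}) := - ln (kap iu.1 iu.2).
  have cb : continuity_label mu b.
    move=> [i u].
    rewrite (_ : b @^-1` [set (i, u)] = (a @^-1` [set i]) `&` ((nm p \o iter 1 T) @^-1` [set u])).
      apply: continuity_setI => //; apply: (@continuity_label_iter _ _ _ _ cT muT _ _ 1).
      exact: continuity_label_name.
    apply/seteqP; split => x /=; rewrite /b /step_label => -[h1 h2]; first by split.
    by rewrite h1 /nm in h2 *; rewrite h2.
  have k0 : 1 <= k%:R :> R by rewrite ler1n; case: (a point) => i; apply: leq_ltn_trans.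
  have bL : bounded_fct (phi \o b : X -> R) by exact: bounded_fct_label.
  have hc : c <= L (fun x => (phi \o b) x + psi x).
    (* The correction [p * ln k] is divided by [N j > j] and disappears at fixed [p]; starting at
       [j = p] leaves room for the last [p] letters. *)
    apply: (hL _ (bounded_fctD bL bpsi.2) c (p%:R * ln k%:R) p) => j pj.
    have pN : (p <= N j)%N by apply: leq_trans pj (ltnW (jN j)).
    have sj0 : s j != [::].
      by apply/eqP => sj; have := Z0 j; rewrite /Z sj big_nil ltxx.
    (* Two points with the same name stay within [e] of each other during [N j] steps, against
       separation. *)
    have inj : {in s j &, injective (name T a (N j - p + p))}.
      move=> x y xs ys; rewrite subnK// => /ffunP nxy; apply: contrapT => xy.
      have [fC sC] := (hC j).1.
      have inC z : z \in s j -> C j z by rewrite in_fset_set// inE.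
      have := sC x y (inC _ xs) (inC _ ys) xy; rewrite leNgt => /negP; apply.
      apply/bowen_lt => // t tN; apply: hka.
      by have := nxy (Ordinal tN); rewrite !ffunE.
    have := log_sum_le_empirical psi kap0 kap1 sj0 (fset_uniq _) inj.
    rewrite subnK// => h.
    have {}h := le_trans (ltW (hC j).2.1) h.
    have NR : 0 < (N j)%:R :> R by rewrite ltr0n; apply: leq_ltn_trans (jN j).
    set E := empirical _ _ _ _ _ in h *.
    have : c - (N j)%:R^-1 * (p%:R * ln k%:R) <= E.
      rewrite lerBlDl -(ler_pM2l NR) mulrDr mulVKf ?gt_eqF//.
    apply: le_trans; rewrite lerD2l lerN2 ler_wpM2r//.
      by rewrite mulr_ge0// ln_ge0.
    by rewrite lef_pV2 ?posrE ?NR ?ltr0n ?ler_nat.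
  rewrite (stateD sL) ?bpsi.2// in hc; last exact: bpsi.2.
  rewrite (state_measure_label sL phi hmu cb) in hc.
  have h1 := state_measure_le cX sL hmu cpsi.
  have h2 : avg mu (phi \o b) <= label_entropy mu (nm p.+1) - label_entropy mu (nm p) - ln (1 - eta).
    exact: avg_step_kernel.
  rewrite lne' in h2; lra.
(* The increments telescope from the empty name, whose entropy is nonnegative. *)
have HS m : m%:R * (c - avg mu psi) <= label_entropy mu (nm m).
  elim: m => [|m ih]; first by rewrite mul0r; apply: label_entropy_ge0; exact: mlabel_name.
  by have := step m; rewrite -natr1 mulrDl mul1r; lra.
have cvgH := label_entropy_name_cvg mT muT ma.
rewrite -leeBlDr// -EFinB; apply: le_trans (le_ks_entropy mu T ma).
rewrite lee_fin; apply: limr_ge => //.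
exists 1%N => // m /= m1; rewrite mulrC ler_pdivlMr ?ltr0n// mulrC.
exact: HS.
Qed.

Lemma variational_principle :
  Ptop T psi = ereal_sup [set (ks_entropy T mu + (mean mu psi)%:E)%E | mu in invariant_measures T].
Proof.
apply/eqP; rewrite eq_le; apply/andP; split; last first.
  by apply: ge_ereal_sup => _ [mu muT <-]; exact: goodwyn.
apply: Ptop_le => e e0; rewrite leNgt; apply/negP => /ereal_between_real[c supc csc].
have [mu muT hmu] := misiurewicz e0 csc.
move: supc; rewrite ltNge => /negP; apply; apply: le_trans hmu _.
by apply: ereal_sup_ubound; exists mu.
Qed.

End upper_bound.

(** * Concave functions of Legendre type *)

Lemma continuous_calm {R : realType} {V : normedModType R} (f : V -> R) (z : V) (C d : R) : 0 < d ->
  (forall w, `|w - z| < d -> `|f w - f z| <= C * `|w - z|) -> {for z, continuous f}.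
Proof.
move=> d0 h; apply/cvgrPdist_lt => e e0.
have C1 : 0 < `|C| + 1 by rewrite ltr_wpDl.
near=> w; rewrite distrC.
have dw : `|w - z| < d.
  by rewrite distrC; near: w; have /cvgrPdist_lt := @cvg_id _ (nbhs z); apply.
apply: le_lt_trans (h w dw) _.
apply: (@le_lt_trans _ _ ((`|C| + 1) * `|w - z|)).
  by rewrite ler_wpM2r// (le_trans (ler_norm C))// lerDl.
rewrite mulrC -ltr_pdivlMr// distrC; near: w.
by have /cvgrPdist_lt := @cvg_id _ (nbhs z); apply; rewrite divr_gt0.
Unshelve. all: by end_near. Qed.

(** * Inner products and gradients in the sup norm *)

Section inner_product.
Context {R : realType} {n : nat}.
Implicit Types x y z v w : 'rV[R]_n.

Lemma innerDl v w z : inner (v + w) z = inner v z + inner w z.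
Proof. by rewrite /inner -big_split; apply: eq_bigr => i _; rewrite mxE mulrDl. Qed.

Lemma innerC v w : inner v w = inner w v.
Proof. by apply: eq_bigr => i _; rewrite mulrC. Qed.

Lemma innerZl c v z : inner (c *: v) z = c * inner v z.
Proof. by rewrite /inner mulr_sumr; apply: eq_bigr => i _; rewrite mxE mulrA. Qed.

Lemma innerDr v w z : inner z (v + w) = inner z v + inner z w.
Proof. by rewrite innerC innerDl !(innerC z). Qed.

Lemma innerZr c v z : inner z (c *: v) = c * inner z v.
Proof. by rewrite innerC innerZl (innerC z). Qed.

Lemma innerNl v z : inner (- v) z = - inner v z.
Proof. by rewrite -scaleN1r innerZl mulN1r. Qed.

Lemma innerNr v z : inner z (- v) = - inner z v.
Proof. by rewrite innerC innerNl innerC. Qed.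

Lemma innerBl v w z : inner (v - w) z = inner v z - inner w z.
Proof. by rewrite innerDl innerNl. Qed.

Lemma innerBr v w z : inner z (v - w) = inner z v - inner z w.
Proof. by rewrite innerDr innerNr. Qed.

Lemma inner_delta v i : inner v (delta_mx ord0 i) = v ord0 i.
Proof.
rewrite /inner (bigD1 i)//= mxE !eqxx mulr1 big1 ?addr0// => j /negbTE ji.
by rewrite mxE ji andbF mulr0.
Qed.

Lemma coord_norm v i : `|v ord0 i| <= `|v|.
Proof. by rewrite [leRHS]mx_normrE; exact: (le_bigmax _ (fun ij => `|v ij.1 ij.2|) (ord0, i)). Qed.

Lemma norm_coord v (c : R) : 0 <= c -> (forall i, `|v ord0 i| <= c) -> `|v| <= c.
Proof.
move=> c0 h; rewrite [leLHS]mx_normrE; apply: bigmax_le => // -[i j] _ /=.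
by rewrite (ord1 i).
Qed.

Lemma inner_le v w : `|inner v w| <= n%:R * (`|v| * `|w|).
Proof.
apply: le_trans (ler_norm_sum _ _ _) _.
rewrite -[X in _ <= X%:R * _]card_ord mulr_natl -sumr_const.
by apply: ler_sum => i _; rewrite normrM ler_pM// coord_norm.
Qed.

Lemma inner_self_ge0 v : 0 <= inner v v.
Proof. by apply: sumr_ge0 => i _; rewrite -expr2 sqr_ge0. Qed.

Lemma inner_self_eq0 v : inner v v = 0 -> v = 0.
Proof.
move=> /eqP; rewrite psumr_eq0; last by move=> i _; rewrite -expr2 sqr_ge0.
move=> /allP h; apply/rowP => i; rewrite mxE; apply/eqP.
by have := h i (mem_index_enum _); rewrite /= mulf_eq0 orbb.
Qed.

Lemma inner_continuous_l z : continuous (fun v => inner v z).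
Proof.
move=> v; apply: (@continuous_calm _ _ _ _ (n%:R * `|z|) 1) => // w _.
by rewrite -innerBl; apply: le_trans (inner_le _ _) _; rewrite -mulrA [_ * `|z|]mulrC.
Qed.

Lemma differentiable_gradient (f : 'rV[R]_n -> R) x z :
  (forall e : R, 0 < e -> \forall v \near (0 : 'rV[R]_n),
     `|f (x + v) - f x - inner v z| <= e * `|v|) ->
  differentiable f x /\ gradient f x = z.
Proof.
move=> h; pose L v := inner v z.
have Llin : linear L by move=> c u v; rewrite /L innerDl innerZl.
pose LM := GRing.isLinear.Build _ _ _ _ _ Llin.
pose Ll : {linear 'rV[R]_n -> R} := HB.pack L LM.
have cL : continuous Ll by exact: inner_continuous_l.
have hL : f \o shift x = cst (f x) + Ll +o_ (0 : 'rV[R]_n) id.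
  apply/eqaddoP => e e0; near=> v; rewrite /= !fctE /=.
  rewrite opprD addrA [v + x]addrC; near: v; exact: h.
have dE := diff_unique cL hL.
have df : differentiable f x by apply/diff_locallyP; rewrite dE; split.
split => //; apply/rowP => i; rewrite mxE /partial deriveE// dE /= /L.
by rewrite innerC inner_delta.
Unshelve. all: by end_near. Qed.

Lemma derive_gradient (f : 'rV[R]_n -> R) x v : differentiable f x ->
  'D_v f x = inner v (gradient f x).
Proof.
move=> df; rewrite deriveE// [X in 'd f x X](row_sum_delta v) linear_sum.
by apply: eq_bigr => i _; rewrite linearZ /= mxE /partial deriveE.
Qed.

End inner_product.

Definition usc_on {R : realType} {V : normedModType R} (K : set V) (f : V -> R) :=
  forall x, K x -> forall a, f x < a ->
    exists2 d : R, 0 < d & forall y, K y -> `|y - x| < d -> f y < a.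

(** The superlevel sets at the values of [f] are nested and form a filter base; upper semicontinuity
    makes a cluster point in [K] a maximiser. *)
Lemma compact_usc_max {R : realType} {V : normedModType R} (K : set V) (f : V -> R) :
  compact K -> K !=set0 ->
  usc_on K f -> exists2 z, K z & forall w, K w -> f w <= f z.
Proof.
move=> cK [x0 Kx0] usc.
pose F := filter_from K (fun z => [set w | K w /\ f z <= f w]).
have FF : ProperFilter F.
  apply: filter_from_proper; last by move=> z Kz; exists z; split => //=; exact: lexx.
  apply: filter_from_filter; first by exists x0.
  move=> z1 z2 K1 K2; have [h|h] := leP (f z1) (f z2).
    by exists z2 => // w [Kw h']; split; split => //; exact: le_trans h'.
  by exists z1 => // w [Kw h']; split; split => //; apply: le_trans h'; exact: ltW.
have FK : F K by exists x0 => // w [].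
have [p [Kp clp]] := cK F FF FK; exists p => // w Kw; rewrite leNgt; apply/negP => pw.
have [d d0 hd] := usc _ Kp _ pw.
have Fw : F [set u | K u /\ f w <= f u] by exists w.
have [u [[Ku wu]]] := clp _ _ Fw (nbhsx_ballx p _ d0).
rewrite -ball_normE /= distrC => /(hd _ Ku); rewrite ltNge => /negP; exact.
Qed.

(** A Lipschitz bound between [x] and nearby points, not between arbitrary nearby pairs:
    differentiability at [x] provides it, and steepness forbids it to compensate [f] at a boundary
    maximiser. *)
Definition calm {R : realType} {V : normedModType R} (f : V -> R) (x : V) :=
  exists2 C : R, 0 <= C & exists2 d : R, 0 < d &
    forall w, `|w - x| < d -> `|f w - f x| <= C * `|w - x|.

Lemma usc_on_calmD {R : realType} {V : normedModType R} (K : set V) (g f : V -> R) :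
  (forall x, K x -> calm g x) -> usc_on K f -> usc_on K (fun w => g w + f w).
Proof.
move=> cg uf x Kx a xa; pose e := (a - (g x + f x)) / 2.
have e0 : 0 < e by rewrite divr_gt0// subr_gt0.
have [C C0 [d1 d10 hd1]] := cg x Kx.
have [|d d0 hd] := uf x Kx (f x + e); first by rewrite ltrDl.
have C1 : 0 < C + 1 by rewrite ltr_wpDl.
exists (Num.min (Num.min d d1) (e / (C + 1))).
  by rewrite !lt_min d0 d10 divr_gt0.
move=> w Kw; rewrite !lt_min => /andP[/andP[wd /hd1 w1]].
rewrite ltr_pdivlMr// => we; have := hd w Kw wd.
have := ler_norm (g w - g x); have := normr_ge0 (w - x); move: we w1; rewrite /e.
nra.
Qed.

Lemma calm_usc_on {R : realType} {V : normedModType R} (K : set V) (g : V -> R) :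
  (forall x, K x -> calm g x) -> usc_on K g.
Proof.
move=> cg; rewrite (_ : g = fun w => g w + 0); last by apply/funext => w; rewrite addr0.
apply: usc_on_calmD => // x _ a xa; by exists 1.
Qed.

Lemma closed_norm_ge {R : realType} {V : normedModType R} (a : V) (e : R) :
  closed [set w | e <= `|w - a|].
Proof.
move=> w cw; rewrite /= leNgt; apply/negP => lt.
have d0 : 0 < e - `|w - a| by rewrite subr_gt0.
have [u [/= ue]] := cw _ (nbhsx_ballx w _ d0).
rewrite -ball_normE /= distrC => uw; have := ler_distD w u a; lra.
Qed.

Lemma closed_preimage {R : realType} {V W : normedModType R} (g : V -> W) (C : set W) :
  (forall x (e : R), 0 < e -> exists2 d : R, 0 < d &
     forall y, `|y - x| < d -> `|g y - g x| < e) ->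
  closed C -> closed (g @^-1` C).
Proof.
move=> cg; apply: preimage_closed => x _; apply/cvgrPdist_lt => e e0.
have [d d0 hd] := cg x e e0.
by apply/nbhs_ballP; exists d => // y; rewrite -ball_normE /= distrC => /hd; rewrite distrC.
Qed.

Lemma usc_on_sub {R : realType} {V : normedModType R} (K K' : set V) (f : V -> R) :
  K' `<=` K -> usc_on K f -> usc_on K' f.
Proof.
move=> sK uf x /sK Kx a /(uf x Kx)[d d0 hd]; exists d => // y /sK; exact: hd.
Qed.

Lemma inner_calm {R : realType} {n : nat} (y x : 'rV[R]_n) : calm (inner y) x.
Proof.
exists (n%:R * `|y|); first by rewrite mulr_ge0.
by exists 1 => // w _; rewrite -innerBr -mulrA; exact: inner_le.
Qed.

(** The interface between dynamics and convex analysis: real values on a compact domain, with the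
    entropy bounds 0 and [B], and the regularity class reduced to differentiability in the
    interior. *)
Record legendre_on {R : realType} {n : nat} (K : set 'rV[R]_n) (f : 'rV[R]_n -> R)
    (B : R) : Prop := LegendreOn {
  leg_compact : compact K;
  leg_convex : forall x y (t : R), K x -> K y -> 0 < t < 1 -> K (t *: x + (1 - t) *: y);
  leg_concave : forall x y (t : R), K x -> K y -> 0 < t < 1 ->
    t * f x + (1 - t) * f y <= f (t *: x + (1 - t) *: y);
  leg_usc : usc_on K f;
  leg_ge0 : forall x, K x -> 0 <= f x;
  leg_le : forall x, K x -> f x <= B;
  leg_interior : interior K !=set0;
  leg_strict : strictly_concave_on (interior K) f;
  leg_diff : forall x, interior K x -> differentiable f x;
  leg_steep : forall (x : nat -> 'rV[R]_n) a, (forall i, interior K (x i)) ->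
    boundary K a -> x @ \oo --> a -> `|gradient f (x i)| @[i --> \oo] --> +oo }.

(** * Duality and maximisers for steep concave functions *)

Section legendre.
Context {R : realType} {n : nat}.
Variables (K : set 'rV[R]_n) (f : 'rV[R]_n -> R) (B : R).
Implicit Types x y z w v : 'rV[R]_n.
Hypothesis L : legendre_on K f B.
Local Notation O := (interior K).
Local Notation cK := (leg_compact L).
Local Notation convK := (leg_convex L).
Local Notation uscf := (leg_usc L).
Local Notation f_ge0 := (leg_ge0 L).
Local Notation f_le := (leg_le L).
Local Notation O_neq0 := (leg_interior L).

Lemma interior_normP x : O x <-> exists2 r : R, 0 < r & forall w, `|w - x| < r -> K w.
Proof.
split=> [/nbhs_ballP[r /= r0 h]|[r r0 h]].
  by exists r => // w wx; apply: h; rewrite -ball_normE /= distrC.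
by apply/nbhs_ballP; exists r => // w; rewrite -ball_normE /= distrC; exact: h.
Qed.

Lemma interior_domain x : O x -> K x.
Proof. exact: interior_subset. Qed.

Lemma segmentE x w (t : R) : t *: w + (1 - t) *: x = x + t *: (w - x).
Proof. by rewrite scalerBl scale1r scalerBr addrCA. Qed.

(** By concavity the difference quotients from [x] towards [w] are at least [f w - f x], hence so is
    their limit. *)
Lemma supergradient x w : O x -> K w -> f w <= f x + inner (gradient f x) (w - x).
Proof.
move=> Ox Kw; have Kx := interior_domain Ox; rewrite -lerBlDl innerC -(derive_gradient _ (leg_diff L Ox)).
set v := w - x; set D := 'D_v f x.
have hD : (fun h : R => h^-1 *: (f (h *: v + x) - f x)) @ (0:R)^' --> D.
  exact: (diff_derivable (leg_diff L Ox)).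
rewrite leNgt; apply/negP => lt.
have e0 : 0 < f w - f x - D by rewrite subr_gt0.
have /cvgrPdist_lt/(_ _ e0)/nbhs_ballP[d /= d0 hd] := hD.
pose h := Num.min (d / 2) (1 / 2).
have h0 : 0 < h by rewrite lt_min !divr_gt0.
have h1 : h < 1 by rewrite gt_min; apply/orP; right; lra.
have hd' : h < d by rewrite gt_min; apply/orP; left; lra.
have := hd h; rewrite /ball /= sub0r normrN gtr0_norm// => /(_ hd').
rewrite gt_eqF// => /(_ isT); rewrite ltr_norml => /andP[+ _].
have := @leg_concave _ _ _ _ _ L w x h Kw Kx; rewrite h0 h1 => /(_ isT); rewrite segmentE [x + _]addrC -/v => cc.
rewrite /GRing.scale /= ltrNl opprB ltrBlDr subrK => q.
have : h * (h^-1 * (f (h *: v + x) - f x)) < h * (f w - f x) by rewrite ltr_pM2l.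
rewrite mulVKf ?gt_eqF//; lra.
Qed.

(* At a boundary point such a bound would keep the gradients bounded along the
   segment towards an interior point, against steepness. *)
Lemma steep_interior z (C d : R) : K z -> 0 < d ->
  (forall w, K w -> `|w - z| < d -> f w <= f z + C * `|w - z|) -> O z.
Proof.
move=> Kz d0 calm; apply: contrapT => nOz.
have [z0 Oz0] := O_neq0; have /interior_normP[r r0 hr] := Oz0.
pose t (i : nat) : R := i.+2%:R^-1.
have t01 i : 0 < t i < 1.
  by rewrite /t invr_gt0 ltr0n /= invf_lt1 ?ltr0n// ltr1n.
pose x i := z + t i *: (z0 - z).
have Ox i : O (x i).
  have /andP[t0 t1] := t01 i.
  apply/interior_normP; exists (t i * r); first by rewrite mulr_gt0.
  move=> w wx; have -> : w = t i *: (z0 + (t i)^-1 *: (w - x i)) + (1 - t i) *: z.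
    by apply/rowP => j; rewrite /x !mxE; field; rewrite gt_eqF.
  apply: convK => //.
  apply: hr; rewrite addrC addKr normrZ gtr0_norm ?invr_gt0//.
  by rewrite mulrC ltr_pdivrMr// mulrC.
have t_cvg : t @ \oo --> (0 : R).
  by have := @cvg_harmonic R; rewrite -cvg_shiftS; exact.
have x_cvg : x @ \oo --> z.
  suff : x @ \oo --> z + 0 *: (z0 - z) by rewrite scale0r addr0.
  apply: cvgD; first exact: cvg_cst.
  exact: cvgZr_tmp.
have bz : boundary K z by split => //; exact: subset_closure.
have grad := leg_steep L Ox bz x_cvg.
pose D := `|z0 - z|; pose A := `|C| * D.
have A0 : 0 <= A by rewrite mulr_ge0 ?normr_ge0.
pose G := (r / 2)^-1 * (B + A).
have B0 : 0 <= B by apply: le_trans (f_ge0 Kz) (f_le Kz).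
have r2 : 0 < r / 2 by rewrite divr_gt0.
have bound : \forall i \near \oo, `|gradient f (x i)| <= G.
  have : \forall i \near \oo, `|x i - z| < d.
    by have /cvgrPdist_lt/(_ _ d0) := x_cvg; under eq_near do rewrite distrC.
  apply: filterS => i xd; set g := gradient f (x i); have /andP[t0 t1] := t01 i.
  have xz : `|x i - z| = t i * D.
    by rewrite /x addrC addKr normrZ gtr0_norm.
  (* The supergradient at [x i] is tested at [z]; the assumed bound at [x i] and division by [t i]
     limit the slope towards [z0] by [C * D]. *)
  have gz : inner g (z0 - z) <= A.
    have := supergradient (Ox i) Kz; have := calm _ (interior_domain (Ox i)) xd.
    rewrite xz {2}/x opprD addrA subrr add0r innerNr innerZr -/g => h1 h2.
    have : t i * inner g (z0 - z) <= t i * (C * D) by rewrite mulrCA; lra.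
    rewrite ler_pM2l// => /le_trans; apply.
    by apply: ler_wpM2r; [exact: normr_ge0 | exact: ler_norm].
  (* Testing the supergradient at [z0] moved by [r / 2] along an axis, still in [K], bounds each
     coordinate, since [f] stays between 0 and [B]. *)
  have ge (s : R) j : `|s| = r / 2 -> - (s * g ord0 j) <= B + A.
    move=> sr; pose w := z0 + s *: delta_mx ord0 j.
    have Kw : K w.
      apply: hr; rewrite addrC addKr normrZ sr.
      apply: (@le_lt_trans _ _ (r / 2 * 1)); last by rewrite mulr1 ltr_pdivrMr// ltr_pMr// ltr1n.
      apply: ler_wpM2l; first exact: ltW.
      by apply: norm_coord => // k; rewrite mxE; case: (_ && _); rewrite ?normr1 ?normr0.
    have := supergradient (Ox i) Kw.
    have -> : w - x i = (1 - t i) *: (z0 - z) + s *: delta_mx ord0 j.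
      by apply/rowP => k; rewrite /w /x !mxE; ring.
    rewrite innerDr !innerZr inner_delta -/g => h.
    have := f_ge0 Kw; have := f_le (interior_domain (Ox i)).
    have : (1 - t i) * inner g (z0 - z) <= A.
      have [g0|g0] := leP (inner g (z0 - z)) 0.
        by apply: le_trans A0; rewrite mulr_ge0_le0// subr_ge0 ltW.
      apply: le_trans gz; rewrite ger_pMl// gerBl ltW//.
    lra.
  apply: norm_coord => [|j]; first by rewrite /G mulr_ge0 ?addr_ge0// invr_ge0 ltW.
  rewrite /G mulrC ler_pdivlMr// -{1}(gtr0_norm r2) -normrM ler_norml mulrC.
  have h1 := ge (r / 2) j (gtr0_norm r2).
  have h2 : `|- (r / 2)| = r / 2 by rewrite normrN gtr0_norm.
  have {}h2 := ge _ j h2.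
  by rewrite mulNr opprK in h2; rewrite lerNl h1.
have /cvgryPgt/(_ G) := grad.
move=> /(filterI bound)/filter_ex[i [h1 h2]].
by move: h2; rewrite ltNge h1.
Qed.

Lemma domain_neq0 : K !=set0.
Proof. by have [x Ox] := O_neq0; exists x; exact: interior_domain. Qed.

(** Maximality turns the Lipschitz bound of [g] at [z] into the growth bound on [f] that
    [steep_interior] requires. *)
Lemma calm_max_interior (g : 'rV[R]_n -> R) z : calm g z -> K z ->
  (forall w, K w -> g w + f w <= g z + f z) -> O z.
Proof.
move=> [C C0 [d d0 hd]] Kz hz; apply: (@steep_interior z C d) => // w Kw /hd.
have := hz w Kw; have := ler_norm (g z - g w); rewrite distrC; lra.
Qed.

Definition argmax y : 'rV[R]_n :=
  xget 0 [set z | O z /\ forall w, K w -> inner y w + f w <= inner y z + f z].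

Definition dual y : R := inner y (argmax y) + f (argmax y).

Lemma argmaxP y : O (argmax y) /\ forall w, K w -> inner y w + f w <= dual y.
Proof.
have cy x : calm (inner y) x by exact: inner_calm.
have [z Kz hz] := compact_usc_max cK domain_neq0 (usc_on_calmD (fun x _ => cy x) uscf).
have := @xgetPex _ 0 [set z | O z /\ forall w, K w -> inner y w + f w <= inner y z + f z].
by apply; exists z; split => //; exact: (@calm_max_interior (inner y)).
Qed.

Lemma argmax_O y : O (argmax y). Proof. by have [] := argmaxP y. Qed.

Lemma argmax_K y : K (argmax y). Proof. exact/interior_domain/argmax_O. Qed.

Lemma dual_ge y w : K w -> inner y w + f w <= dual y.
Proof. by have [_] := argmaxP y; exact. Qed.

(** Strict concavity at the midpoint of two maximisers. It is available in the interior only, so [z]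
    is first shown to be interior. *)
Lemma argmax_unique y z : K z -> dual y <= inner y z + f z -> argmax y = z.
Proof.
move=> Kz hz; apply/eqP/negPn/negP => ne.
have Oz : O z.
  apply: (@calm_max_interior (inner y)) => //; first exact: inner_calm.
  by move=> w Kw; exact: le_trans (dual_ge y Kw) hz.
have h01 : 0 < (2^-1 : R) < 1 by apply/andP; split; lra.
have := leg_strict L (argmax_O y) Oz ne h01.
have := dual_ge y (convK (argmax_K y) Kz h01).
rewrite innerDr !innerZr; move: hz; rewrite /dual; lra.
Qed.

Lemma domain_bounded : exists2 D : R, 0 < D & forall x, K x -> `|x| <= D.
Proof.
have [M [_ hM]] := compact_bounded cK; exists (`|M| + 1); first by rewrite ltr_wpDl.
by move=> x Kx; apply: hM => //; rewrite (le_lt_trans (ler_norm M))// ltrDl.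
Qed.

(** On the compact part of [K] at distance at least [e] from [argmax y] the maximum falls short of
    [dual y] by some [g > 0], and a small change of [y] cannot make up for this gap. *)
Lemma argmax_continuous y (e : R) : 0 < e ->
  exists2 d : R, 0 < d & forall y', `|y' - y| < d -> `|argmax y' - argmax y| < e.
Proof.
move=> e0; have [D D0 hD] := domain_bounded.
pose K' := K `&` [set w | e <= `|w - argmax y|].
have cK' : compact K'.
  by apply: compact_closedI; [exact: cK | exact: closed_norm_ge].
have [K'0|/set0P K'0] := eqVneq K' set0.
  exists 1 => // y' _; rewrite ltNge; apply/negP => h.
  have : K' (argmax y') by split => //; exact: argmax_K.
  by rewrite K'0.
have cy x : calm (inner y) x by exact: inner_calm.
have sK : K' `<=` K by move=> w [].
have [w [Kw we] hw] := compact_usc_max cK' K'0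
  (usc_on_sub sK (usc_on_calmD (fun x _ => cy x) uscf)).
have g0 : 0 < dual y - (inner y w + f w).
  rewrite subr_gt0 ltNge; apply/negP => /(argmax_unique Kw) ww.
  by move: we; rewrite /= ww subrr normr0 leNgt e0.
set g := _ - _ in g0; have N0 : 0 < n%:R * (D + D) + 1 by rewrite ltr_wpDl// mulr_ge0// addr_ge0// ltW.
(* The factor [n] comes from bounding inner products by sup norms and [D + D] bounds the diameter of
   [K]; the [+ 1] keeps the divisor positive when [n = 0]. *)
exists (g / (n%:R * (D + D) + 1)); first by rewrite divr_gt0.
move=> y' yy; rewrite ltNge; apply/negP => h.
have := hw _ (conj (argmax_K y') h); have := dual_ge y' (argmax_K y).
have := le_trans (ler_norm _) (inner_le (y' - y) (argmax y' - argmax y)).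
have : n%:R * (`|y' - y| * `|argmax y' - argmax y|) <= n%:R * (D + D) * `|y' - y|.
  rewrite -mulrA (mulrC `|y' - y|); apply: ler_wpM2l; first exact: ler0n.
  apply: ler_wpM2r => //; apply: le_trans (ler_normB _ _) _.
  by apply: lerD; apply: hD; exact: argmax_K.
move: yy; rewrite ltr_pdivlMr// mulrDr mulr1 [_ * (n%:R * _)]mulrC.
have := normr_ge0 (y' - y); rewrite innerBl !innerBr /g /dual; lra.
Qed.

(** The envelope argument: the increment of [dual] along [v] lies between the products of [v] with
    [argmax y] and with [argmax (y + v)], and [argmax] is continuous. *)
Lemma dual_gradient y : differentiable dual y /\ gradient dual y = argmax y.
Proof.
apply: differentiable_gradient => e e0.
have N0 : 0 < n%:R + 1 :> R by rewrite ltr_wpDl.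
have [d d0 hd] := argmax_continuous y (divr_gt0 e0 N0).
apply/nbhs_ballP; exists d => // v; rewrite -ball_normE /= sub0r normrN => vd.
have := hd (y + v); rewrite addrC addKr => /(_ vd); rewrite ltr_pdivlMr// => h.
have h1 := dual_ge (y + v) (argmax_K y); have h2 := dual_ge y (argmax_K (y + v)).
have := le_trans (ler_norm _) (inner_le v (argmax (y + v) - argmax y)).
have : `|v| * (`|argmax (y + v) - argmax y| * (n%:R + 1)) <= `|v| * e.
  by rewrite ler_wpM2l// ltW.
have : n%:R * (`|v| * `|argmax (y + v) - argmax y|) <=
    `|v| * (`|argmax (y + v) - argmax y| * (n%:R + 1)).
  rewrite -subr_ge0 (_ : _ - _ = `|v| * `|argmax (y + v) - argmax y|); last by ring.
  exact: mulr_ge0.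
move: h1 h2; rewrite innerBr /dual !innerDl ler_norml => h1 h2 h3 h4 h5.
by rewrite [e * _]mulrC; apply/andP; split; lra.
Qed.

(** For this parameter the supergradient inequality at [z] says that [z] is a maximiser. *)
Lemma argmax_gradient z : O z -> argmax (- gradient f z) = z.
Proof.
move=> Oz; apply: argmax_unique; first exact: interior_domain.
rewrite /dual; have := supergradient Oz (argmax_K (- gradient f z)).
rewrite innerBr !innerNl; lra.
Qed.

(* y is a supergradient at z + s (z0 - z), s small: its slope along the segment is
   bounded by concavity between s and 2 s, which covers the boundary points z. *)
Lemma dual_le z (e : R) : K z -> 0 < e -> exists y, dual y <= inner y z + f z + e.
Proof.
move=> Kz e0; have [z0 Oz0] := O_neq0; have Kz0 := interior_domain Oz0.
have B0 : 0 <= B by apply: le_trans (f_ge0 Kz) (f_le Kz).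
have [|d d0 hd] := uscf Kz (_ : f z < f z + e / 4); first by rewrite ltrDl divr_gt0.
(* The first bound keeps [s + s] below 1, the second puts [x] within [d] of [z], where [f] is below
   [f z + e / 4], and the third makes [2 * s * B] at most [e / 2]. *)
pose s := Num.min (1 / 4) (Num.min (d / (2 * (`|z0 - z| + 1))) (e / (4 * (B + 1)))).
have D0 : 0 < `|z0 - z| + 1 by rewrite ltr_wpDl.
have B1 : 0 < B + 1 by rewrite ltr_wpDl.
have s0 : 0 < s by rewrite !lt_min !divr_gt0// ?mulr_gt0.
have [s1 [s2 s3]] : s <= 1 / 4 /\ s <= d / (2 * (`|z0 - z| + 1)) /\ s <= e / (4 * (B + 1)).
  by rewrite /s; split; [|split]; rewrite !ge_min lexx ?orbT.
have s01 : 0 < s < 1 by rewrite s0 /=; lra.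
have s01' : 0 < s + s < 1 by apply/andP; split; lra.
have zE u : z + u *: (z0 - z) = u *: z0 + (1 - u) *: z by rewrite segmentE.
pose x := z + s *: (z0 - z).
have Kx2 : K (z + (s + s) *: (z0 - z)) by rewrite zE; exact: convK.
have Ox : O x.
  have /interior_normP[r r0 hr] := Oz0.
  apply/interior_normP; exists (s * r); first by rewrite mulr_gt0.
  move=> w wx; have -> : w = s *: (z0 + s^-1 *: (w - x)) + (1 - s) *: z.
    by apply/rowP => j; rewrite /x !mxE; field; rewrite gt_eqF.
  apply: convK => //.
  apply: hr; rewrite addrC addKr normrZ gtr0_norm ?invr_gt0//.
  by rewrite mulrC ltr_pdivrMr// mulrC.
have xz : `|x - z| < d.
  rewrite /x addrC addKr normrZ gtr0_norm//.
  move: s2; rewrite ler_pdivlMr ?mulr_gt0//; have := normr_ge0 (z0 - z); nra.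
exists (- gradient f x); rewrite /dual argmax_gradient// !innerNl.
have := supergradient Ox Kx2; have := hd _ (interior_domain Ox) xz.
have := leg_concave L Kz0 Kz s01'; rewrite -zE.
have -> : z + (s + s) *: (z0 - z) - x = s *: (z0 - z).
  by apply/rowP => j; rewrite /x !mxE; ring.
have -> : inner (gradient f x) x = inner (gradient f x) z + s * inner (gradient f x) (z0 - z).
  by rewrite -innerZr -innerDr.
rewrite innerZr; have := f_ge0 Kz0; have := f_le Kz; have := f_ge0 Kz.
move: s3; rewrite ler_pdivlMr ?mulr_gt0//.
nra.
Qed.

(* Separation by the Euclidean projection of z onto K. *)
Lemma dual_out z (M : R) : ~ K z -> exists y, M + dual y <= inner y z.
Proof.
move=> nKz; pose q w := inner (w - z) (w - z).
have [p Kp hp] : exists2 p, K p & forall w, K w -> - q w <= - q p.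
  apply: compact_usc_max; [exact: cK | exact: domain_neq0 |].
  apply: calm_usc_on => x _; exists (n%:R * (2 * `|x - z| + 1)).
    by rewrite mulr_ge0// addr_ge0// mulr_ge0.
  exists 1 => // w wx.
  have -> : - q w - - q x = - (inner (w - x) (w - z) + inner (w - x) (x - z)).
    by rewrite /q !innerBl !innerBr (innerC w x) (innerC x z) (innerC w z); ring.
  rewrite normrN -innerDr; apply: le_trans (inner_le _ _) _.
  rewrite -mulrA; apply: ler_wpM2l => //; rewrite mulrC ler_wpM2r//.
  have -> : w - z + (x - z) = w - x + (x - z + (x - z)) by apply/rowP => j; rewrite !mxE; ring.
  have := ler_normD (w - x) (x - z + (x - z)); have := ler_normD (x - z) (x - z); lra.
have q0 : 0 < q p.
  rewrite lt_neqAle inner_self_ge0 andbT eq_sym; apply/eqP => /inner_self_eq0/eqP.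
  by rewrite subr_eq0 => /eqP pz; apply: nKz; rewrite -pz.
have var w : K w -> inner (z - p) (w - p) <= 0.
  move=> Kw; rewrite leNgt; apply/negP => c0; set c := inner _ _ in c0.
  pose N := inner (w - p) (w - p); have N0 : 0 <= N by exact: inner_self_ge0.
  (* Moving from [p] towards [w] by [s] changes the squared distance by [s * (s * N - 2 * c)],
     negative because [s * N <= c]. *)
  pose s := Num.min 2^-1 (c / (N + 1)).
  have s0 : 0 < s by rewrite lt_min invr_gt0 ltr0n divr_gt0// ltr_wpDl.
  have [s1 s2] : s <= 2^-1 /\ s <= c / (N + 1) by rewrite /s; split; rewrite !ge_min lexx ?orbT.
  have s01 : 0 < s < 1 by apply/andP; split; lra.
  have := hp _ (convK Kw Kp s01); rewrite segmentE lerN2 /q.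
  have -> : p + s *: (w - p) - z = s *: (w - p) - (z - p).
    by apply/rowP => j; rewrite !mxE; ring.
  rewrite -[p - z]opprB innerNl innerNr opprK.
  rewrite !(innerBl (s *: _)) !(innerBr (s *: _)) !innerZl !innerZr (innerC (w - p) (z - p)) -/c -/N.
  move: s2; rewrite ler_pdivlMr ?ltr_wpDl//; nra.
(* Scaled so that the gain [t * q p] pays for [M] and for the bound [B] on [f]. *)
pose t := (`|M| + B) / q p.
exists (t *: (z - p)); rewrite /dual !innerZl.
have B0 : 0 <= B by apply: le_trans (f_ge0 Kp) (f_le Kp).
have t0 : 0 <= t by rewrite divr_ge0 ?addr_ge0// ltW.
have /(ler_wpM2l t0) := var _ (argmax_K (t *: (z - p))).
have : t * inner (z - p) (z - p) = `|M| + B.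
  by rewrite -(opprB p z) innerNl innerNr opprK /t divfK// gt_eqF.
rewrite mulr0 !(innerBr _ _ (z - p)) !mulrBr.
have := ler_norm M; have := f_le (argmax_K (t *: (z - p))); lra.
Qed.

(** If [argmax y] is well inside [K], it can be moved by [r / 4] along each axis; by maximality the
    linear gain is at most the loss in [f], hence at most [B]. *)
Lemma argmax_bounded z : O z -> exists2 d : R, 0 < d &
  exists M : R, forall y, `|argmax y - z| < d -> `|y| <= M.
Proof.
move=> /interior_normP[r r0 hr]; exists (r / 2); first by rewrite divr_gt0.
have B0 : 0 <= B by apply: le_trans (f_ge0 (argmax_K 0)) (f_le (argmax_K 0)).
have r4 : 0 < r / 4 by rewrite divr_gt0.
exists (B / (r / 4)) => y yz; apply: norm_coord => [|j]; first by rewrite divr_ge0// ltW.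
rewrite ler_pdivlMr// -{1}(gtr0_norm r4) -normrM.
have ge (s : R) : `|s| = r / 4 -> s * y ord0 j <= B.
  move=> sr; pose w := argmax y + s *: delta_mx ord0 j.
  have Kw : K w.
    apply: hr; rewrite /w addrAC; apply: le_lt_trans (ler_normD _ _) _.
    rewrite normrZ sr.
    have : `|delta_mx ord0 j : 'rV[R]_n| <= 1.
      by apply: norm_coord => // k; rewrite mxE; case: (_ && _); rewrite ?normr1 ?normr0.
    move: yz; nra.
  have := dual_ge y Kw; rewrite /dual innerDr innerZr inner_delta.
  have := f_ge0 Kw; have := f_le (argmax_K y); lra.
have h1 := ge (r / 4) (gtr0_norm r4).
have h2 : `|- (r / 4)| = r / 4 by rewrite normrN gtr0_norm.
have {}h2 := ge _ h2.
by rewrite ler_norml mulrC h1 andbT lerNl -mulNr.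
Qed.

(** Closed by continuity of [argmax]; bounded because compactness of [V] makes the local bounds of
    [argmax_bounded] uniform. *)
Lemma argmax_preimage_compact (V : set 'rV[R]_n) : compact V -> V `<=` O ->
  compact (argmax @^-1` V).
Proof.
move=> cV VO; apply: bounded_closed_compact.
  have /compact_near_coveringP/(_ R +oo (fun M z => forall y, argmax y = z -> `|y| <= M)) := cV.
  case.
    move=> z /VO /argmax_bounded[d d0 [M hM]].
    exists (ball z d, [set r | M < r]); first by split; [exact: nbhsx_ballx | apply: nbhs_pinfty_gt; exact: num_real].
    move=> [w r] [/= + Mr] y yw; rewrite -yw -ball_normE /= distrC => /hM.
    by move=> /le_trans; apply; exact: ltW.
  move=> M [_ hM]; exists M; split; first exact: num_real.
  by move=> r Mr y Vy; exact: (hM r Mr _ Vy).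
apply: closed_preimage; last exact: compact_closed.
by move=> y e; exact: argmax_continuous.
Qed.

Definition argmax_set (F : 'rV[R]_n -> R) : set 'rV[R]_n :=
  [set z | K z /\ forall w, K w -> F w + f w <= F z + f z].

Section perturbation.
Variable F : 'rV[R]_n -> R.
Hypothesis F_calm : forall z, K z -> calm F z.
Local Notation V := (argmax_set F).

Lemma argmax_set_neq0 : V !=set0.
Proof.
by have [z Kz hz] := compact_usc_max cK domain_neq0 (usc_on_calmD F_calm uscf); exists z.
Qed.

Lemma argmax_set_interior : V `<=` O.
Proof. by move=> z [Kz hz]; exact: (@calm_max_interior F) (F_calm Kz) _ _. Qed.

(** The set is the superlevel set of an upper semicontinuous function at its maximum, hence closed
    in [K]. *)
Lemma argmax_set_compact : compact V.
Proof.
apply: (@subclosed_compact _ V K); [|exact: cK | by move=> z []].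
have [z0 [Kz0 h0]] := argmax_set_neq0.
move=> z cz.
have Kz : K z.
  have cl : closed K by apply: compact_closed; [exact: norm_hausdorff | exact: cK].
  by apply: cl; move: cz; apply: closureS => w [].
split => // w Kw; apply: le_trans (h0 w Kw) _; rewrite leNgt; apply/negP => lt.
have [d d0 hd] := usc_on_calmD F_calm uscf Kz lt.
have [u [[Ku hu]]] := cz _ (nbhsx_ballx z _ d0).
rewrite -ball_normE /= distrC => /(hd _ Ku); rewrite ltNge => /negP; apply; exact: hu.
Qed.

End perturbation.

End legendre.

(** * Differentiability of functions of class C^r *)

(** The constant adds 1, for the remainder taken with tolerance 1, to the sup-norm bound on the
    derivative. *)
Lemma differentiable_calm {R : realType} {n : nat} (g : 'rV[R]_n -> R) x :
  differentiable g x -> calm g x.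
Proof.
move=> dg; have /diff_locallyP[_ h] := dg.
exists (1 + n%:R * `|gradient g x|); first by rewrite addr_ge0// mulr_ge0.
have /eqaddoP/(_ _ ltr01)/nbhs_ballP[d /= d0 hd] := h.
exists d => // w wx; have := hd (w - x).
rewrite -ball_normE /= sub0r normrN => /(_ wx); rewrite !fctE /= subrK mul1r -deriveE//.
rewrite derive_gradient// => h1.
have h2 := inner_le (w - x) (gradient g x).
rewrite mulrDl mul1r -mulrA [_ * `|w - x|]mulrC.
apply: le_trans (lerD h1 h2); apply: le_trans (ler_normD _ _).
by rewrite opprD addrA subrK.
Qed.

#[local] Existing Instance totally_filter.

(** * First-order expansion of unconditional power series *)

Section power_series.
Context {R : realType} {n : nat}.
Local Notation index := {ffun 'I_n -> nat}.
Variables (c : index -> R).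

Definition degree (a : index) := (\sum_i a i)%N.

Definition delta_index (i : 'I_n) : index := [ffun j => (j == i) : nat].

(** The multi-indices of the affine part of the series, listed explicitly so that their sum can be
    evaluated. *)
Definition low_indices : seq index := [ffun=> 0%N] :: [seq delta_index i | i <- enum 'I_n].

Lemma low_indices_uniq : uniq low_indices.
Proof.
rewrite /= map_inj_uniq ?enum_uniq ?andbT; last first.
  move=> i j /ffunP/(_ i); rewrite !ffunE eqxx; by case: eqP.
by apply/mapP => -[i _] /ffunP/(_ i); rewrite !ffunE eqxx.
Qed.

Lemma degree_lt2 a : (degree a < 2)%N = (a \in low_indices).
Proof.
rewrite /low_indices inE; apply/idP/orP => [|[/eqP ->|/mapP[i _ ->]]]; last 2 first.
- by rewrite /degree big1// => i _; rewrite ffunE.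
- rewrite /degree (bigD1 i)//= ffunE eqxx big1// => j /negbTE ji.
  by rewrite ffunE ji.
rewrite ltnS leq_eqVlt orbC => /orP[|].
  rewrite ltnS leqn0 /degree sum_nat_eq0 => /forallP h; left; apply/eqP/ffunP => i.
  by rewrite ffunE; apply/eqP; have := h i.
move=> /sum_nat_eq1[i [_ ai h]]; right; apply/mapP; exists i; first exact: mem_enum.
apply/ffunP => j; rewrite ffunE; have [->//|ji] := eqVneq j i; exact: h.
Qed.

Lemma partial_sumE (t : index -> R) (A : {fset index}) :
  partial_sum t A = \sum_(a <- A) t a.
Proof. by rewrite big_seq_fsetE. Qed.

Lemma monomial_const (s : R) a : monomial a (const_mx s) = s ^+ degree a.
Proof. by rewrite /monomial /degree expr_sum; apply: eq_bigr => i _; rewrite mxE. Qed.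

Lemma monomial_le (v : 'rV[R]_n) a : `|monomial a v| <= `|v| ^+ degree a.
Proof.
rewrite /monomial /degree expr_sum normr_prod; apply: ler_prod => i _.
by rewrite normr_ge0 normrX lerXn2r ?nnegrE// coord_norm.
Qed.

(** Beyond [A0] every finite sum is within 1 of [l]. Extending [A0] once by nonnegative terms and
    once by negative ones, and subtracting, gives the absolute sum off [A0], at most 2. *)
Lemma summable_bounded (t : index -> R) (l : R) : partial_sum t @ totally --> l ->
  exists2 M, 0 <= M & forall A : {fset index}, \sum_(a <- A) `|t a| <= M.
Proof.
move=> /cvgrPdist_lt/(_ _ ltr01)[A0 _ hA0].
exists (2 + \sum_(a <- A0) `|t a|); first by rewrite addr_ge0// sumr_ge0.
move=> A; pose E := (A0 `|` A)%fset.
pose Bp := [fset a in E | (a \in A0) || (0 <= t a)]%fset.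
pose Bm := [fset a in E | (a \in A0) || (t a < 0)]%fset.
have sub (P : pred index) : [set B | (A0 `<=` B)%fset] [fset a in E | (a \in A0) || P a]%fset.
  by apply/fsubsetP => a aA; rewrite !inE /= aA.
have := hA0 _ (sub (fun a => 0 <= t a)); have := hA0 _ (sub (fun a => t a < 0)).
rewrite /= !partial_sumE -/Bp -/Bm => hm hp.
have EA : \sum_(a <- A) `|t a| <= \sum_(a <- E) `|t a|.
  rewrite (big_fsetID _ (mem A) E) /= [X in _ <= X + _](_ : _ = \sum_(a <- A) `|t a|).
    by rewrite lerDl sumr_ge0.
  by congr bigop; congr enum_fset; apply/fsetP => a; rewrite !inE andb_idl// => ->; rewrite orbT.
have sumB (P : pred index) : \sum_(a <- [fset a in E | P a]%fset) t a =
    \sum_(a <- E) (if P a then t a else 0).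
  by rewrite big_fset -big_mkcond.
have sumA : \sum_(a <- A0) `|t a| = \sum_(a <- E) (if a \in A0 then `|t a| else 0).
  transitivity (\sum_(a <- [fset a in E | a \in A0]%fset) `|t a|); last first.
    by rewrite big_fset -big_mkcond.
  by congr bigop; congr enum_fset; apply/fsetP => a; rewrite !inE andb_idl// => ->.
apply: le_trans EA _.
have : \sum_(a <- E) `|t a| <= \sum_(a <- Bp) t a - \sum_(a <- Bm) t a + \sum_(a <- A0) `|t a|.
  rewrite sumA /Bp /Bm !sumB -sumrB -big_split /=; apply: ler_sum => a _.
  by case: (ltrP (t a) 0) => ta /=; [rewrite (ltr0_norm ta)|rewrite (ger0_norm ta)];
    case: (a \in A0) => /=; lra.
have := ler_norm (l - \sum_(a <- Bm) t a); have := ler_norm (\sum_(a <- Bp) t a - l).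
rewrite (distrC _ l); lra.
Qed.

(* For |v| <= s = e / 2 the terms of degree at least 2 are bounded by
   (|v| / s)^2 times those at (s, ..., s). *)
Lemma power_series_estimate (x : 'rV[R]_n) (g : 'rV[R]_n -> R) (e : R) : 0 < e ->
  (forall v : 'rV[R]_n, `|v| < e ->
     partial_sum (fun a => c a * monomial a v) @ totally --> g (x + v)) ->
  exists2 M : R, 0 <= M & forall v : 'rV[R]_n, `|v| <= e / 2 ->
    `|g (x + v) - \sum_(a <- low_indices) c a * monomial a v| <= M * `|v| ^+ 2.
Proof.
move=> e0 hg; pose s := e / 2; have s0 : 0 < s by rewrite divr_gt0.
have ns : `|const_mx s : 'rV[R]_n| < e.
  apply: (@le_lt_trans _ _ s); last by rewrite /s ltr_pdivrMr// ltr_pMr// ltr1n.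
  by apply: norm_coord => [|i]; [exact: ltW|rewrite mxE gtr0_norm].
have [M M0 hM] := summable_bounded (hg _ ns).
exists (M / s ^+ 2); first by rewrite divr_ge0// exprn_ge0// ltW.
move=> v vs; have ve : `|v| < e.
  by apply: le_lt_trans vs _; rewrite ltr_pdivrMr// ltr_pMr// ltr1n.
rewrite -[leRHS]addr0; apply/ler_addgt0Pr => eta eta0; rewrite addr0.
have /cvgrPdist_lt/(_ _ eta0)[A0 _ hA0] := hg v ve.
pose L : {fset index} := [fset a in low_indices]%fset; pose A := (A0 `|` L)%fset.
have := hA0 A (fsubsetUl _ _); rewrite partial_sumE => h1.
have split_sum (F : index -> R) : \sum_(a <- A) F a =
    \sum_(a <- low_indices) F a + \sum_(a <- A | a \notin low_indices) F a.
  rewrite (bigID (mem low_indices)) /=; congr (_ + _).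
  rewrite -big_filter; apply: perm_big; apply: uniq_perm.
  - exact/filter_uniq/fset_uniq.
  - exact: low_indices_uniq.
  by move=> a; rewrite mem_filter !inE andb_idr// => ->; rewrite orbT.
have h2 : `|\sum_(a <- A | a \notin low_indices) c a * monomial a v| <=
    M / s ^+ 2 * `|v| ^+ 2.
  apply: le_trans (ler_norm_sum _ _ _) _.
  apply: (@le_trans _ _ (\sum_(a <- A | a \notin low_indices)
      `|c a * monomial a (const_mx s : 'rV[R]_n)| * (`|v| / s) ^+ 2)).
    apply: ler_sum => a; rewrite -degree_lt2 -leqNgt => da.
    rewrite !normrM -mulrA ler_wpM2l//; apply: le_trans (monomial_le v a) _.
    rewrite monomial_const normrX gtr0_norm//.
    rewrite -(subnK da) !exprD.
    set k := (_ - _)%N; have -> : s ^+ k * s ^+ 2 * (`|v| / s) ^+ 2 = s ^+ k * `|v| ^+ 2.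
      by field; rewrite gt_eqF.
    by rewrite ler_wpM2r ?exprn_ge0// lerXn2r ?nnegrE// ltW.
  rewrite -mulr_suml expr_div_n mulrA mulrAC; apply: ler_wpM2r; first exact: exprn_ge0.
  apply: ler_wpM2r; first by rewrite invr_ge0 exprn_ge0// ltW.
  apply: le_trans (hM A); rewrite [leRHS](bigID (mem low_indices)) /= lerDr.
  exact: sumr_ge0.
move: h1; rewrite split_sum => h1.
have := ler_distD (\sum_(a <- low_indices) c a * monomial a v +
  \sum_(a <- A | a \notin low_indices) c a * monomial a v)
  (g (x + v)) (\sum_(a <- low_indices) c a * monomial a v).
rewrite [_ + _ - \sum_(a <- low_indices) _]addrC addKr => h3.
by apply: (le_trans h3); rewrite addrC; apply: lerD => //; exact: ltW.
Qed.

Lemma low_indices_sum (v : 'rV[R]_n) : \sum_(a <- low_indices) c a * monomial a v =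
  c [ffun=> 0%N] + inner v (\row_i c (delta_index i)).
Proof.
rewrite big_cons /monomial big1 ?mulr1; last by move=> i _; rewrite ffunE.
rewrite big_map big_enum /=; congr (_ + _); apply: eq_bigr => i _; rewrite mxE mulrC.
congr (_ * _); rewrite (bigD1 i)//= ffunE eqxx expr1 big1 ?mulr1// => j /negbTE ji.
by rewrite ffunE ji.
Qed.

End power_series.

(** The remainder after the affine part is quadratic, so the linear coefficients form the
    gradient. *)
Lemma real_analytic_differentiable {R : realType} {n : nat} (U : set 'rV[R]_n)
  (g : 'rV[R]_n -> R) x : real_analytic U g -> U x -> differentiable g x.
Proof.
move=> an Ux; have [e e0 [c hg]] := an x Ux.
have [M M0 hM] := power_series_estimate e0 hg.
have g0 : g x = c [ffun=> 0%N].
  have := hM 0; rewrite normr0 divr_ge0 ?(ltW e0)// => /(_ isT).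
  rewrite expr0n /= mulr0 low_indices_sum addr0 normr_le0 -(scale0r 0) innerZl mul0r addr0 subr_eq0.
  by move/eqP.
apply: (proj1 (B := gradient g x = \row_i c (delta_index i))).
apply: differentiable_gradient => eta eta0; apply/nbhs_ballP.
exists (Num.min (e / 2) (eta / (M + 1))) => /=; first by rewrite lt_min !divr_gt0// ltr_wpDl.
move=> v; rewrite -ball_normE /= sub0r normrN lt_min => /andP[v1 v2].
have := hM v (ltW v1); rewrite low_indices_sum g0 opprD addrA => /le_trans; apply.
rewrite expr2 mulrA ler_wpM2r//; move: v2; rewrite ltr_pdivlMr ?ltr_wpDl//.
have := normr_ge0 v; nra.
Qed.

Lemma is_Cr_differentiable {R : realType} {n : nat} r (U : set 'rV[R]_n)
  (g : 'rV[R]_n -> R) x : reg_ge 1 r -> is_Cr r U g -> U x -> differentiable g x.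
Proof.
case: r => [[|k]//|_|_] /=; [by move=> _ [h _]; exact: h | by move=> /(_ 1%N)[h _]; exact: h|].
exact: real_analytic_differentiable.
Qed.

(** * Rotation vectors lie in the convex hull *)

Section caratheodory.
Context {R : realType} {n : nat}.
Variable A : set 'rV[R]_n.

Definition convex_combination (k : nat) (z : 'rV[R]_n) :=
  exists (w : 'I_k -> R) (p : 'I_k -> 'rV[R]_n),
    [/\ forall i, 0 <= w i, \sum_i w i = 1, forall i, A (p i) & z = \sum_i w i *: p i].

Lemma convex_combination_drop k (w : 'I_k.+1 -> R) (p : 'I_k.+1 -> 'rV[R]_n) j :
  (forall i, 0 <= w i) -> \sum_i w i = 1 -> (forall i, A (p i)) -> w j = 0 ->
  convex_combination k (\sum_i w i *: p i).
Proof.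
move=> w0 w1 Ap wj; exists (w \o lift j), (p \o lift j); split => //=.
- by rewrite -w1 (bigD1_ord j)//= wj add0r.
- by rewrite (bigD1_ord j)//= wj scale0r add0r.
Qed.

(** The weights are moved along an affine dependence until one vanishes, which leaves the barycentre
    and the total weight unchanged. *)
Lemma convex_combination_reduce k z : (n < k)%N -> convex_combination k.+1 z ->
  convex_combination k z.
Proof.
move=> nk [w [p [w0 w1 Ap ->]]].
have [[j wj]|nz] := pselect (exists j, w j = 0); first exact: (convex_combination_drop w0 w1 Ap wj).
have wp i : 0 < w i.
  by rewrite lt_neqAle w0 andbT eq_sym; apply/eqP => wi; apply: nz; exists i.
(* A nonzero u in the left kernel is an affine dependence between the points. *)
pose M : 'M[R]_(k.+1, n + 1) := \matrix_(i < k.+1) row_mx (p i) (const_mx 1).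
have [u uM un0] : exists2 u : 'rV_k.+1, u *m M = 0 & u != 0.
  have : kermx M != 0.
    rewrite -mxrank_eq0 mxrank_ker subn_eq0 -ltnNge ltnS.
    by apply: (leq_trans (rank_leq_col M)); rewrite addn1.
  by move=> /rowV0Pn[u /sub_kermxP]; exists u.
have u1 : \sum_i u ord0 i = 0.
  have /rowP/(_ (rshift n ord0)) := uM; rewrite !mxE => uE; rewrite -[RHS]uE.
  by apply: eq_bigr => i _; rewrite !mxE (unsplitK (inr _)) mxE mulr1.
have up : \sum_i u ord0 i *: p i = 0.
  apply/rowP => l; have /rowP/(_ (lshift 1 l)) := uM; rewrite !mxE summxE => uE; rewrite -[RHS]uE.
  by apply: eq_bigr => i _; rewrite !mxE (unsplitK (inl _)).
(* The coordinates of [u] sum to 0 and are not all 0, so one is positive. *)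
have [i0 ui0] : exists i, 0 < u ord0 i.
  apply: contrapT => nex; move/eqP: un0; apply; apply/rowP => i; rewrite mxE.
  have un j : 0 <= - u ord0 j by rewrite oppr_ge0 leNgt; apply/negP => h; apply: nex; exists j.
  have h : \sum_j - u ord0 j = 0 by rewrite sumrN u1 oppr0.
  by have /(_ (fun j _ => un j) h i isT)/eqP := @psumr_eq0P _ _ predT (fun j => - u ord0 j); rewrite oppr_eq0 => /eqP.
(* The smallest ratio over positive [u] is the largest displacement that keeps all weights
   nonnegative, and it cancels the weight of [j]. *)
have [j uj hj] := @arg_minP _ _ _ i0 (fun i => 0 < u ord0 i) (fun i => w i / u ord0 i) ui0.
pose t := w j / u ord0 j; pose w' i := w i - t * u ord0 i.
have -> : \sum_i w i *: p i = \sum_i w' i *: p i.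
  under [RHS]eq_bigr do rewrite scalerBl -scalerA.
  by rewrite sumrB -scaler_sumr up scaler0 subr0.
apply: (@convex_combination_drop _ w' p j) => //.
- move=> i; rewrite subr_ge0; have [ui|ui] := ltP 0 (u ord0 i).
    by rewrite -ler_pdivlMr//; exact: hj.
  by apply: le_trans (w0 i); rewrite mulr_ge0_le0// divr_ge0// ltW.
- by rewrite sumrB -mulr_sumr u1 mulr0 subr0.
- by rewrite /w' /t divfK ?subrr// gt_eqF.
Qed.

Lemma convex_combination_pad k z : convex_combination k z -> convex_combination k.+1 z.
Proof.
move=> [w [p [w0 w1 Ap ->]]]; case: k w p w0 w1 Ap => [|k] w p w0 w1 Ap.
  by move: w1; rewrite big_ord0 => /esym/eqP; rewrite oner_eq0.
exists (fun i => if unlift ord_max i is Some j then w j else 0).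
exists (fun i => if unlift ord_max i is Some j then p j else p ord0); split.
- by move=> i; case: unliftP.
- rewrite (bigD1_ord ord_max)//= unlift_none add0r -w1; apply: eq_bigr => i _.
  by rewrite liftK.
- by move=> i; case: unliftP.
- rewrite [RHS](bigD1_ord ord_max)//= unlift_none scale0r add0r; apply: eq_bigr => i _.
  by rewrite liftK.
Qed.

(** Short combinations are padded and long ones reduced, so that the number of points is the same
    for all [z]. *)
Lemma caratheodory k z : convex_combination k z -> convex_combination n.+1 z.
Proof.
have [kn|/ltnW] := leqP k n.+1.
  by rewrite -(subnK kn); elim: (_ - _)%N => // l ih /ih; exact: convex_combination_pad.
elim: k => // k ih; rewrite leq_eqVlt => /orP[/eqP ->//|].
rewrite ltnS => nk /(convex_combination_reduce nk); exact: ih.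
Qed.

Lemma convex_combination_sub (C : set 'rV[R]_n) k z :
  @convex_set R 'rV[R]_n C -> A `<=` C -> convex_combination k z -> C z.
Proof.
move=> cC AC; elim: k z => [|k ih] z [w [p [w0 w1 Ap ->]]].
  by move: w1; rewrite big_ord0 => /esym/eqP; rewrite oner_eq0.
have [w1'|ne] := eqVneq (w ord0) 1.
  rewrite big_ord_recl w1' scale1r big1 ?addr0; first exact/AC/Ap.
  move: w1; rewrite big_ord_recl w1' => /(canRL (addKr _)); rewrite addrC subrr => h i _.
  have := @psumr_eq0P _ _ predT (fun i => w (lift ord0 i)) (fun i _ => w0 _) h i isT.
  by move=> ->; rewrite scale0r.
have rest : \sum_(i < k) w (lift ord0 i) = 1 - w ord0.
  by rewrite -w1 big_ord_recl addrC addKr.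
have lt1 : w ord0 < 1.
  by rewrite lt_neqAle ne -subr_ge0 -rest sumr_ge0.
have d0 : 0 < 1 - w ord0 by rewrite subr_gt0.
have Cz : C (\sum_(i < k) (w (lift ord0 i) / (1 - w ord0)) *: p (lift ord0 i)).
  apply: ih; exists (fun i => w (lift ord0 i) / (1 - w ord0)), (fun i => p (lift ord0 i)).
  split => //; first by move=> i; rewrite divr_ge0// ltW.
  by rewrite -mulr_suml rest divff// gt_eqF.
pose l : {i01 R} := Itv01 (w0 ord0) (ltW lt1).
have := cC (p ord0) _ l (mem_set (AC _ (Ap ord0))) (mem_set Cz); rewrite inE => h.
have {h} : C (w ord0 *: p ord0 + (1 - w ord0) *:
  \sum_(i < k) (w (lift ord0 i) / (1 - w ord0)) *: p (lift ord0 i)) := h.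
rewrite big_ord_recl scaler_sumr; congr C; congr (_ + _); apply: eq_bigr => i _.
by rewrite scalerA mulrC divfK// gt_eqF.
Qed.

End caratheodory.

Section mean_in_hull.
Context {R : realType} {X : pmetricType R} {n : nat}.
Variables (phi : 'I_n -> X -> R).
Hypothesis cX : compact [set: X].
Hypothesis cphi : forall i, continuous (phi i).
Let vphi (x : X) : 'rV[R]_n := \row_i phi i x.
Let A := [set vphi x | x in [set: X]].

(** The weights are the measures of the cells of a fine partition and the points are chosen in the
    cells: a Riemann sum for all coordinates at once. *)
Lemma mean_approx (mu : probability (borel X) R) (e : R) : 0 < e ->
  exists k z, convex_combination A k z /\ forall j, `|mean mu (phi j) - z ord0 j| <= e.
Proof.
move=> e0.
have /boolp.choice[d hd] : forall j, exists d : R, 0 < d /\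
    forall x y : X, mdist x y < d -> `|phi j x - phi j y| < e.
  by move=> j; have [d d0 h] := continuous_unif cX (@cphi j) e0; exists d.
pose D := \big[Num.min/1]_j d j.
have D0 : 0 < D by apply/bigmin_gtP; split => // j _; have [] := hd j.
have [k [a [ca ha]]] := fine_partition mu cX D0.
have ma := continuity_mlabel ca.
(* A representative of each nonempty cell; an empty cell receives an arbitrary point. *)
have /boolp.choice[r hr] : forall i : 'I_k, exists x : X, forall y, a y = i -> a x = i.
  move=> i; have [[y yi]|ne] := pselect (exists y, a y = i); first by exists y => _ _.
  by exists point => y yi; case: ne; exists y.
exists k, (\sum_i law mu a i *: vphi (r i)); split.
  exists (law mu a), (vphi \o r); split => //.
  - by move=> i; exact: law_ge0.
  - exact: law_sum1.
  - by move=> i; exists (r i).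
move=> j; rewrite summxE.
have -> : \sum_i (law mu a i *: vphi (r i)) ord0 j = avg mu ((phi j \o r) \o a).
  by rewrite (avg_label mu (phi j \o r) ma); apply: eq_bigr => i _; rewrite !mxE.
have mphi : bmeas (phi j : borel X -> R) by exact: continuous_bmeas.
have mr := bmeas_label (phi j \o r) ma.
have close x : `|phi j x - phi j (r (a x))| <= e.
  have [d0 /(_ x (r (a x))) h] := hd j; apply/ltW/h.
  apply: (@lt_le_trans _ _ D); last exact: bigmin_le_cond.
  by apply: ha; rewrite (hr (a x) x).
rewrite -[mean _ _]/(avg mu (phi j : borel X -> R)) ler_norml lerBlDl lerBrDr; apply/andP; split.
  rewrite addrC -[X in _ + X](avg_cst mu) -avgD//; last exact: bmeas_cst.
  apply: le_avg => //; first by apply: bmeasD => //; exact: bmeas_cst.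
  by move=> x /=; have := close x; rewrite ler_norml => /andP[h1 h2]; lra.
rewrite -[X in _ + X](avg_cst mu) -avgD//; last exact: bmeas_cst.
apply: le_avg => //; first by apply: bmeasD => //; exact: bmeas_cst.
by move=> x /=; have := close x; rewrite ler_norml => /andP[h1 h2]; lra.
Qed.

(* Approximate convex combinations have a limit along an ultrafilter because, by
   Caratheodory's theorem, the number of points is bounded. *)
Lemma vec_mean_hull (mu : probability (borel X) R) :
  convex_hull A (vec_mean phi mu).
Proof.
have /boolp.choice[z hz] : forall m : nat, exists z, convex_combination A n.+1 z /\
    forall j, `|mean mu (phi j) - z ord0 j| <= m.+1%:R^-1.
  move=> m; have [|k [z [/caratheodory cz hz]]] := @mean_approx mu m.+1%:R^-1.
    by rewrite invr_gt0 ltr0n.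
  by exists z.
have /boolp.choice[w hw] : forall m, exists w : 'I_n.+1 -> R, exists x : 'I_n.+1 -> X,
    [/\ forall i, 0 <= w i, \sum_i w i = 1 & z m = \sum_i w i *: vphi (x i)].
  move=> m; have [[w [p [w0 w1 Ap ->]]] _] := hz m.
  have /boolp.choice[x hx] : forall i, exists x, vphi x = p i.
    by move=> i; have [x _ <-] := Ap i; exists x.
  by exists w, x; split => //; apply: eq_bigr => i _; rewrite hx.
have {hw}/boolp.choice[x hw] := hw.
have [G [GU Gsub]] := @ultraFilterLemma nat \oo _.
have wc i : cvg (w m i @[m --> G]).
  apply: (ultra_cvg GU); exists 1 => m; have [w0 w1 _] := hw m.
  by rewrite ger0_norm// -w1 (bigD1 i)//= lerDl sumr_ge0.
have /boolp.choice[q hq] : forall i, exists q : X, (fun m => x m i) @ G --> q.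
  move=> i; have := cX; rewrite compact_ultra => /(_ _ (ultra_fmap (fun m => x m i) GU)).
  by case=> [|q [_ hq]]; [exact: filterT | exists q].
pose wl i := lim (w m i @[m --> G]).
have wl_ge0 i : 0 <= wl i.
  by apply: limr_ge => //; apply: nearW => m; have [] := hw m.
have sum_cvg (u : 'I_n.+1 -> nat -> R) (l : 'I_n.+1 -> R) :
    (forall i, u i m @[m --> G] --> l i) -> \sum_i u i m @[m --> G] --> \sum_i l i.
  by move=> h; apply: cvg_big => //; exact: add_continuous.
have wl_sum : \sum_i wl i = 1.
  have h := sum_cvg (fun i m => w m i) wl wc.
  have w1 : (fun m => \sum_i w m i) = cst 1 by apply/funext => m; have [] := hw m.
  rewrite w1 in h; rewrite -[LHS](cvg_lim _ h)//; apply: cvg_lim => //; exact: cvg_cst.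
have -> : vec_mean phi mu = \sum_i wl i *: vphi (q i).
  apply/rowP => j; rewrite summxE mxE.
  have h := sum_cvg (fun i m => w m i * phi j (x m i)) (fun i => wl i * phi j (q i)).
  have {}h : z m ord0 j @[m --> G] --> \sum_i wl i * phi j (q i).
    rewrite (_ : (fun m => _) = fun m => \sum_i w m i * phi j (x m i)); last first.
      apply/funext => m; have [_ _ ->] := hw m; rewrite summxE.
      by apply: eq_bigr => i _; rewrite !mxE.
    apply: h => i; apply: cvgM; first exact: wc.
    exact: (cvg_comp _ _ (hq i) (@cphi j (q i))).
  under [RHS]eq_bigr do rewrite !mxE.
  rewrite -[RHS](cvg_lim _ h)//; apply/esym/cvg_lim => //.
  apply: (@cvg_trans _ ((fun m => z m ord0 j) @ \oo)); first exact: cvg_fmap2.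
  apply/cvgrPdist_le => e e0; near=> m; have [_ /(_ j)/le_trans] := hz m; apply.
  near: m; apply: filterS (near_infty_natSinv_lt (PosNum e0)) => m /ltW.
  exact.
move=> C [cC AC]; apply: (@convex_combination_sub _ _ A C n.+1) => //.
by exists wl, (vphi \o q); split => // i; exists (q i).
Unshelve. all: by end_near. Qed.

End mean_in_hull.

(** * Equilibrium measures *)

Section entropy_function.
Context {R : realType} {X : pmetricType R} {n : nat}.
Variables (T : X -> X) (phi : 'I_n -> X -> R) (r : regularity).
Hypothesis cX : compact [set: X].
Hypothesis cT : continuous T.
Hypothesis cphi : forall i, continuous (phi i).
Hypothesis r1 : reg_ge 1 r.
Hypothesis legT : Cr_Legendre T phi r.
Implicit Types (mu nu : probability (borel X) R) (y z w : 'rV[R]_n).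
Local Notation h := (entropy_fun T phi).
Local Notation K := (dom (entropy_fun T phi)).
Local Notation f := (fine \o entropy_fun T phi).
Local Notation B := (fine (topological_entropy T)).
Local Notation inv := (invariant_measures T).
Local Notation ks := (ks_entropy T).
Local Notation vm := (vec_mean phi).

Lemma topological_entropyE : topological_entropy T = B%:E.
Proof. by rewrite fineK//; case: legT. Qed.

Lemma ks_le_htop mu : inv mu -> (ks mu <= B%:E)%E.
Proof.
move=> imu; rewrite -topological_entropyE /topological_entropy variational_principle//; last by move=> x; exact: cvg_cst.
by apply: ereal_sup_ubound; exists mu => //; rewrite [mean _ _](avg_cst mu 0) adde0.
Qed.

Lemma ks_real mu : inv mu -> exists2 s, 0 <= s & ks mu = s%:E.
Proof.
move=> imu; have := ks_le_htop imu; have := ks_entropy_ge0 mu T.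
by case: (ks mu) => [s|//|//]; rewrite lee_fin => s0 _; exists s.
Qed.

Lemma entropy_ge mu : inv mu -> (ks mu <= h (vm mu))%E.
Proof. by move=> imu; apply: ereal_sup_ubound; exists mu. Qed.

Lemma entropy_le z (c : \bar R) :
  (forall mu, inv mu -> vm mu = z -> (ks mu <= c)%E) -> (h z <= c)%E.
Proof. by move=> H; apply: ge_ereal_sup => _ [mu [imu vz] <-]; exact: H. Qed.

Lemma entropy_le_htop z : (h z <= B%:E)%E.
Proof. by apply: entropy_le => mu imu _; exact: ks_le_htop. Qed.

Lemma entropy_out z : ~ K z -> h z = -oo%E.
Proof.
move=> nK; have := entropy_le_htop z; move: nK; rewrite /dom /=.
by case: (h z) => [s|//|//]; case.
Qed.

(** Finite topological entropy excludes +oo and the measure itself excludes -oo; with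
    [dom_rotation], [K] is the rotation set. *)
Lemma rotation_dom mu : inv mu -> K (vm mu).
Proof.
move=> imu; have := entropy_le_htop (vm mu); have := entropy_ge imu.
have [s s0 ->] := ks_real imu.
by rewrite /dom /=; case: (h (vm mu)).
Qed.

Lemma dom_rotation z : K z -> exists2 mu, inv mu & vm mu = z.
Proof.
move=> Kz; apply: contrapT => nex; move: Kz; rewrite /dom /=.
suff -> : h z = -oo%E by [].
apply/eqP; rewrite -leeNy_eq; apply: entropy_le => mu imu vz.
by case: nex; exists mu.
Qed.

Lemma entropyE z : K z -> h z = (f z)%:E.
Proof. by move=> Kz; rewrite /= fineK. Qed.

Lemma ks_le_entropy mu : inv mu -> exists s, [/\ ks mu = s%:E, 0 <= s & s <= f (vm mu)].
Proof.
move=> imu; have [s s0 e] := ks_real imu; exists s; split => //.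
by rewrite -lee_fin -(entropyE (rotation_dom imu)) -e entropy_ge.
Qed.

Lemma mean_potential mu y : mean mu (potential phi y) = inner y (vm mu).
Proof.
rewrite -[LHS]/(avg mu (fun x : borel X => \sum_(i < n) y ord0 i * phi i x)) avg_sum.
  apply: eq_bigr => i _; rewrite avgZ ?mxE//; exact: continuous_bmeas.
by move=> i; apply/bmeasZ/continuous_bmeas.
Qed.

Lemma potential_continuous y : continuous (potential phi y).
Proof.
move=> x; apply: cvg_big => [|i _]; first exact: add_continuous.
by apply: cvgM; [exact: cvg_cst | exact: cphi].
Qed.

Lemma dom_bounded : bounded_set K.
Proof.
have /boolp.choice[M hM] : forall i, exists M : R, forall x, `|phi i x| <= M.
  by move=> i; have [_ [M hM]] := continuous_bmeas cX (@cphi i); exists M.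
have M0 i : 0 <= M i by apply: le_trans (hM i point).
exists (\sum_i M i); split; first exact: num_real.
move=> c Mc z /dom_rotation[mu imu <-]; apply/ltW; apply: le_lt_trans Mc.
apply: norm_coord => [|i]; first exact: sumr_ge0.
rewrite mxE; apply: (@le_trans _ _ (M i)); last by rewrite (bigD1 i)//= lerDl sumr_ge0.
rewrite -[mean _ _]/(avg mu (phi i : borel X -> R)) ler_norml.
have bphi := continuous_bmeas cX (@cphi i).
rewrite -{1}(avg_cst mu (- M i)) -{2}(avg_cst mu (M i)).
apply/andP; split; apply: le_avg => //; try exact: bmeas_cst.
  by move=> x; have := hM i x; rewrite ler_norml => /andP[].
by move=> x; have := hM i x; rewrite ler_norml => /andP[].
Qed.

Lemma entropy_ge0 z : K z -> 0 <= f z.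
Proof. by move=> /dom_rotation[mu imu <-]; have [s [_ s0 /(le_trans s0)]] := ks_le_entropy imu. Qed.

Lemma entropy_usc x (a : R) : (h x < a%:E)%E ->
  exists2 d : R, 0 < d & forall y, `|y - x| < d -> (h y < a%:E)%E.
Proof.
have [_ _ [_ [usc _] _ _]] := legT => xa.
have := usc x (- a); rewrite EFinN lteN2 => /(_ xa)[V /nbhs_ballP[d /= d0 dV] hV].
exists d => // y yx; have /hV : V y by apply: dV; rewrite -ball_normE /= distrC.
by rewrite EFinN lteN2.
Qed.

(** Off [K] the entropy function is -oo, so upper semicontinuity keeps it negative nearby, whereas
    it is nonnegative on [K]. *)
Lemma dom_closed : closed K.
Proof.
move=> x cx; apply: contrapT => nK.
have [|d d0 hd] := @entropy_usc x 0; first by rewrite entropy_out// ltNyr.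
have [y [Ky]] := cx _ (nbhsx_ballx x _ d0); rewrite -ball_normE /= distrC => /hd.
by rewrite entropyE// lte_fin ltNge entropy_ge0.
Qed.

Lemma dom_concave x y (t : R) : K x -> K y -> 0 < t < 1 ->
  K (t *: x + (1 - t) *: y) /\ t * f x + (1 - t) * f y <= f (t *: x + (1 - t) *: y).
Proof.
move=> Kx Ky t01; have [_ _ [_ [_ conc] _ _]] := legT.
have := conc x y t t01; rewrite (entropyE Kx) (entropyE Ky) -!EFinM -EFinD => le.
have Kz : K (t *: x + (1 - t) *: y).
  apply: contrapT => /entropy_out e; by move: le; rewrite e.
by split => //; rewrite -lee_fin -(entropyE Kz).
Qed.

Lemma entropy_legendre : legendre_on K f B.
Proof.
have [_ _ [_ [_ _] [nO st Cr _] steep]] := legT.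
split => //.
- exact: bounded_closed_compact dom_bounded dom_closed.
- by move=> x y t Kx Ky t01; have [] := dom_concave Kx Ky t01.
- by move=> x y t Kx Ky t01; have [] := dom_concave Kx Ky t01.
- move=> x Kx a xa; have [|d d0 hd] := @entropy_usc x a; first by rewrite entropyE// lte_fin.
  by exists d => // y Ky /hd; rewrite entropyE// lte_fin.
- exact: entropy_ge0.
- by move=> x Kx; rewrite -lee_fin -entropyE// entropy_le_htop.
- by move=> x Ox; exact: is_Cr_differentiable r1 Cr Ox.
Qed.

Local Notation L := entropy_legendre.
Local Notation P := (pressure_fun T phi).
Local Notation dualf := (dual K f).

(** Grouping measures by rotation vector turns the variational principle into a maximum over [K]; at
    the maximiser [h] is itself a supremum over measures, so none attaining it has to be
    produced. *)
Lemma pressureE y : P y = (dualf y)%:E.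
Proof.
rewrite /pressure_fun variational_principle//; last exact: potential_continuous.
apply/eqP; rewrite eq_le; apply/andP; split.
  apply: ge_ereal_sup => _ [mu imu <-]; rewrite mean_potential.
  have [s [-> _ sf]] := ks_le_entropy imu; rewrite -EFinD lee_fin addrC.
  by apply: le_trans (dual_ge L y (rotation_dom imu)); rewrite lerD2l.
have Kz := argmax_K L y; set S := ereal_sup _.
rewrite /dual EFinD -entropyE// addeC -leeBrDr//.
apply: entropy_le => mu imu vz; rewrite leeBrDr// -vz -mean_potential.
by apply: ereal_sup_ubound; exists mu.
Qed.

Lemma pressure_sup y : P y = ereal_sup [set ((inner y z)%:E + h z)%E | z in setT].
Proof.
rewrite pressureE; apply/eqP; rewrite eq_le; apply/andP; split.
  rewrite /dual EFinD -entropyE; last exact: (argmax_K L y).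
  by apply: ereal_sup_ubound; exists (argmax K f y).
apply: ge_ereal_sup => _ [z _ <-]; have [Kz|nK] := pselect (K z).
  by rewrite entropyE// -EFinD lee_fin; exact: (dual_ge L).
by rewrite entropy_out// addeNy leNye.
Qed.

Lemma fine_pressure : fine \o P = dualf.
Proof. by apply/funext => y; rewrite /= pressureE. Qed.

(** On [K], boundary included, [dual_le] provides nearly optimal parameters; off [K], separation
    makes the supremum infinite. *)
Lemma legendre_dual_pressure z : (- h z)%E = legendre_dual P z.
Proof.
rewrite /legendre_dual; have [Kz|nK] := pselect (K z).
  rewrite entropyE// -EFinN; apply/eqP; rewrite eq_le; apply/andP; split.
    apply/lee_addgt0Pr => e e0; have [y hy] := dual_le L Kz e0.
    apply: (@le_trans _ _ ((inner y z)%:E - P y + e%:E)%E); last first.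
      by rewrite leeD2r//; apply: ereal_sup_ubound; exists y.
    by rewrite pressureE -EFinB -EFinD lee_fin; lra.
  apply: ge_ereal_sup => _ [y _ <-]; rewrite pressureE -EFinB lee_fin.
  have := dual_ge L y Kz; lra.
rewrite entropy_out//=; apply/esym/eqyP => M M0.
have [y hy] := dual_out L M nK.
apply: (@le_trans _ _ ((inner y z)%:E - P y)%E); last first.
  by apply: ereal_sup_ubound; exists y.
by rewrite pressureE -EFinB lee_fin; lra.
Qed.

Section nonlinear.
Variables (U : set 'rV[R]_n) (F : 'rV[R]_n -> R).
Hypothesis hull_U : convex_hull [set \row_i phi i x | x in [set: X]] `<=` U.
Hypothesis F_Cr : is_Cr r U F.
Local Notation V := (argmax_set K f F).

(** Every point of [K] is a mean, hence in the convex hull and in [U], where [F] is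
    differentiable. *)
Lemma nonlinearity_calm z : K z -> calm F z.
Proof.
move=> /dom_rotation[mu _ <-]; apply/differentiable_calm/(is_Cr_differentiable r1 F_Cr).
by apply: hull_U; exact: vec_mean_hull.
Qed.

Lemma maximizersE : maximizers T phi F = V.
Proof.
have [z0 [Kz0 hz0]] := argmax_set_neq0 L nonlinearity_calm.
have supE : ereal_sup [set (h z' + (F z')%:E)%E | z' in setT] = (F z0 + f z0)%:E.
  apply/eqP; rewrite eq_le; apply/andP; split.
    apply: ge_ereal_sup => _ [w _ <-]; have [Kw|nK] := pselect (K w).
      by rewrite entropyE// -EFinD lee_fin addrC hz0.
    by rewrite entropy_out// addNye leNye.
  by apply: ereal_sup_ubound; exists z0 => //; rewrite entropyE// -EFinD addrC.
apply/seteqP; split => z; rewrite /maximizers /= supE.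
  move=> e; have Kz : K z by apply: contrapT => /entropy_out hz; rewrite hz in e.
  split => // w Kw; move: e; rewrite entropyE// -EFinD => -[] e.
  by rewrite [leRHS]addrC e hz0.
move=> [Kz hz]; rewrite entropyE// -EFinD addrC; congr EFin.
by apply/eqP; rewrite eq_le hz0// hz.
Qed.

Lemma parameter_setE : parameter_set T phi F = argmax K f @^-1` V.
Proof.
rewrite /parameter_set fine_pressure maximizersE.
rewrite (_ : gradient dualf = argmax K f)//; apply/funext => y.
by have [] := dual_gradient L y.
Qed.

(** Each kind of equilibrium forces the entropy of [mu] to be maximal among measures with its
    rotation vector; what remains is that [argmax] links [y] with that vector. *)
Lemma nonlinear_linear mu :
  nonlinear_equilibrium T (fun nu => F (vm nu)) mu <->
  exists2 y, parameter_set T phi F y & linear_equilibrium T (potential phi y) mu.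
Proof.
rewrite parameter_setE.
have linE y : linear_equilibrium T (potential phi y) mu <->
    inv mu /\ (ks mu + (inner y (vm mu))%:E)%E = (dualf y)%:E.
  rewrite /linear_equilibrium mean_potential -variational_principle//.
    by rewrite -[Ptop _ _]/(P y) pressureE.
  exact: potential_continuous.
split=> [[imu H]|[y Vy /linE[imu H]]].
  have [s [ksE s0 sf]] := ks_le_entropy imu; have Kz := rotation_dom imu.
  (* Measures with mean [w] are compared with [mu] one by one. Applied at other [w] this puts
     [vm mu] in [V]; applied at [vm mu] it gives [s = f (vm mu)]. *)
  have le w : K w -> f w <= s + F (vm mu) - F w.
    move=> Kw; rewrite -lee_fin -entropyE//; apply: entropy_le => nu inu vw.
    have := H nu inu; have [s' [-> _ _]] := ks_le_entropy inu.
    by rewrite ksE vw -!EFinD !lee_fin; lra.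
  have Vz : V (vm mu) by split => // w /le; lra.
  exists (- gradient f (vm mu)).
    by rewrite /= (argmax_gradient L)//; exact: (argmax_set_interior L nonlinearity_calm).
  apply/linE; split => //; rewrite ksE -EFinD; congr EFin.
  rewrite /dual (argmax_gradient L); last exact: (argmax_set_interior L nonlinearity_calm).
  have := le _ Kz; lra.
have [s [ksE s0 sf]] := ks_le_entropy imu; have Kz := rotation_dom imu.
move: H; rewrite ksE -EFinD => -[] H.
(* Since [s] is at most [f (vm mu)], linear equilibrium makes [vm mu] a maximiser, and uniqueness
   identifies it. *)
have az : argmax K f y = vm mu by apply: (argmax_unique L) => //; lra.
move: Vy; rewrite /= az => -[_ Vz]; have := dual_ge L y Kz => h1.
split => // nu inu; have [s' [-> _ s'f]] := ks_le_entropy inu.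
have := Vz _ (rotation_dom inu); rewrite ksE -!EFinD lee_fin; lra.
Qed.

End nonlinear.

End entropy_function.

Theorem mainTheorem4 (R : realType) (X : pmetricType R)
    (X_compact : compact [set: X])
    (T : X -> X) (T_cont : continuous T)
    (n : nat) (phi : 'I_n -> X -> R)
    (phi_cont : forall i, continuous (phi i))
    (r : regularity) (r_ge1 : reg_ge 1 r)
    (legT : Cr_Legendre T phi r)
    (U : set 'rV[R]_n) (U_open : open U)
    (hull_U : convex_hull [set \row_i phi i x | x in [set: X]] `<=` U)
    (F : 'rV[R]_n -> R) (F_Cr : is_Cr r U F) :
  let P := pressure_fun T phi in
  let h := entropy_fun T phi in
  let Y := parameter_set T phi F in
  let E := fun mu : probability (borel X) R => F (vec_mean phi mu) in
  (forall y, P y \is a fin_num /\ differentiable (fine \o P) y) /\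
  [/\ Y !=set0,
      compact Y &
      forall mu : probability (borel X) R,
        nonlinear_equilibrium T E mu <->
        exists2 y, Y y & linear_equilibrium T (potential phi y) mu] /\
  (forall y, P y = ereal_sup [set ((inner y z)%:E + h z)%E | z in setT]) /\
  (forall z, (- h z)%E = legendre_dual P z).
Proof.
move=> P h Y E.
have L := entropy_legendre X_compact T_cont phi_cont r_ge1 legT.
have Fc : forall z, dom h z -> calm F z by apply: nonlinearity_calm; eassumption.
have pE := pressureE X_compact T_cont phi_cont r_ge1 legT.
have YE := parameter_setE X_compact T_cont phi_cont r_ge1 legT hull_U F_Cr.
have VO := argmax_set_interior L Fc.
split; [|split; [split|split]].
- move=> y; rewrite /P pE; split => //.
  rewrite (fine_pressure X_compact T_cont phi_cont r_ge1 legT).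
  by have [] := dual_gradient L y.
- have [z Vz] := argmax_set_neq0 L Fc; rewrite /Y YE.
  (* [z] is interior, so [argmax_gradient] exhibits a parameter sent to it. *)
  by exists (- gradient (fine \o h) z); rewrite /= (argmax_gradient L)//; exact: VO.
- by rewrite /Y YE; exact: (argmax_preimage_compact L (argmax_set_compact L Fc) VO).
- exact: (nonlinear_linear X_compact T_cont phi_cont r_ge1 legT hull_U F_Cr).
- exact: (pressure_sup X_compact T_cont phi_cont r_ge1 legT).
- exact: (legendre_dual_pressure X_compact T_cont phi_cont r_ge1 legT).
Qed.
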